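(* Let $d\ge2$, let $t_1,t_2,t_3\in\mathbb{P}^1$ be distinct points, let $\varepsilon\in\{1,-1\}$, and let $C_1,C_2,C_3$ be conjugacy classes in $G_\varepsilon$ (where $G_1=O(r)$ and $G_{-1}=Sp(r)$). If the quadratic relative character variety $\mathscr{X}^{\mathrm{irred}}(r,\varepsilon,C_1,C_2,C_3)$ on $\mathbb{P}^1\setminus\{t_1,t_2,t_3\}$ is numerically MC-minimal and has dimension $d$, then $r\le 9d+54$.
   Context: $O(r)$ (resp. $Sp(r)$) is the group of linear transformations of an $r$-dimensional complex vector space preserving a symmetric (resp. antisymmetric) nondegenerate bilinear form. For conjugacy classes $C_i\subset G_\varepsilon$, $$\mathscr{X}^{\mathrm{irred}}(r,\varepsilon,C_1,C_2,C_3)=\{\rho:\pi_1(\mathbb{P}^1\setminus\{t_1,t_2,t_3\})\to G_\varepsilon\ :\ \rho\text{ irreducible (as an }r\text{-dimensional representation)},\ \rho(\gamma_i)\in C_i\}/G_\varepsilon,$$ where $\gamma_i$ is the loop around $t_i$ and $G_\varepsilon$ acts by simultaneous conjugation. When non-empty, its dimension is $\dim C_1+\dim C_2+\dim C_3-2\dim G_\varepsilon$. Numerical data. To an eigenvalue $z$ of an element of $C_i$ attach the partition dual to its Jordan block partition, with parts (for $j\ge 1$) the number of Jordan blocks of size $\ge j$ with eigenvalue $z$ (in the semisimple case this is a single part, the multiplicity of $z$). Eigenvalues with $z\ne z^{-1}$ come in pairs $z,z^{-1}$ having the same parts; the parts from one member of each such pair, collected over all pairs and put in decreasing order, are denoted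 $m_i^0\ge m_i^1\ge\cdots$ (type $m$; each accounts for two equal parts). The parts attached to the eigenvalues $1$ and $-1$ give two decreasing sequences, denoted $e_i^0\ge e_i^1\ge\cdots$ and $f_i^0\ge f_i^1\ge\cdots$, with the labels chosen so that $e_i^0\ge f_i^0$. Thus $\sum_je_i^j+\sum_jf_i^j+2\sum_jm_i^j=r$. Absent terms are taken to be $0$. The character variety, of rank $r>2$, is called numerically MC-minimal if the following inequalities hold, together with all those obtained by permuting the indices $1,2,3$ of the points: - $m_1^j+m_2^j+m_3^j\le r$ for all $j$; - $e_1^0+e_2^0+e_3^0\le r$; - $m_1^j+m_2^j+e_3^0\le r$ for all $j$; - $m_1^0+e_2^0+(e_3^0+f_3^0)/2\le r$; - $m_1^0+e_2^0+(e_3^0+e_3^1)/2\le r$. *)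

(* Defs.v *)
From HB Require Import structures.
From mathcomp Require Import all_boot all_order all_algebra.
From mathcomp Require Import boolp classical_sets reals.
From mathcomp Require Import complex.
Set Implicit Arguments.
Unset Strict Implicit.
Unset Printing Implicit Defensive.
Import Order.TTheory GRing.Theory Num.Theory.
Local Open Scope classical_set_scope.
Local Open Scope ring_scope.

(* As everywhere in MathComp, a matrix g acts on row vectors by v |-> v *m g;
   B is the Gram matrix of the bilinear form (u, v) |-> u *m B *m v^T. *)

Section Group.
Variables (F : fieldType) (r : nat).
Implicit Types (B g h X : 'M[F]_r).

Definition nondegenerate_form (eps : int) B : Prop :=
  B \in unitmx /\ B^T = eps%:~R *: B.

(* O(r) or Sp(r), according to the symmetry of B. *)
Definition form_group B : set 'M[F]_r := [set g | g *m B *m g^T = B].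

Definition conj_class B g : set 'M[F]_r :=
  [set invmx h *m g *m h | h in form_group B].

(* The Lie algebra of [form_group B] is the kernel of the differential at 1 of
   g |-> g *m B *m g^T. *)
Definition dform B X : 'M[F]_r := X *m B + B *m X^T.

Fact dform_is_linear B : linear (dform B).
Proof.
move=> a X Y; rewrite /dform linearD linearZ /= mulmxDl mulmxDr.
by rewrite -scalemxAl -scalemxAr scalerDr addrACA.
Qed.

HB.instance Definition _ B :=
  GRing.isLinear.Build F 'M[F]_r 'M[F]_r *:%R (dform B) (dform_is_linear B).

Definition lie_algebra B : {vspace 'M[F]_r} := lker (linfun (dform B)).

Lemma mem_lie_algebra B X :
  (X \in lie_algebra B) = (X *m B + B *m X^T == 0).
Proof. by rewrite memv_ker lfunE. Qed.

(* [dconj g] is the differential at h = 1 of h |-> invmx h *m g *m h, so that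
   the image of the Lie algebra is the tangent space at g of the class of g. *)
Definition dconj g X : 'M[F]_r := g *m X - X *m g.

Fact dconj_is_linear g : linear (dconj g).
Proof.
move=> a X Y; rewrite /dconj mulmxDr mulmxDl -scalemxAl -scalemxAr scalerBr.
by rewrite opprD addrACA.
Qed.

HB.instance Definition _ g :=
  GRing.isLinear.Build F 'M[F]_r 'M[F]_r *:%R (dconj g) (dconj_is_linear g).

Definition class_tangent B g : {vspace 'M[F]_r} :=
  (linfun (dconj g) @: lie_algebra B)%VS.

(* [form_group B] and its conjugacy classes are smooth and homogeneous: their
   dimension is that of their tangent space at any point. *)
Definition group_dim B : nat := \dim (lie_algebra B).
Definition class_dim B g : nat := \dim (class_tangent B g).

End Group.

Section CharacterVariety.
Variables (F : fieldType) (r : nat).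
Implicit Types (B : 'M[F]_r) (c rho : 'I_3 -> 'M[F]_r).

(* The fundamental group of the thrice-punctured sphere is generated by the
   loops gamma_0, gamma_1, gamma_2 with the single relation
   gamma_0 gamma_1 gamma_2 = 1; a representation rho is given by the images
   rho i of the gamma_i. *)
Definition is_representation B rho : Prop :=
  (forall i, form_group B (rho i)) /\ \big[mulmx/1%:M]_(i < 3) rho i = 1%:M.

Definition irreducible_rep rho : Prop :=
  (0 < r)%N /\
  forall U : 'M[F]_r, (forall i, stablemx U (rho i)) ->
    \rank U = 0%N \/ \rank U = r.

(* c i is an element of the i-th conjugacy class. *)
Definition irred_reps B c : set ('I_3 -> 'M[F]_r) :=
  [set rho | [/\ is_representation B rho, irreducible_rep rho
               & forall i, conj_class B (c i) (rho i)]].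

Definition conj_orbit B rho : set ('I_3 -> 'M[F]_r) :=
  [set (fun i => invmx h *m rho i *m h) | h in form_group B].

Definition char_variety B c : set (set ('I_3 -> 'M[F]_r)) :=
  [set conj_orbit B rho | rho in irred_reps B c].

(* When nonempty, the variety has pure dimension
   dim C_1 + dim C_2 + dim C_3 - 2 dim G. *)
Definition char_variety_has_dim B c (d : nat) : Prop :=
  char_variety B c !=set0 /\
  (\sum_(i < 3) class_dim B (c i) = d + 2 * group_dim B)%N.

End CharacterVariety.

Section Jordan.
Variable F : fieldType.

Definition jordan_block (z : F) (n : nat) : 'M[F]_n :=
  \matrix_(i, j) (z *+ (i == j) + (i.+1 == j :> nat)%:R).

(* A Jordan type lists the blocks as pairs (eigenvalue, size). *)
Definition jordan_type : Type := seq (F * nat).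

Definition block_value (s : jordan_type) (k : nat) : F :=
  nth 0 [seq b.1 | b <- s] k.
Definition block_size (s : jordan_type) (k : nat) : nat :=
  nth 0%N [seq b.2 | b <- s] k.

Definition jordan_mx (s : jordan_type) :
    'M[F]_(\sum_(k < size s) block_size s k) :=
  \mxdiag_(k < size s) jordan_block (block_value s k) (block_size s k).

(* Similarity, phrased with mutually inverse rectangular matrices because the
   size of [jordan_mx s] is not syntactically r. *)
Definition has_jordan_type (r : nat) (g : 'M[F]_r) (s : jordan_type) : Prop :=
  all (fun b => 0 < b.2)%N s /\
  exists P Q, [/\ P *m Q = 1%:M, Q *m P = 1%:M & g = P *m jordan_mx s *m Q].

(* Number of Jordan blocks of size >= j + 1 with eigenvalue z; the indices j
   start at 0. *)
Definition dual_part (s : jordan_type) (z : F) (j : nat) : nat :=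
  count (fun b => (b.1 == z) && (j < b.2)%N) s.

(* One member of each pair {z, z^-1} of eigenvalues with z != z^-1. *)
Definition pair_reps (s : jordan_type) : seq F :=
  foldr (fun z zs => if (z == z^-1) || (z^-1 \in zs) then zs else z :: zs)
    [::] (undup [seq b.1 | b <- s]).

(* [\max_(b <- s) b.2] bounds the number of nonzero parts at each eigenvalue;
   the zero parts that this enumerates are sorted last. *)
Definition m_part (s : jordan_type) (j : nat) : nat :=
  nth 0%N (sort geq (flatten
    [seq mkseq (dual_part s z) (\max_(b <- s) b.2) | z <- pair_reps s])) j.

(* The labels e, f are chosen so that f_part s 0 <= e_part s 0.  In case of a
   tie the choice does not affect [MC_inequalities]: the fourth inequality then
   implies the fifth for both choices. *)
Definition e_value (s : jordan_type) : F :=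
  if (dual_part s (-1) 0 <= dual_part s 1 0)%N then 1 else -1.
Definition e_part (s : jordan_type) : nat -> nat := dual_part s (e_value s).
Definition f_part (s : jordan_type) : nat -> nat := dual_part s (- e_value s).

Definition MC_inequalities (r : nat) (s : 'I_3 -> jordan_type) : Prop :=
  let m i := m_part (s i) in
  let e i := e_part (s i) in
  let f i := f_part (s i) in
  forall i1 i2 i3 : 'I_3, uniq [:: i1; i2; i3] ->
  [/\ forall j, (m i1 j + m i2 j + m i3 j <= r)%N,
      (e i1 0 + e i2 0 + e i3 0 <= r)%N,
      forall j, (m i1 j + m i2 j + e i3 0 <= r)%N,
      (m i1 0%N)%:R + (e i2 0%N)%:R + (e i3 0 + f i3 0)%N%:R / 2 <= r%:R :> rat
    & (m i1 0%N)%:R + (e i2 0%N)%:R + (e i3 0 + e i3 1)%N%:R / 2 <= r%:R :> rat].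

End Jordan.

(* The Jordan type of c i exists and is unique up to permutation of the blocks,
   on which the inequalities do not depend. *)
Definition numerically_MC_minimal (F : fieldType) (r : nat)
    (c : 'I_3 -> 'M[F]_r) : Prop :=
  (2 < r)%N /\
  exists s : 'I_3 -> jordan_type F,
    (forall i, has_jordan_type (c i) (s i)) /\ MC_inequalities r s.

(* Main.v *)
(* Since 2 dim G = r^2 - eps r, the hypothesis on the dimension says that
   2 d = r^2 - eps r - sum_i 2 dim Z(c_i), where Z(g) is the centralizer of g
   in the Lie algebra.  Through X |-> X B the algebra Z(g) becomes a space of
   (skew-)symmetric matrices W with g W g^T = W; in a basis where g is a sum of
   Cayley blocks z (1 + N)/(1 - N), the invariance is homogeneous in N and W is
   determined by the free entries of its blocks with inverse eigenvalues.
   Counting them, 2 dim Z(g) is the sum of the squares of the parts minus eps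
   times the number of odd Jordan blocks at 1 and -1, an alternating sum of the
   parts at 1 and of those at -1.

   What remains is a statement on three partitions of r.  If the largest parts
   p_i add up to at most r, then up to the signed terms 2 d is
   r (r - sum p_i) + sum_i sum_q q (p_i - q), which is small only if every
   partition consists, up to a few units, of parts 0 and p_i; the p_i are then
   close to r/3, r/3, r/3, or to r/2, r/4, r/4, or to r/2, r/3, r/6, or to
   r/2, r/2, 1, and these cases are treated separately.  Otherwise the
   inequalities force the largest part to be of type m at one point and of
   type e at the two others, and the parts other than the two largest ones are
   weighed instead. *)

From HB Require Import structures.
Require Import Defs.
From mathcomp Require Import all_boot all_order all_algebra.
From mathcomp Require Import boolp classical_sets reals.
From mathcomp Require Import complex.
From mathcomp Require Import zify ring lra.
Set Implicit Arguments.
Unset Strict Implicit.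
Unset Printing Implicit Defensive.
Import Order.TTheory GRing.Theory Num.Theory.
Local Open Scope ring_scope.

(** * Bounds for sums of parts *)

(** The proof is by contradiction with [D] = 2d: if r > 9d + 54 then 9D < 2r - 108, and d >= 2 gives
    D >= 4 and r >= 73. The obstacle is that the signed terms can reach size r, beyond the target
    2r/9, so positivity of the costs alone does not conclude. When the largest parts fill the rank,
    the exceptional shapes have p_i near r/k_i with 1/k_1 + 1/k_2 + 1/k_3 = 1, that is (3,3,3),
    (2,4,4), (2,3,6) or the limit (2,2,infinity); there the terms in r^2 cancel. Convexity bounds D
    above by r times a linear form in the signs t_i and the small parts s_i, plus a constant below
    4. As D >= 4, this form is positive: either the signs cause no loss, or there must be small
    parts. Comparing ranks then bounds the deficits v_i from below, and the cost of small parts and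
    deficits exceeds the signed loss by more than 2r/9. *)

Lemma gap_sum (s : seq nat) (p k : int) :
  0 <= k -> all (fun q : nat => q%:Z <= p) s ->
  let S := \sum_(q <- s) q%:Z in
  (S - k * p) * ((k + 1) * p - S) <= \sum_(q <- s) q%:Z * (p - q%:Z).
Proof.
move=> + /=; elim: s k => [|q s IH] k k0 /=.
  move=> _; rewrite !big_nil; nia.
case/andP=> qp sp; rewrite !big_cons.
have S0 : 0 <= \sum_(j <- s) j%:Z by apply: sumr_ge0.
set S := \sum_(j <- s) j%:Z in S0 *.
set C := \sum_(j <- s) _.
(* If k is the quotient of the sum by p, the bound is the cost of the remainder, full parts p
   costing nothing; for other k it is at most 0. Adding q uses the induction hypothesis at k if k p
   <= S and at k - 1 otherwise. *)
have [le_kp|lt_kp] := lerP (k * p) S.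
  have := IH k k0 sp; rewrite -/S -/C => IHk.
  have : 0 <= q%:Z * (S - k * p) by apply: mulr_ge0; lia.
  nia.
have k1 : 0 <= k - 1 by nia.
have := IH (k - 1) k1 sp; rewrite -/S -/C => IHk.
have : 0 <= (k * p - S) * (p - q%:Z) by apply: mulr_ge0; lia.
nia.
Qed.

(** By concavity of q (c - q), one part between l and c - l already costs l (c - l); if all parts
    are below l, each unit of their sum costs at least c - l. *)
Lemma truncated_sum (s : seq nat) (c l : int) :
  0 <= l -> all (fun q : nat => q%:Z <= c - l) s ->
  l <= \sum_(q <- s) q%:Z ->
  l * (c - l) <= \sum_(q <- s) q%:Z * (c - q%:Z).
Proof.
move=> l0 sc lS.
have [/hasP[q0 q0s lq0]|/hasPn lts] := boolP (has (fun q : nat => l <= q%:Z) s).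
  have cl q : q \in s -> q%:Z <= c - l by move=> qs; apply: (allP sc).
  rewrite (big_rem q0 q0s) /=.
  set C := \sum_(_ <- _) _.
  have : 0 <= C.
    rewrite /C big_seq; apply: sumr_ge0 => q /mem_rem /cl qc; apply: mulr_ge0; lia.
  have qc := cl _ q0s.
  have : 0 <= (q0%:Z - l) * (c - l - q0%:Z) by apply: mulr_ge0; lia.
  nia.
apply: (@le_trans _ _ (\sum_(q <- s) q%:Z * (c - l))).
  rewrite -mulr_suml; case: s lS lts sc => [|q s] lS lts sc.
    by rewrite big_nil in lS *; have -> : l = 0 by lia.
  apply: ler_wpM2r => //.
  have := allP sc q (mem_head _ _); lia.
rewrite big_seq [leRHS]big_seq; apply: ler_sum => q qs.
have := lts _ qs; have := allP sc _ qs; nia.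
Qed.

(** By concavity, a single part strictly between 0 and p costs at least p - 1. *)
Lemma sum_eq0_or_ge (s : seq nat) (p : int) :
  all (fun q : nat => q%:Z <= p) s ->
  let C := \sum_(q <- s) q%:Z * (p - q%:Z) in C = 0 \/ p - 1 <= C.
Proof.
move=> /=; elim: s => [|q s IH] /=; first by rewrite big_nil; left.
case/andP=> qp sp; rewrite big_cons.
have C0 : 0 <= \sum_(j <- s) j%:Z * (p - j%:Z).
  by rewrite big_seq; apply: sumr_ge0 => j js; have := allP sp _ js => ?; apply: mulr_ge0; lia.
set C := \sum_(j <- s) _ in C0 *.
have [q0|q0] := eqVneq (q%:Z * (p - q%:Z)) 0.
  by rewrite q0 add0r; apply: IH.
right; have : 1 <= q%:Z * (p - q%:Z).
  have : 0 <= q%:Z * (p - q%:Z) by apply: mulr_ge0; lia.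
  lia.
move=> q1; have : 0 <= (q%:Z - 1) * (p - q%:Z - 1) by apply: mulr_ge0; nia.
lia.
Qed.

(** * Alternating sums *)

Definition altsum (s : seq int) : int := foldr (fun x a => x - a) 0 s.

Section Altsum.
Variable T : Type.
Implicit Types (s : seq T) (u v : T -> int).

Lemma altsum_abs s u : `|altsum (map u s)| <= \sum_(q <- s) `|u q|.
Proof.
elim: s => [|q s IH] /=; rewrite ?big_nil ?normr0 // big_cons.
by apply: (le_trans (ler_normB _ _)); rewrite lerD2l.
Qed.

Lemma altsum_linear s u v (a b : int) :
  altsum (map (fun q => a * u q + b * v q) s) =
  a * altsum (map u s) + b * altsum (map v s).
Proof. by elim: s => [|q s IH] /=; rewrite ?mulr0 ?addr0 // IH; ring. Qed.

Lemma altsum_parity s u :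
  exists j : int, altsum (map u s) = \sum_(q <- s) u q - 2 * j.
Proof.
elim: s => [|q s [j IH]] /=; first by exists 0; rewrite big_nil; lia.
by exists (\sum_(q <- s) u q - j); rewrite big_cons IH; ring.
Qed.

End Altsum.

Lemma altsum_bound (s : seq int) :
  sorted >=%R s -> all (>= 0) s -> 0 <= altsum s <= head 0 s.
Proof.
elim: s => [|x s IH] //= pth /andP[x0 s0].
have /andP[] := IH (path_sorted pth) s0.
by case: s pth {IH s0} => [|y s] /=; [lia|case/andP; lia].
Qed.

Lemma altsum_bound2 (x : int) (s : seq int) :
  sorted >=%R (x :: s) -> all (>= 0) (x :: s) ->
  x - head 0 s <= altsum (x :: s) <= x.
Proof.
move=> ss /= /andP[x0 s0].
have /andP[] := altsum_bound (path_sorted ss) s0.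
by rewrite lerD2l lerN2 lerBlDr lerDl => -> ->.
Qed.

(** * Spectra *)

Record spectrum := Spectrum { e_seq : seq nat; f_seq : seq nat; m_seq : seq nat }.

Definition parts (d : spectrum) : seq nat :=
  e_seq d ++ f_seq d ++ m_seq d ++ m_seq d.

Definition signed_sum (u : nat -> int) (d : spectrum) : int :=
  altsum (map u (e_seq d)) + altsum (map u (f_seq d)).

Definition descending (d : spectrum) : bool :=
  [&& sorted geq (e_seq d), sorted geq (f_seq d) & sorted geq (m_seq d)].

Lemma signed_sum_linear (d : spectrum) (u v : nat -> int) (a b : int) :
  signed_sum (fun q => a * u q + b * v q) d =
  a * signed_sum u d + b * signed_sum v d.
Proof. by rewrite /signed_sum !altsum_linear; ring. Qed.

(** Each part at 1 or -1 enters the signed sum once, up to sign, so an estimate valid for both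
    values of [eps] reduces to a pointwise one with absolute values. *)
Lemma signed_sum_le (d : spectrum) (A B u : nat -> int) (eps : int) :
  eps = 1 \/ eps = -1 ->
  (forall q, q \in parts d -> B q + `|u q| <= A q) ->
  \sum_(q <- parts d) B q <= \sum_(q <- parts d) A q + eps * signed_sum u d.
Proof.
move=> eps1 AB.
have sub (s : seq nat) : {subset s <= parts d} ->
    \sum_(q <- s) (B q + `|u q|) <= \sum_(q <- s) A q.
  by move=> sd; rewrite big_seq [leRHS]big_seq; apply: ler_sum => q /sd /AB.
have se : {subset e_seq d <= parts d} by move=> q; rewrite !mem_cat => ->.
have sf : {subset f_seq d <= parts d} by move=> q; rewrite !mem_cat orbC => ->.
have sm : {subset m_seq d <= parts d}.
  by move=> q; rewrite !mem_cat => ->; rewrite !orbT.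
have := sub _ se; have := sub _ sf; have := sub _ sm.
rewrite !big_split /=.
have : 0 <= \sum_(q <- m_seq d) `|u q| by apply: sumr_ge0.
have := altsum_abs (e_seq d) u; have := altsum_abs (f_seq d) u.
rewrite /signed_sum /parts !big_cat /=.
case: eps1 => ->; rewrite ?mul1r ?mulN1r; rewrite !ler_norml => /andP[? ?] /andP[? ?] ? ? ? ?; lra.
Qed.

(* The parts q with 2 q > p are k in number, v is the sum of their deficits
   p - q, and t is the sum of the signs with which they enter the alternating
   sum [odd]; s is the sum of the parts q with 2 q <= p. *)
Record profile (eps r p k s v t cost odd : int) : Prop := Profile {
  profile_s : 0 <= s;
  profile_v : 0 <= v;
  profile_k : 0 <= k;
  profile_r : r = k * p + s - v;
  profile_t : 0 <= t <= 2;
  profile_par : exists j : int, t = k - 2 * j;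
  profile_odd : 0 <= odd <= 2 * p;
  profile_cost : exists CS CV : int, cost = CS + CV /\
    forall l, 0 <= l -> 2 * l <= p ->
      (l <= s -> l * (p - l) <= CS) /\ (l <= v -> l * (p - l) <= CV);
  profile_half : (s + v) * p <= 2 * cost;
  profile_signed : exists CS CV : int,
    CS + CV <= cost + eps * (odd - t * p) /\
    forall l, 0 <= l -> 2 * l + 2 <= p ->
      (l <= s -> l * (p - 1 - l) <= CS) /\ (l <= v -> l * (p - 1 - l) <= CV);
  profile_upper : 0 < k ->
    4 * r * r - 8 * r * s - 4 * eps * t * r - k * k <=
      4 * k * (p * r - cost - eps * odd) }.

(** The amount by which the sum of squares falls short of p r; it vanishes when all parts are 0 or
    p. *)
Definition cost (d : spectrum) (p : int) : int :=
  \sum_(q <- parts d) q%:Z * (p - q%:Z).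

(** A monotone test turns a decreasing sequence into 1, ..., 1, 0, ..., 0. *)
Lemma altsum_indicator (s : seq nat) (P : pred nat) :
  sorted geq s -> {homo P : x y / (x <= y)%N >-> x ==> y} ->
  0 <= altsum [seq (P q)%:Z | q <- s] <= 1.
Proof.
move=> ss Pmono.
have : sorted >=%R [seq (P q)%:Z | q <- s].
  rewrite sorted_map; apply: sub_sorted ss => x y /= /Pmono.
  by case: (P y) => //=; case: (P x).
move=> /altsum_bound; case/(_ _)/andP => [|-> H].
  by apply/allP => x /mapP[q _ ->].
by apply: le_trans H _; case: s {ss} => //= q s; case: (P q).
Qed.

(** Parts are split at p / 2: a small part counts as q, a large one as its deficit p - q. Both
    quantities are at most p / 2 and each of their units costs at least p / 2, so [truncated_sum]
    applies to both families. *)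
Lemma profileP (eps r : int) (p : nat) (d : spectrum) :
  eps = 1 \/ eps = -1 -> descending d ->
  (head 0%N (e_seq d) <= p)%N -> (head 0%N (f_seq d) <= p)%N ->
  (head 0%N (m_seq d) <= p)%N ->
  r = \sum_(q <- parts d) q%:Z ->
  exists k s v t, profile eps r p k s v t (cost d p) (signed_sum Posz d).
Proof.
move=> eps1 /and3P[se sf sm] pe pf pm rE.
have geq_trans : transitive geq by move=> x y z /= xy /leq_trans; apply.
have le_head s : sorted geq s -> (head 0%N s <= p)%N ->
    forall q, q \in s -> (q <= p)%N.
  case: s => //= x s; rewrite path_sortedE // => /andP[/allP xs _] xp q.
  by rewrite inE => /predU1P[-> //|/xs /= /leq_trans]; apply.
have dp q : q \in parts d -> (q <= p)%N.
  rewrite !mem_cat => /or4P[]; by apply: le_head.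
pose big q := (p < 2 * q)%N.
pose small_of q := if big q then 0%N else q.
pose defect_of q := if big q then (p - q)%N else 0%N.
pose k : int := \sum_(q <- parts d) (big q)%:Z.
pose s : int := \sum_(q <- parts d) (small_of q)%:Z.
pose v : int := \sum_(q <- parts d) (defect_of q)%:Z.
pose t : int := signed_sum (fun q => (big q)%:Z) d.
have big_mono : {homo big : x y / (x <= y)%N >-> x ==> y}.
  by move=> x y xy; apply/implyP; rewrite /big; lia.
have s0 : 0 <= s by apply: sumr_ge0.
have v0 : 0 <= v by apply: sumr_ge0.
have k0 : 0 <= k by apply: sumr_ge0.
have trunc (w : nat -> nat) c l : 0 <= l ->
    (forall q, q \in parts d -> (w q)%:Z <= c - l) ->
    l <= \sum_(q <- parts d) (w q)%:Z ->
    l * (c - l) <= \sum_(q <- parts d) (w q)%:Z * (c - (w q)%:Z).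
  move=> l0 wc; rewrite -!(big_map w xpredT (fun q : nat => q%:Z)).
  rewrite -(big_map w xpredT (fun q : nat => q%:Z * (c - q%:Z))).
  apply: truncated_sum => //; apply/allP => _ /mapP[q qd ->]; exact: wc.
exists k, s, v, t; split => //.
- rewrite rE mulr_suml -big_split -sumrB; apply: eq_big_seq => q /dp qp.
  by rewrite /small_of /defect_of; case: (big q) => /=; lia.
- have := altsum_indicator se big_mono; have := altsum_indicator sf big_mono.
  rewrite /t /signed_sum; lia.
- have [j1 E1] := altsum_parity (e_seq d) (fun q => (big q)%:Z).
  have [j2 E2] := altsum_parity (f_seq d) (fun q => (big q)%:Z).
  exists (j1 + j2 + \sum_(q <- m_seq d) (big q)%:Z).
  by rewrite /t /signed_sum E1 E2 /k /parts !big_cat /=; ring.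
- have alt_le s' : sorted geq s' -> (head 0%N s' <= p)%N ->
      0 <= altsum (map Posz s') <= p%:Z.
    move=> ss sp.
    have : sorted >=%R (map Posz s').
      by rewrite sorted_map; apply: sub_sorted ss => x y /=; lia.
    move=> /altsum_bound; case/(_ _)/andP => [|-> H].
      by apply/allP => x /mapP[q _ ->].
    by apply: le_trans H _; case: s' {ss} sp.
  have := alt_le _ se pe; have := alt_le _ sf pf; rewrite /signed_sum; lia.
- exists (\sum_(q <- parts d) (small_of q)%:Z * (p%:Z - (small_of q)%:Z)),
         (\sum_(q <- parts d) (defect_of q)%:Z * (p%:Z - (defect_of q)%:Z)).
  split.
    rewrite -big_split; apply: eq_big_seq => q /dp qp.
    by rewrite /small_of /defect_of; case: (big q) => /=; rewrite -?subzn //; lia.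
  move=> l l0 lp; split; apply: trunc => // q /dp qp;
    by rewrite /small_of /defect_of; case: ifP; rewrite /big; lia.
- rewrite /s /v /cost -big_split mulr_suml mulr_sumr /=.
  rewrite big_seq [leRHS]big_seq; apply: ler_sum => q /dp qp.
  rewrite /small_of /defect_of; case: (boolP (big q)); rewrite /big; nia.
- exists (\sum_(q <- parts d) (small_of q)%:Z * (p%:Z - 1 - (small_of q)%:Z)),
         (\sum_(q <- parts d) (defect_of q)%:Z * (p%:Z - 1 - (defect_of q)%:Z)).
  split; last first.
    move=> l l0 lp; split; apply: trunc => // q /dp qp;
    by rewrite /small_of /defect_of; case: ifP; rewrite /big; lia.
  (* Once t p is removed, a part changes the signed sum by at most its small part or its deficit, so
     the cost coefficient only drops from p to p - 1. *)
  have -> : signed_sum Posz d - t * p%:Z =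
            signed_sum (fun q => 1 * q%:Z + - p%:Z * (big q)%:Z) d.
    by rewrite signed_sum_linear; ring.
  rewrite -big_split; apply: signed_sum_le => // q /dp qp.
  rewrite /small_of /defect_of; case: (big q) => /=; rewrite -?subzn //; lia.
- move=> k_gt0.
  have Neps1 : - eps = 1 \/ - eps = -1 by case: eps1 => ->; [right|left].
  have QE : p%:Z * r - cost d p = \sum_(q <- parts d) q%:Z * q%:Z.
    by rewrite rE mulr_sumr /cost -sumrB; apply: eq_bigr => q _; ring.
  have rsE : r - s = \sum_(q <- parts d) (big q)%:Z * q%:Z.
    rewrite {1}rE -sumrB; apply: eq_bigr => q _.
    by rewrite /small_of; case: (big q) => /=; ring.
  (* A Cauchy-Schwarz bound for the large parts: [B] is the tangent to 4 k k q q at q = r / k,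
     lowered by k k to absorb the signed term, because 4 w w - 4 k w + k k is the square of 2 w -
     k. *)
  pose B q := (big q)%:Z * (8 * k * r * q%:Z - 4 * r * r - k * k).
  have BE : \sum_(q <- parts d) B q =
            8 * k * r * (r - s) - (4 * r * r + k * k) * k.
    have -> : (4 * r * r + k * k) * k =
        \sum_(q <- parts d) (4 * r * r + k * k) * (big q)%:Z.
      by rewrite -mulr_sumr.
    rewrite rsE mulr_sumr -sumrB; apply: eq_bigr => q _; rewrite /B; ring.
  pose u q := 4 * k * k * q%:Z + (- 4 * k * r) * (big q)%:Z.
  have /(signed_sum_le Neps1) : forall q, q \in parts d ->
      B q + `|u q| <= 4 * k * k * (q%:Z * q%:Z).
    move=> q _; have k2 : `|u q| = 4 * k * `|k * q%:Z - r * (big q)%:Z|.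
      rewrite -[4 * k]gtr0_norm ?mulr_gt0 // -normrM /u; congr `|_|; ring.
    rewrite k2 /B; case: (big q) => /=; last first.
      rewrite !(mulr0, mul0r, subr0, add0r) ger0_norm ?mulr_ge0 //.
      have : 0 <= k * k * (q%:Z * (q%:Z - 1)).
        by apply: mulr_ge0; [apply: mulr_ge0; lia|nia].
      lia.
    set w := `| _ |.
    have : 0 <= (2 * w - k) * (2 * w - k) by rewrite -expr2 sqr_ge0.
    have : w * w = (k * q%:Z - r) * (k * q%:Z - r).
      by rewrite /w mulr1 -normrM ger0_norm // -expr2 sqr_ge0.
    lia.
  rewrite BE -mulr_sumr -QE signed_sum_linear -/t => H.
  rewrite -(ler_pM2l k_gt0); lia.
Qed.

(** * Spectra whose largest parts fill the rank *)

(** The cases l = 1, 2, 3 of [profile_cost] and [profile_signed]; 8 <= p is the condition 2 l + 2 <=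
    p at l = 3. If eps (1 - t) > 0, the bounds 0 <= odd <= 2 p make the signed term nonnegative, and
    the sharper unsigned estimates hold for N. *)
Lemma profile_ends (eps r p k s v t cost odd : int) :
  profile eps r p k s v t cost odd -> eps = 1 \/ eps = -1 -> 8 <= p ->
  let N := cost + eps * (odd - t * p) in
  exists CS CV CS' CV' : int,
  [/\ cost = CS + CV, CS' + CV' <= N,
      (0 < eps * (1 - t) -> CS + CV <= N),
      [/\ 0 <= CS, 0 <= CV, 0 <= CS' & 0 <= CV'] &
      [/\ 1 <= s -> p - 1 <= CS /\ p - 2 <= CS',
          2 <= s -> 2 * p - 4 <= CS /\ 2 * p - 6 <= CS' &
          3 <= s -> 3 * p - 9 <= CS /\ 3 * p - 12 <= CS'] /\
      [/\ 1 <= v -> p - 1 <= CV /\ p - 2 <= CV',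
          2 <= v -> 2 * p - 4 <= CV /\ 2 * p - 6 <= CV' &
          3 <= v -> 3 * p - 9 <= CV /\ 3 * p - 12 <= CV']].
Proof.
case=> s0 v0 k0 _ t02 _ odd0 [CS [CV [-> C]]] _ [CS' [CV' [N C']]] _ eps1 p8.
exists CS, CV, CS', CV'; split => //.
- move=> t1; have -> : eps * (odd - t * p) = odd * eps - eps * t * p by ring.
  case: eps1 t1 => -> t1.
    have -> : t = 0 by lia.
    lia.
  have -> : t = 2 by lia.
  lia.
- have [? ?] := C 0 isT ltac:(lia); have [? ?] := C' 0 isT ltac:(lia).
  by split; lia.
have [? ?] := C 1 isT ltac:(lia); have [? ?] := C' 1 isT ltac:(lia).
have [? ?] := C 2 isT ltac:(lia); have [? ?] := C' 2 isT ltac:(lia).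
have [? ?] := C 3 isT ltac:(lia); have [? ?] := C' 3 isT ltac:(lia).
by split; split=> h; lia.
Qed.

(** * Largest parts near (r/2, r/3, r/6), (r/3, r/3, r/3) or (r/2, r/4, r/4) *)

Section TypeA.
Variables (eps r D : int) (p1 k1 s1 v1 t1 c1 o1 p2 k2 s2 v2 t2 c2 o2
  p3 k3 s3 v3 t3 c3 o3 : int).
Hypothesis eps1 : eps = 1 \/ eps = -1.
Hypothesis P1 : profile eps r p1 k1 s1 v1 t1 c1 o1.
Hypothesis P2 : profile eps r p2 k2 s2 v2 t2 c2 o2.
Hypothesis P3 : profile eps r p3 k3 s3 v3 t3 c3 o3.
Hypothesis r73 : 73 <= r.
Hypothesis DE : D = r * r - eps * r - (p1 * r - c1 - eps * o1)
  - (p2 * r - c2 - eps * o2) - (p3 * r - c3 - eps * o3).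
Hypothesis D4 : 4 <= D.
Hypothesis Dlt : 9 * D < 2 * r - 108.
Hypothesis p_total : p1 + p2 + p3 = r.

(** This isolates the main signed terms: [profile_ends] bounds each of the three brackets below by
    nonnegative quantities, so that any loss of order r sits in the last sum. *)
Lemma signed_total :
  D = (c1 + eps * (o1 - t1 * p1)) + (c2 + eps * (o2 - t2 * p2)) +
      (c3 + eps * (o3 - t3 * p3)) -
      eps * ((1 - t1) * p1 + (1 - t2) * p2 + (1 - t3) * p3).
Proof. rewrite DE -p_total; ring. Qed.

Lemma typeA_236 : k1 = 2 -> k2 = 3 -> k3 = 6 ->
  s1 <= 6 -> s2 <= 6 -> s3 <= 6 -> v1 <= 6 -> v2 <= 6 -> v3 <= 6 -> False.
Proof.
move=> k1E k2E k3E.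
have DN := signed_total.
have U1 := profile_upper P1; have U2 := profile_upper P2.
have U3 := profile_upper P3.
move: U1 U2 U3; rewrite k1E k2E k3E => U1 U2 U3.
(* In the combination of U1, U2, U3 with weights 1/8, 1/12, 1/24 the terms in r^2 cancel: D is at
   most r / 6 times this form plus (2 + 3 + 6) / 4, which is below 4. *)
have key : 0 < - 6 * eps + eps * (3 * t1 + 2 * t2 + t3) +
               2 * (3 * s1 + 2 * s2 + s3).
  rewrite ltNge; apply/negP => neg.
  have : r * (- 6 * eps + eps * (3 * t1 + 2 * t2 + t3) +
               2 * (3 * s1 + 2 * s2 + s3)) <= 0 by rewrite mulr_ge0_le0 //; lia.
  move: (U1 isT) (U2 isT) (U3 isT) DE D4; lia.
have s10 := profile_s P1; have s20 := profile_s P2; have s30 := profile_s P3.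
have v10 := profile_v P1; have v20 := profile_v P2; have v30 := profile_v P3.
have r1 := profile_r P1; have r2 := profile_r P2; have r3 := profile_r P3.
have t10 := profile_t P1; have t20 := profile_t P2; have t30 := profile_t P3.
have [j1 t1E] := profile_par P1; have [j2 t2E] := profile_par P2.
have [j3 t3E] := profile_par P3.
subst k1 k2 k3.
move=> s16 s26 s36 v16 v26 v36.
have [|CS1 [CV1 [CS1' [CV1' [e1 n1 b1 [? ? ? ?] [a1 a1']]]]]] :=
  profile_ends P1 eps1; first by lia.
have [|CS2 [CV2 [CS2' [CV2' [e2 n2 b2 [? ? ? ?] [a2 a2']]]]]] :=
  profile_ends P2 eps1; first by lia.
have [|CS3 [CV3 [CS3' [CV3' [e3 n3 b3 [? ? ? ?] [a3 a3']]]]]] :=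
  profile_ends P3 eps1; first by lia.
move: n1 n2 n3 b1 b2 b3 DN.
set N1 := c1 + _; set N2 := c2 + _; set N3 := c3 + _.
move=> n1 n2 n3 b1 b2 b3 DN.
have t2_1 : t2 = 1 by lia.
have t1_02 : t1 = 0 \/ t1 = 2 by lia.
have t3_02 : t3 = 0 \/ t3 = 2 by lia.
clear t1E t2E t3E t10 t20 t30 U1 U2 U3 DE P1 P2 P3 j1 j2 j3.
(* The equations r = k_i p_i + s_i - v_i, weighted by 6 / k_i, are added and compared with p1 + p2 +
   p3 = r: deficits balance small parts. *)
have nu : 3 * v1 + 2 * v2 + v3 = 3 * s1 + 2 * s2 + s3 by lia.
(* The minimal ways in which the weighted sum reaches 2, and below 3. As the p_i are near r/2, r/3,
   r/6, they cost at least about r/3 and r/2 respectively. *)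
have weight2 (w1 w2 w3 : int) (A1 A2 A3 : Prop) : 0 <= w1 -> 0 <= w2 ->
    0 <= w3 -> (1 <= w1 -> A1) -> (1 <= w2 -> A2) -> (2 <= w3 -> A3) ->
    2 <= 3 * w1 + 2 * w2 + w3 ->
    A1 \/ w1 = 0 /\ (A2 \/ w2 = 0 /\ A3).
  have [/[swap] _ h|?] := lerP 1 w1; first by move=> *; left; auto.
  move=> ? ? ? _ H2 H3 ?; right; split; first by lia.
  have [/H2|?] := lerP 1 w2; first by left.
  by right; split; [|apply: H3]; lia.
have weight3 (w1 w2 w3 : int) (A1 A2 A2' A3 A3' : Prop) : 0 <= w1 -> 0 <= w2 ->
    0 <= w3 -> (1 <= w1 -> A1) -> (2 <= w2 -> A2) -> (1 <= w2 -> A2') ->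
    (1 <= w3 -> A3') -> (3 <= w3 -> A3) ->
    3 <= 3 * w1 + 2 * w2 + w3 ->
    A1 \/ w1 = 0 /\ (A2 \/ w2 = 1 /\ A2' /\ A3' \/ w2 = 0 /\ A3).
  have [/[swap] _ h|?] := lerP 1 w1; first by move=> *; left; auto.
  move=> ? ? ? _ H2 H2' H3' H3 ?; right; split; first by lia.
  have [/H2|?] := lerP 2 w2; first by left.
  have [h|?] := lerP 1 w2; right; [left|right].
    by split; [lia|split; [apply: H2'|apply: H3'; lia]].
  by split; [|apply: H3]; lia.
case: a1 a1' a2 a2' a3 a3' => [a11 a12 _] [a14 a15 _] [a21 a22 _]
  [a24 a25 _] [a31 a32 a33] [a34 a35 a36].
have HS2 := weight2 _ _ _ _ _ _ s10 s20 s30 a11 a21 a32.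
have HV2 := weight2 _ _ _ _ _ _ v10 v20 v30 a14 a24 a35.
have HS3 := weight3 _ _ _ _ _ _ _ _ s10 s20 s30 a11 a22 a21 a31 a33.
have HV3 := weight3 _ _ _ _ _ _ _ _ v10 v20 v30 a14 a25 a24 a34 a36.
clear a11 a12 a14 a15 a21 a22 a24 a25 a31 a32 a33 a34 a35 a36 weight2 weight3.
case: eps1 t1_02 t3_02 key b1 b2 b3 DN; case=> ->; case=> ->; case=> ->;
  rewrite t2_1 => key b1 b2 b3 DN.
all: clearbody N1 N2 N3.
all: try (clear HS2 HV2 HS3 HV3; lia).
(* Four sign choices remain. In the first and the last, the signed loss p1 + p3 is near 2r/3 and
   [key] gives weight 3; in the two others, the loss p1 - p3 is near r/3 and [key] gives weight
   2. *)
{ clear HS2 HV2; case: HS3 => [|h|[z [h|[h|h]]]]; first by lia.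
  all: case: HV3 => [|h'|[z' [h'|[h'|h']]]]; first by lia.
  all: lia. }
{ clear HS3 HV3; case: HS2 => [|h|[z [h|h]]]; first by lia.
  all: case: HV2 => [|h'|[z' [h'|h']]]; first by lia.
  all: lia. }
{ clear HS3 HV3; case: HS2 => [|h|[z [h|h]]]; first by lia.
  all: case: HV2 => [|h'|[z' [h'|h']]]; first by lia.
  all: lia. }
{ clear HS2 HV2; case: HS3 => [|h|[z [h|[h|h]]]]; first by lia.
  all: case: HV3 => [|h'|[z' [h'|[h'|h']]]]; first by lia.
  all: lia. }
Qed.

(** Odd k_i force t_i = 1, so the signed loss vanishes; one unit of small parts and one unit of
    deficit, each costing about r/3, are enough. *)
Lemma typeA_333 : k1 = 3 -> k2 = 3 -> k3 = 3 ->
  s1 <= 6 -> s2 <= 6 -> s3 <= 6 -> v1 <= 6 -> v2 <= 6 -> v3 <= 6 -> False.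
Proof.
move=> k1E k2E k3E.
have DN := signed_total.
have U1 := profile_upper P1; have U2 := profile_upper P2.
have U3 := profile_upper P3.
have t10 := profile_t P1; have t20 := profile_t P2; have t30 := profile_t P3.
have [j1 t1E] := profile_par P1; have [j2 t2E] := profile_par P2.
have [j3 t3E] := profile_par P3.
have s10 := profile_s P1; have s20 := profile_s P2; have s30 := profile_s P3.
have v10 := profile_v P1; have v20 := profile_v P2; have v30 := profile_v P3.
have r1 := profile_r P1; have r2 := profile_r P2; have r3 := profile_r P3.
subst k1 k2 k3.
have t1_1 : t1 = 1 by lia.
have t2_1 : t2 = 1 by lia.
have t3_1 : t3 = 1 by lia.
move: (U1 isT) (U2 isT) (U3 isT); rewrite t1_1 t2_1 t3_1 => {}U1 {}U2 {}U3.
have key : 0 < s1 + s2 + s3.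
  rewrite ltNge; apply/negP => neg.
  have [s1E s2E s3E] : [/\ s1 = 0, s2 = 0 & s3 = 0] by split; lia.
  by move: U1 U2 U3; rewrite s1E s2E s3E; lia.
move=> s16 s26 s36 v16 v26 v36.
have [|CS1 [CV1 [CS1' [CV1' [_ n1 _ [_ _ ? ?] [[a1 _ _] [b1 _ _]]]]]]] :=
  profile_ends P1 eps1; first by lia.
have [|CS2 [CV2 [CS2' [CV2' [_ n2 _ [_ _ ? ?] [[a2 _ _] [b2 _ _]]]]]]] :=
  profile_ends P2 eps1; first by lia.
have [|CS3 [CV3 [CS3' [CV3' [_ n3 _ [_ _ ? ?] [[a3 _ _] [b3 _ _]]]]]]] :=
  profile_ends P3 eps1; first by lia.
have [hs|[hs|hs]] : 1 <= s1 \/ 1 <= s2 \/ 1 <= s3 by lia.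
all: have [hv|[hv|hv]] : 1 <= v1 \/ 1 <= v2 \/ 1 <= v3 by lia.
all: move: DN n1 n2 n3; rewrite t1_1 t2_1 t3_1.
all: set N1 := c1 + _; set N2 := c2 + _; set N3 := c3 + _; clearbody N1 N2 N3.
all: clear U1 U2 U3 DE; lia.
Qed.

(** As for (2,3,6), with weights 2, 1, 1. All t_i are 0 or 2, so the loss can reach r; [key] then
    gives weight 3, which costs about 3r/4 in small parts and again in deficits. *)
Lemma typeA_244 : k1 = 2 -> k2 = 4 -> k3 = 4 ->
  s1 <= 6 -> s2 <= 6 -> s3 <= 6 -> v1 <= 6 -> v2 <= 6 -> v3 <= 6 -> False.
Proof.
move=> k1E k2E k3E.
have DN := signed_total.
have U1 := profile_upper P1; have U2 := profile_upper P2.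
have U3 := profile_upper P3.
move: U1 U2 U3; rewrite k1E k2E k3E => U1 U2 U3.
have key : 0 < - 4 * eps + eps * (2 * t1 + t2 + t3) + 2 * (2 * s1 + s2 + s3).
  rewrite ltNge; apply/negP => neg.
  have : r * (- 4 * eps + eps * (2 * t1 + t2 + t3) + 2 * (2 * s1 + s2 + s3))
    <= 0 by rewrite mulr_ge0_le0 //; lia.
  move: (U1 isT) (U2 isT) (U3 isT) DE D4; lia.
have s10 := profile_s P1; have s20 := profile_s P2; have s30 := profile_s P3.
have v10 := profile_v P1; have v20 := profile_v P2; have v30 := profile_v P3.
have r1 := profile_r P1; have r2 := profile_r P2; have r3 := profile_r P3.
have t10 := profile_t P1; have t20 := profile_t P2; have t30 := profile_t P3.
have [j1 t1E] := profile_par P1; have [j2 t2E] := profile_par P2.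
have [j3 t3E] := profile_par P3.
subst k1 k2 k3.
have t1_02 : t1 = 0 \/ t1 = 2 by lia.
have t2_02 : t2 = 0 \/ t2 = 2 by lia.
have t3_02 : t3 = 0 \/ t3 = 2 by lia.
have nu : 2 * v1 + v2 + v3 = 2 * s1 + s2 + s3 by lia.
have weight1 (w1 w2 w3 : int) (A1 A2 A3 : Prop) : 0 <= w1 -> 0 <= w2 ->
    0 <= w3 -> (1 <= w1 -> A1) -> (1 <= w2 -> A2) -> (1 <= w3 -> A3) ->
    1 <= 2 * w1 + w2 + w3 -> A1 \/ A2 \/ A3.
  move=> ? ? ? H1 H2 H3 ?.
  have [/H1|?] := lerP 1 w1; first by left.
  have [/H2|?] := lerP 1 w2; first by right; left.
  by right; right; apply: H3; lia.
have weight2 (w1 w2 w3 : int) (A1 A2 A2' A3 A3' : Prop) : 0 <= w1 -> 0 <= w2 ->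
    0 <= w3 -> (1 <= w1 -> A1) -> (1 <= w2 -> A2) -> (2 <= w2 -> A2') ->
    (1 <= w3 -> A3) -> (2 <= w3 -> A3') ->
    2 <= 2 * w1 + w2 + w3 ->
    A1 \/ w1 = 0 /\ (A2' \/ w2 = 1 /\ A2 /\ A3 \/ w2 = 0 /\ A3').
  move=> ? ? ? H1 H2 H2' H3 H3' ?.
  have [/H1|?] := lerP 1 w1; [by left|right; split; first by lia].
  have [/H2'|?] := lerP 2 w2; [by left|right].
  have [h|?] := lerP 1 w2; [left|right].
    by split; [lia|split; [apply: H2|apply: H3; lia]].
  by split; [|apply: H3']; lia.
have weight3 (w1 w2 w3 : int) (A1 A1' A2 A2' A2'' A3 A3' A3'' : Prop) :
    0 <= w1 -> 0 <= w2 -> 0 <= w3 -> (1 <= w1 -> A1) -> (2 <= w1 -> A1') ->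
    (1 <= w2 -> A2) -> (2 <= w2 -> A2') -> (3 <= w2 -> A2'') ->
    (1 <= w3 -> A3) -> (2 <= w3 -> A3') -> (3 <= w3 -> A3'') ->
    3 <= 2 * w1 + w2 + w3 ->
    A1' \/ w1 = 1 /\ A1 /\ (A2 \/ w2 = 0 /\ A3) \/
    w1 = 0 /\ (A2'' \/ w2 = 2 /\ A2' /\ A3 \/ w2 = 1 /\ A2 /\ A3' \/
               w2 = 0 /\ A3'').
  move=> ? ? ? H1 H1' H2 H2' H2'' H3 H3' H3'' ?.
  have [/H1'|?] := lerP 2 w1; [by left|right].
  have [w1_1|?] := lerP 1 w1; [left|right].
    split; [lia|split; first exact: H1].
    by have [/H2|?] := lerP 1 w2; [left|right; split; [|apply: H3]; lia].
  split; first by lia.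
  have [/H2''|?] := lerP 3 w2; [by left|right].
  have [h|?] := lerP 2 w2; [left|right].
    by split; [lia|split; [apply: H2'|apply: H3; lia]].
  have [h|?] := lerP 1 w2; [left|right].
    by split; [lia|split; [apply: H2|apply: H3'; lia]].
  by split; [|apply: H3'']; lia.
move=> s16 s26 s36 v16 v26 v36.
have [|CS1 [CV1 [CS1' [CV1' [e1 n1 b1 [? ? ? ?] [a1 a1']]]]]] :=
  profile_ends P1 eps1; first by lia.
have [|CS2 [CV2 [CS2' [CV2' [e2 n2 b2 [? ? ? ?] [a2 a2']]]]]] :=
  profile_ends P2 eps1; first by lia.
have [|CS3 [CV3 [CS3' [CV3' [e3 n3 b3 [? ? ? ?] [a3 a3']]]]]] :=
  profile_ends P3 eps1; first by lia.
move: n1 n2 n3 b1 b2 b3 DN.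
set N1 := c1 + _; set N2 := c2 + _; set N3 := c3 + _.
move=> n1 n2 n3 b1 b2 b3 DN; clearbody N1 N2 N3.
clear t1E t2E t3E t10 t20 t30 U1 U2 U3 DE P1 P2 P3 j1 j2 j3.
case: a1 a1' a2 a2' a3 a3' => [a11 a12 _] [a14 a15 _] [a21 a22 a23]
  [a24 a25 a26] [a31 a32 a33] [a34 a35 a36].
have HS1 := weight1 _ _ _ _ _ _ s10 s20 s30 a11 a21 a31.
have HV1 := weight1 _ _ _ _ _ _ v10 v20 v30 a14 a24 a34.
have HS2 := weight2 _ _ _ _ _ _ _ _ s10 s20 s30 a11 a21 a22 a31 a32.
have HV2 := weight2 _ _ _ _ _ _ _ _ v10 v20 v30 a14 a24 a25 a34 a35.
have HS3 :=
  weight3 _ _ _ _ _ _ _ _ _ _ _ s10 s20 s30 a11 a12 a21 a22 a23 a31 a32 a33.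
have HV3 :=
  weight3 _ _ _ _ _ _ _ _ _ _ _ v10 v20 v30 a14 a15 a24 a25 a26 a34 a35 a36.
clear a11 a12 a14 a15 a21 a22 a23 a24 a25 a26 a31 a32 a33 a34 a35 a36.
clear weight1 weight2 weight3.
case: eps1 t1_02 t2_02 t3_02 key b1 b2 b3 DN;
  case=> ->; case=> ->; case=> ->; case=> -> => key b1 b2 b3 DN.
all: try (clear HS1 HV1 HS2 HV2 HS3 HV3; lia).
{ clear HS1 HV1 HS2 HV2.
  have {}HS3 : _ := HS3 ltac:(clear HS3 HV3; lia).
  have {}HV3 : _ := HV3 ltac:(clear HS3 HV3; lia).
  case: HS3 => [h|[[z [h0 [h|h]]]|[z [h|[h|[h|h]]]]]].
  all: case: HV3 => [h'|[[z' [h0' [h'|h']]]|[z' [h'|[h'|[h'|h']]]]]]; lia. }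
{ clear HS1 HV1 HS3 HV3.
  have {}HS2 : _ := HS2 ltac:(clear HS2 HV2; lia).
  have {}HV2 : _ := HV2 ltac:(clear HS2 HV2; lia).
  case: HS2 => [h|[z [h|[h|h]]]].
  all: case: HV2 => [h'|[z' [h'|[h'|h']]]]; lia. }
{ clear HS1 HV1 HS3 HV3.
  have {}HS2 : _ := HS2 ltac:(clear HS2 HV2; lia).
  have {}HV2 : _ := HV2 ltac:(clear HS2 HV2; lia).
  case: HS2 => [h|[z [h|[h|h]]]].
  all: case: HV2 => [h'|[z' [h'|[h'|h']]]]; lia. }
{ clear HS2 HV2 HS3 HV3.
  have {}HS1 : _ := HS1 ltac:(clear HS1 HV1; lia).
  have {}HV1 : _ := HV1 ltac:(clear HS1 HV1; lia).
  by case: HS1 => [h|[h|h]]; case: HV1 => [h'|[h'|h']]; lia. }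
{ clear HS2 HV2 HS3 HV3.
  have {}HS1 : _ := HS1 ltac:(clear HS1 HV1; lia).
  have {}HV1 : _ := HV1 ltac:(clear HS1 HV1; lia).
  by case: HS1 => [h|[h|h]]; case: HV1 => [h'|[h'|h']]; lia. }
{ clear HS2 HV2 HS3 HV3.
  have {}HS1 : _ := HS1 ltac:(clear HS1 HV1; lia).
  have {}HV1 : _ := HV1 ltac:(clear HS1 HV1; lia).
  by case: HS1 => [h|[h|h]]; case: HV1 => [h'|[h'|h']]; lia. }
{ clear HS2 HV2 HS3 HV3.
  have {}HS1 : _ := HS1 ltac:(clear HS1 HV1; lia).
  have {}HV1 : _ := HV1 ltac:(clear HS1 HV1; lia).
  by case: HS1 => [h|[h|h]]; case: HV1 => [h'|[h'|h']]; lia. }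
{ clear HS1 HV1 HS3 HV3.
  have {}HS2 : _ := HS2 ltac:(clear HS2 HV2; lia).
  have {}HV2 : _ := HV2 ltac:(clear HS2 HV2; lia).
  case: HS2 => [h|[z [h|[h|h]]]].
  all: case: HV2 => [h'|[z' [h'|[h'|h']]]]; lia. }
{ clear HS1 HV1 HS3 HV3.
  have {}HS2 : _ := HS2 ltac:(clear HS2 HV2; lia).
  have {}HV2 : _ := HV2 ltac:(clear HS2 HV2; lia).
  case: HS2 => [h|[z [h|[h|h]]]].
  all: case: HV2 => [h'|[z' [h'|[h'|h']]]]; lia. }
{ clear HS1 HV1 HS2 HV2.
  have {}HS3 : _ := HS3 ltac:(clear HS3 HV3; lia).
  have {}HV3 : _ := HV3 ltac:(clear HS3 HV3; lia).
  case: HS3 => [h|[[z [h0 [h|h]]]|[z [h|[h|[h|h]]]]]].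
  all: case: HV3 => [h'|[[z' [h0' [h'|h']]]|[z' [h'|[h'|[h'|h']]]]]]; lia. }
Qed.

End TypeA.

(** * Largest parts near r/2 and r/2, and equal to 1 *)

Section TypeA22.
Variables (eps r D : int) (p1 s1 v1 t1 c1 o1 p2 s2 v2 t2 c2 o2 o3 : int).
Hypothesis eps1 : eps = 1 \/ eps = -1.
Hypothesis P1 : profile eps r p1 2 s1 v1 t1 c1 o1.
Hypothesis P2 : profile eps r p2 2 s2 v2 t2 c2 o2.
Hypothesis o3_2 : 0 <= o3 <= 2.
Hypothesis r73 : 73 <= r.
Hypothesis DE : D = r * r - eps * r - (p1 * r - c1 - eps * o1)
  - (p2 * r - c2 - eps * o2) - (r - eps * o3).
Hypothesis D4 : 4 <= D.
Hypothesis Dlt : 9 * D < 2 * r - 108.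
Hypothesis p_total : p1 + p2 = r - 1.

Lemma typeA_22 : s1 <= 6 -> s2 <= 6 -> v1 <= 6 -> v2 <= 6 -> False.
Proof.
have DN : D = (c1 + eps * (o1 - t1 * p1)) + (c2 + eps * (o2 - t2 * p2)) -
      eps * ((1 - t1) * p1 + (1 - t2) * p2 + 1 - o3).
  rewrite DE; have -> : r = p1 + p2 + 1 by lia.
  ring.
have U1 := profile_upper P1 isT; have U2 := profile_upper P2 isT.
(* D is at most r / 2 times this form plus 1 + eps o3, which is at most 3. *)
have key : 0 < - 2 * eps - 2 + eps * (t1 + t2) + 2 * (s1 + s2).
  rewrite ltNge; apply/negP => neg.
  have : r * (- 2 * eps - 2 + eps * (t1 + t2) + 2 * (s1 + s2)) <= 0.
    by rewrite mulr_ge0_le0 //; lia.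
  by case: eps1 DE D4 U1 U2 => ->; lia.
have s10 := profile_s P1; have s20 := profile_s P2.
have v10 := profile_v P1; have v20 := profile_v P2.
have r1 := profile_r P1; have r2 := profile_r P2.
have t10 := profile_t P1; have t20 := profile_t P2.
have [j1 t1E] := profile_par P1; have [j2 t2E] := profile_par P2.
(* As p1 + p2 is r - 1 rather than r, there is no balance here: two units of small parts are always
   present. *)
have nu : s1 + s2 = v1 + v2 + 2 by lia.
have t1_02 : t1 = 0 \/ t1 = 2 by lia.
have t2_02 : t2 = 0 \/ t2 = 2 by lia.
have weight1 (A1 A2 : Prop) : 0 <= v1 -> 0 <= v2 ->
    (1 <= v1 -> A1) -> (1 <= v2 -> A2) -> 1 <= v1 + v2 -> A1 \/ A2.
  move=> ? ? H1 H2 ?; have [/H1|?] := lerP 1 v1; first by left.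
  by right; apply: H2; lia.
have weight2 (A1 A1' A1'' A2 A2' A2'' : Prop) : 0 <= s1 -> 0 <= s2 ->
    (1 <= s1 -> A1) -> (2 <= s1 -> A1') -> (3 <= s1 -> A1'') ->
    (1 <= s2 -> A2) -> (2 <= s2 -> A2') -> (3 <= s2 -> A2'') ->
    [\/ A1'', s1 = 2 /\ A1' /\ (s2 = 0 \/ A2),
     s1 = 1 /\ A1 /\ (s2 = 1 /\ A2 \/ A2') |
     s1 = 0 /\ (s2 = 2 /\ A2' \/ A2'')].
  move=> ? ? H1 H1' H1'' H2 H2' H2''.
  have [/H1''|?] := lerP 3 s1; first by constructor 1.
  have [h|?] := lerP 2 s1.
    constructor 2; split; [lia|split; first exact: H1'].
    by have [/H2|?] := lerP 1 s2; [right|left; lia].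
  have [h|?] := lerP 1 s1.
    constructor 3; split; [lia|split; first exact: H1].
    by have [/H2'|?] := lerP 2 s2; [right|left; split; [lia|apply: H2; lia]].
  constructor 4; split; first by lia.
  by have [/H2''|?] := lerP 3 s2; [right|left; split; [lia|apply: H2'; lia]].
move=> s16 s26 v16 v26.
have [|CS1 [CV1 [CS1' [CV1' [e1 n1 b1 [? ? ? ?] [[a1 a2 a3] [a4 _ _]]]]]]] :=
  profile_ends P1 eps1; first by lia.
have [|CS2 [CV2 [CS2' [CV2' [e2 n2 b2 [? ? ? ?] [[a5 a6 a7] [a8 _ _]]]]]]] :=
  profile_ends P2 eps1; first by lia.
move: n1 n2 b1 b2 DN; set N1 := c1 + _; set N2 := c2 + _.
move=> n1 n2 b1 b2 DN; clearbody N1 N2.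
clear t1E t2E t10 t20 U1 U2 DE P1 P2 j1 j2.
have HV := weight1 _ _ v10 v20 a4 a8.
have HS := weight2 _ _ _ _ _ _ s10 s20 a1 a2 a3 a5 a6 a7.
clear weight1 weight2.
clear a1 a2 a3 a4 a5 a6 a7 a8.
case: eps1 t1_02 t2_02 key b1 b2 DN;
  case=> ->; case=> ->; case=> -> => key b1 b2 DN.
all: try (clear HS HV; lia).
all: case: HS => [h|[z [h h']]|[z [h h']]|[z h]]; try (clear HV; lia).
all: (case: HV => [|hv|hv]; [lia|..]); lia.
Qed.

End TypeA22.

(** * Reduction to the exceptional shapes *)

Lemma mul_pin (k n p : int) :
  0 < p -> (n - 1) * p < k * p -> k * p < (n + 1) * p -> k = n.
Proof. by move=> p0; rewrite !ltr_pM2r //; lia. Qed.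

(** For k < n, s + v is at least p + a, and for k > n at least p - a; half of its product with p
    then exceeds the cost. *)
Lemma pin_third (r n p c a k s v b : int) : 12 <= p -> 0 <= s -> 0 <= v ->
  r = k * p + s - v -> r = n * p + a -> (s + v) * p <= 2 * c ->
  2 * c < b -> b <= p * (p - a) -> b <= p * (p + a) -> k = n.
Proof.
move=> p12 s0 v0 rE rE' half cb ba ba'.
have [h|h|//] := ltrgtP k n.
- have : 0 <= (n - 1 - k) * p by apply: mulr_ge0; lia.
  move=> h'; have : p + a <= s + v by lia.
  by rewrite -(ler_pM2r (x := p)); lia.
- have : 0 <= (k - n - 1) * p by apply: mulr_ge0; lia.
  move=> h'; have : p - a <= s + v by lia.
  by rewrite -(ler_pM2r (x := p)); lia.
Qed.

Lemma third_236 (r p1 p2 p3 a1 a2 c1 c2 c3 k3 s3 v3 : int) : 73 <= r ->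
  r = 2 * p1 + a1 -> r = 3 * p2 + a2 -> p1 + p2 + p3 = r ->
  -2 <= a1 <= 2 -> -4 <= a2 <= 4 ->
  `|a1| * (p1 - `|a1|) <= c1 -> `|a2| * (p2 - `|a2|) <= c2 -> 0 <= c3 ->
  r = k3 * p3 + s3 - v3 -> 0 <= s3 -> 0 <= v3 -> (s3 + v3) * p3 <= 2 * c3 ->
  (forall l l', 0 <= l -> 0 <= l' -> 2 * l <= p3 -> 2 * l' <= p3 ->
    l <= s3 -> l' <= v3 -> l * (p3 - l) + l' * (p3 - l') <= c3) ->
  9 * (c1 + c2 + c3) < 11 * r - 108 -> k3 = 6 /\ s3 <= 6 /\ v3 <= 6.
Proof.
move=> r73 r1 r2 pr a1b a2b C1 C2 c30 r3 s30 v30 half F budget.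
have a1_cases : [|| a1 == 0, a1 == 1, a1 == -1, a1 == 2 | a1 == -2] by lia.
have a2_cases : [|| a2 == 0, a2 == 1, a2 == -1, a2 == 2, a2 == -2, a2 == 3,
  a2 == -3, a2 == 4 | a2 == -4] by lia.
have r3' : r = 6 * p3 + - (3 * a1 + 2 * a2) by lia.
(* A linear lower bound for p3 * p3 on the integers: the secant through 12 and 13, near 73 / 6. *)
have sq : 0 <= (p3 - 12) * (p3 - 13).
  have [h|h] := lerP p3 12; last by apply: mulr_ge0; lia.
  by rewrite mulr_le0 //; lia.
move: C1 C2 r1 r2 r3'; clear a1b a2b.
case/or4P: a1_cases => [||| /orP[]] /eqP ->.
all: case/or4P: a2_cases => [|||/orP[|/orP[|/orP[|/orP[|/orP[]]]]]] /eqP ->.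
all: rewrite ?normrN ?normr0 ?(ger0_norm (x := 1)) ?(ger0_norm (x := 2))
  ?(ger0_norm (x := 3)) ?(ger0_norm (x := 4)) //.
all: move=> C1 C2 r1 r2 r3'.
all: try (exfalso; clear half sq r3 F; lia).
all: have k3E : k3 = 6 by [apply: (pin_third _ _ _ r3 r3' half
  (ltac:(lia) : 2 * c3 < 2 * c3 + 1)) => //; clear half r3 F; lia].
all: subst k3; clear half sq.
all: split; [by []|].
all: have F66 := F 6 6; have F63 := F 6 3; have F36 := F 3 6.
all: try lia.
all: have F60 := F 6 0; have F06 := F 0 6; clear F; try lia.
Qed.

Lemma third_244 (r p1 p2 p3 a1 a2 c1 c2 c3 k3 s3 v3 : int) : 73 <= r ->
  r = 2 * p1 + a1 -> r = 4 * p2 + a2 -> p1 + p2 + p3 = r ->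
  -2 <= a1 <= 2 -> -6 <= a2 <= 6 ->
  `|a1| * (p1 - `|a1|) <= c1 -> `|a2| * (p2 - `|a2|) <= c2 -> 0 <= c3 ->
  r = k3 * p3 + s3 - v3 -> 0 <= s3 -> 0 <= v3 -> (s3 + v3) * p3 <= 2 * c3 ->
  (forall l l', 0 <= l -> 0 <= l' -> 2 * l <= p3 -> 2 * l' <= p3 ->
    l <= s3 -> l' <= v3 -> l * (p3 - l) + l' * (p3 - l') <= c3) ->
  9 * (c1 + c2 + c3) < 11 * r - 108 -> k3 = 4 /\ s3 <= 6 /\ v3 <= 6.
Proof.
move=> r73 r1 r2 pr a1b a2b C1 C2 c30 r3 s30 v30 half F budget.
have a1_cases : [|| a1 == 0, a1 == 1, a1 == -1, a1 == 2 | a1 == -2] by lia.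
have a2_cases : [|| a2 == 0, a2 == 1, a2 == -1, a2 == 2, a2 == -2, a2 == 3,
  a2 == -3, a2 == 4, a2 == -4,
  a2 == 5, a2 == -5, a2 == 6 | a2 == -6] by lia.
have r3' : r = 4 * p3 + - (2 * a1 + a2) by lia.
have sq : 0 <= (p3 - 12) * (p3 - 13).
  have [h|h] := lerP p3 12; last by apply: mulr_ge0; lia.
  by rewrite mulr_le0 //; lia.
move: C1 C2 r1 r2 r3'; clear a1b a2b.
case/or4P: a1_cases => [||| /orP[]] /eqP ->.
all: case/or4P: a2_cases
  => [|||/orP[|/orP[|/orP[|/orP[|/orP[|/orP[|/orP[|/orP[|/orP[]]]]]]]]]] /eqP ->.
all: rewrite ?normrN ?normr0 ?(ger0_norm (x := 1)) ?(ger0_norm (x := 2))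
  ?(ger0_norm (x := 3)) ?(ger0_norm (x := 4)) ?(ger0_norm (x := 5))
  ?(ger0_norm (x := 6)) //.
all: move=> C1 C2 r1 r2 r3'.
all: try (exfalso; clear half sq r3 F; lia).
all: have k3E : k3 = 4 by [apply: (pin_third _ _ _ r3 r3' half
  (ltac:(lia) : 2 * c3 < 2 * c3 + 1)) => //; clear half r3 F; lia].
all: subst k3; clear half sq.
all: split; [by []|].
all: have F66 := F 6 6; have F63 := F 6 3; have F36 := F 3 6.
all: try lia.
all: have F60 := F 6 0; have F06 := F 0 6; clear F; try lia.
Qed.

Lemma profile_cost2 (eps r p k s v t c o l l' : int) :
  profile eps r p k s v t c o -> 0 <= l -> 0 <= l' -> 2 * l <= p ->
  2 * l' <= p -> l <= s -> l' <= v -> l * (p - l) + l' * (p - l') <= c.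
Proof.
move=> P l0 l0' lp lp' ls lv; have [CS [CV [-> C]]] := profile_cost P.
by have [+ _] := C l l0 lp; have [_ +] := C l' l0' lp'; lia.
Qed.

Lemma profile_cost_abs (eps r p k s v t c o : int) :
  profile eps r p k s v t c o -> 2 * `|s - v| <= p ->
  `|s - v| * (p - `|s - v|) <= c.
Proof.
move=> P; have s0 := profile_s P; have v0 := profile_v P.
have [sv|sv] := lerP v s => h.
  by have := profile_cost2 P (l := s - v) (l' := 0); lia.
by have := profile_cost2 P (l := 0) (l' := v - s); lia.
Qed.

Lemma typeA (eps r D p1 k1 s1 v1 t1 c1 o1 p2 k2 s2 v2 t2 c2 o2
    p3 k3 s3 v3 t3 c3 o3 : int) :
  eps = 1 \/ eps = -1 ->
  profile eps r p1 k1 s1 v1 t1 c1 o1 ->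
  profile eps r p2 k2 s2 v2 t2 c2 o2 ->
  profile eps r p3 k3 s3 v3 t3 c3 o3 ->
  (p3 = 1 -> c3 = 0) ->
  73 <= r -> 1 <= p3 -> p3 <= p2 -> p2 <= p1 -> p1 + p2 + p3 <= r ->
  o1 + o2 + o3 <= 2 * r ->
  D = r * r - eps * r - (p1 * r - c1 - eps * o1)
    - (p2 * r - c2 - eps * o2) - (p3 * r - c3 - eps * o3) ->
  4 <= D -> 9 * D < 2 * r - 108 -> False.
Proof.
move=> eps1 P1 P2 P3 c3_0 r73 p3_1 p32 p21 p_le o_le DE D4 Dlt.
have o1_0 := profile_odd P1; have o2_0 := profile_odd P2.
have o3_0 := profile_odd P3.
pose delta := r - p1 - p2 - p3.
(* The signed term is at most r in absolute value because 0 <= o1 + o2 + o3 <= 2 r; 11 r is 2 r + 9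
   r. *)
have budget : 9 * (r * delta + c1 + c2 + c3) < 11 * r - 108.
  have : D = r * delta + c1 + c2 + c3 + eps * (o1 + o2 + o3 - r).
    by rewrite DE /delta; ring.
  by case: eps1 => ->; lia.
have s10 := profile_s P1; have s20 := profile_s P2; have s30 := profile_s P3.
have v10 := profile_v P1; have v20 := profile_v P2; have v30 := profile_v P3.
have r1 := profile_r P1; have r2 := profile_r P2; have r3 := profile_r P3.
have k10 := profile_k P1; have k20 := profile_k P2; have k30 := profile_k P3.
have F1 l l' := @profile_cost2 _ _ _ _ _ _ _ _ _ l l' P1.
have F2 l l' := @profile_cost2 _ _ _ _ _ _ _ _ _ l l' P2.
have F3 l l' := @profile_cost2 _ _ _ _ _ _ _ _ _ l l' P3.
have c10 : 0 <= c1 by have := F1 0 0; lia.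
have c20 : 0 <= c2 by have := F2 0 0; lia.
have c30 : 0 <= c3 by have := F3 0 0; lia.
have delta01 : delta = 0 \/ delta = 1.
  have delta0 : 0 <= delta by rewrite /delta; lia.
  have [|delta2] := ltrP delta 2; first by lia.
  have : 0 <= r * (delta - 2) by apply: mulr_ge0; lia.
  lia.
have deltaE : p1 + p2 + p3 = r - delta by rewrite /delta; ring.
have {}budget : 9 * (c1 + c2 + c3) < 11 * r - 108 - 9 * r * delta by lia.
clearbody delta.
have s13 : s1 <= 3.
  by rewrite leNgt; apply/negP => h; have := F1 4 0; lia.
have v13 : v1 <= 3.
  by rewrite leNgt; apply/negP => h; have := F1 0 4; lia.
have k1_cases : [\/ k1 = 1, k1 = 2 | k1 = 3].
  have [|h] := ltrP k1 4.
    have [h|?] := eqVneq k1 0; first by move: r1; rewrite h; lia.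
    move=> ?; have [->|?] := eqVneq k1 1; first by constructor 1.
    have [->|?] := eqVneq k1 2; first by constructor 2.
    by constructor 3; lia.
  have : 0 <= (k1 - 4) * p1 by apply: mulr_ge0; lia.
  lia.
case: k1_cases => k1E; rewrite k1E in P1 r1.
(* Here r = p1 + s1 - v1 while p2 + p3 >= 2, so s1 >= 2 at a cost of about 2 r. *)
- by have := F1 2 0; lia.
{ have s12 : s1 <= 2.
    by rewrite leNgt; apply/negP => h; have := F1 3 0; lia.
  have v12 : v1 <= 2.
    by rewrite leNgt; apply/negP => h; have := F1 0 3; lia.
  have v1c : (v1 = 0 \/ v1 = 1 /\ p1 - 1 <= c1) \/ v1 = 2 /\ 2 * p1 - 4 <= c1.
    have := F1 0 1; have := F1 0 2.
    have [|?] := ltrP v1 2; last by right; lia.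
    by have [|?] := ltrP v1 1; [left; left|left; right]; lia.
  have s1c : (s1 = 0 \/ s1 = 1 /\ p1 - 1 <= c1) \/ s1 = 2 /\ 2 * p1 - 4 <= c1.
    have := F1 1 0; have := F1 2 0.
    have [|?] := ltrP s1 2; last by right; lia.
    by have [|?] := ltrP s1 1; [left; left|left; right]; lia.
  have s26 : s2 <= 6.
    rewrite leNgt; apply/negP => h; have := F2 7 0; move: v1c s1c delta01.
    clear F1 F2 F3; case=> [[?|[? ?]]|[? ?]] _ [?|?]; subst delta; lia.
  have v26 : v2 <= 6.
    rewrite leNgt; apply/negP => h; have := F2 0 7; move: v1c s1c delta01.
    clear F1 F2 F3; case=> [[?|[? ?]]|[? ?]] _ [?|?]; subst delta; lia.
  have k2_cases : [\/ k2 = 2, k2 = 3 | k2 = 4].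
    have [|h] := ltrP k2 5; last first.
      have : 0 <= (k2 - 5) * p2 by apply: mulr_ge0; lia.
      case: delta01 => ?; subst delta; lia.
    have [h|?] := eqVneq k2 0; first by move: r2; rewrite h; lia.
    have [h|?] := eqVneq k2 1; first by move: r2; rewrite h; lia.
    move=> ?; have [->|?] := eqVneq k2 2; first by constructor 1.
    have [->|?] := eqVneq k2 3; first by constructor 2.
    by constructor 3; lia.
  case: k2_cases => k2E; rewrite k2E in P2 r2.
  { have s22 : s2 <= 2.
      rewrite leNgt; apply/negP => h; have := F2 3 0.
      by case: delta01 => ?; subst delta; lia.
    have v22 : v2 <= 2.
      rewrite leNgt; apply/negP => h; have := F2 0 3.
      by case: delta01 => ?; subst delta; lia.
    (* Otherwise s1 + s2 - v1 - v2 = 2 (delta + p3) >= 4 forces s1 = s2 = 2, at a cost of about 2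
       r. *)
    have p3E : p3 = 1 /\ delta = 0.
      have [h|?] := lerP 2 (delta + p3); last by lia.
      have := F1 2 0; have := F2 2 0.
      by case: delta01 => ?; subst delta; lia.
    case: p3E => p3E delta0; subst p3 delta.
    apply: (@typeA_22 eps r D p1 s1 v1 t1 c1 o1 p2 s2 v2 t2 c2 o2 o3);
      try lia; try assumption. }
  { have s24 : s2 <= 4.
      rewrite leNgt; apply/negP => h; have := F2 5 0.
      by case: delta01 => ?; subst delta; lia.
    have v24 : v2 <= 4.
      rewrite leNgt; apply/negP => h; have := F2 0 5.
      by case: delta01 => ?; subst delta; lia.
    (* With delta = 1 the budget drops to 2 r - 108. Nothing may be spent at the first two points,
       so r = 2 p1 = 3 p2 and r = 6 p3 + 6, which no k3 achieves with s3 and v3 at most 1. *)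
    have delta0 : delta = 0.
      case: delta01 => // ?; subst delta.
      have [sE vE] : s1 = 0 /\ v1 = 0 by clear F1 F2 F3; lia.
      have [h|?] := lerP 1 s2; first by have := F2 1 0; lia.
      have [h|?] := lerP 1 v2; first by have := F2 0 1; lia.
      have [h|?] := lerP 2 s3; first by have := F3 2 0; lia.
      have [h|?] := lerP 2 v3; first by have := F3 0 2; lia.
      have r6 : r = 6 * p3 + 6 by lia.
      have [h|h] := lerP k3 6.
        by have : 0 <= (6 - k3) * p3 by [apply: mulr_ge0; lia]; lia.
      by have : 0 <= (k3 - 7) * p3 by [apply: mulr_ge0; lia]; lia.
    subst delta.
    have [] := @third_236 r p1 p2 p3 (s1 - v1) (s2 - v2) c1 c2 c3 k3 s3 v3 r73
      _ _ _ _ _ (profile_cost_abs P1 _) (profile_cost_abs P2 _) c30 r3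
      s30 v30 (profile_half P3) F3 _; try (clear F1 F2 F3; lia).
    move=> k3E [s36 v36].
    apply: (typeA_236 eps1 P1 P2 P3 r73 DE D4 Dlt) => //; clear F1 F2 F3; lia. }
  { have delta0 : delta = 0.
      case: delta01 => // ?; subst delta.
      have [sE vE] : s1 = 0 /\ v1 = 0 by clear F1 F2 F3; lia.
      have [h|?] := lerP 1 s2; first by have := F2 1 0; lia.
      have [h|?] := lerP 1 v2; first by have := F2 0 1; lia.
      have [h|?] := lerP 1 s3; first by have := F3 1 0; lia.
      have [h|?] := lerP 1 v3; first by have := F3 0 1; lia.
      have r6 : r = 4 * p3 + 4 by lia.
      have [h|h] := lerP k3 4.
        by have : 0 <= (4 - k3) * p3 by [apply: mulr_ge0; lia]; lia.
      by have : 0 <= (k3 - 5) * p3 by [apply: mulr_ge0; lia]; lia.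
    subst delta.
    have [] := @third_244 r p1 p2 p3 (s1 - v1) (s2 - v2) c1 c2 c3 k3 s3 v3 r73
      _ _ _ _ _ (profile_cost_abs P1 _) (profile_cost_abs P2 _) c30 r3
      s30 v30 (profile_half P3) F3 _; try (clear F1 F2 F3; lia).
    move=> k3E [s36 v36].
    apply: (typeA_244 eps1 P1 P2 P3 r73 DE D4 Dlt) => //; clear F1 F2 F3; lia. } }
have s24 : s2 <= 4.
  rewrite leNgt; apply/negP => h; have := F2 5 0.
  by case: delta01 => ?; subst delta; lia.
have v24 : v2 <= 4.
  rewrite leNgt; apply/negP => h; have := F2 0 5.
  by case: delta01 => ?; subst delta; lia.
have s34 : s3 <= 4.
  rewrite leNgt; apply/negP => h; have := F3 5 0.
  by case: delta01 => ?; subst delta; lia.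
have v34 : v3 <= 4.
  rewrite leNgt; apply/negP => h; have := F3 0 5.
  by case: delta01 => ?; subst delta; lia.
have k2E : k2 = 3 by apply: (@mul_pin _ _ p2); lia.
have k3E : k3 = 3 by apply: (@mul_pin _ _ p3); lia.
subst k1 k2 k3.
have delta0 : delta = 0.
  case: delta01 => // ?; subst delta.
  have [h|[h|h]] : 1 <= s1 \/ 1 <= s2 \/ 1 <= s3 by lia.
  - by have := F1 1 0; lia.
  - by have := F2 1 0; lia.
  - by have := F3 1 0; lia.
apply: (typeA_333 eps1 P1 P2 P3 r73 DE D4 Dlt) => //; lia.
Qed.

(** * Spectra whose largest parts overlap *)

(** The information that [gap_sum] gives on the cost c of parts at most p with sum S: c is small
    only if S is close to a multiple of p. *)
Definition gap_bound (c p S : int) : Prop :=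
  forall k, 0 <= k -> (S - k * p) * ((k + 1) * p - S) <= c.

(** Beside the largest part y, the parts add up to A, with maximum z. If h >= 2, then h A - z is
    about r / 2 or more; if h = 1, a difference A - z > 0 is too expensive by the gap bound. The
    outcome is y = r/2 + 1 and z = r/2 - 1. *)
Lemma typeB_z_core (r kappa h y z A c B : int) :
  73 <= r -> 1 <= kappa -> kappa <= h -> y = z + kappa + h -> r = A + y ->
  0 <= z -> z <= A -> 1 <= A -> 0 <= c -> gap_bound c z A ->
  h * A + c - z <= B -> 9 * B < 2 * r - 108 ->
  [/\ kappa = 1, A = z & r = 2 * z + 2].
Proof.
move=> r73 k1 kh yE rE z0 zA A1 c0 G hB Blt.
have G1 := G 1 isT.
have h1 : h = 1.
  have [h2|] := lerP 2 h; last by lia.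
  have : 0 <= (h - 2) * (A - 1) by apply: mulr_ge0; lia.
  lia.
have k1' : kappa = 1 by lia.
subst h kappa.
have [A_z|A_z] := ltrP z A; last by split; lia.
have [h|h] := lerP 2 (A - z); last first.
  have AE : A = z + 1 by lia.
  subst A; lia.
have : 0 <= (A - z - 2) * (2 * z - A + 1) by apply: mulr_ge0; lia.
lia.
Qed.

(** The cost c < 2r/9 forces r to be near 3x, 4x, 5x or 6x. Then A is near 5w, 3w, 7w/3 or 2w
    without being a multiple of w, and the gap bound for A is violated. *)
Lemma typeB_mixed (r x w z A c c' : int) :
  73 <= r -> 0 <= z -> z < w -> 2 * w = r - 2 - 2 * x ->
  2 * A = r + 2 * x -> 2 * w <= A -> gap_bound c x r -> gap_bound c' w A ->
  0 <= c -> z <= c' -> 9 * (c + c' - z) < 2 * r - 108 -> False.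
Proof.
move=> r73 z0 zw wE AE w2 G G' c0 zc lt.
have c_lt : 9 * c < 2 * r - 108 by lia.
have xb : r <= 6 * x + 4 by lia.
have xb' : 2 * x <= r - 4 by lia.
have x_cases : [\/ r = 3 * x, r = 4 * x, -1 <= r - 5 * x <= 1 |
                -1 <= r - 6 * x <= 1].
  have prod1 (b e : int) : 1 <= b -> 1 <= e -> b * e <= c -> b + e - 1 <= c.
    by move=> b1 e1; have : 0 <= (b - 1) * (e - 1) by [apply: mulr_ge0; lia]; lia.
  have [h3|h3] := lerP r (3 * x).
    have [e0|e0] := eqVneq (3 * x - r) 0; first by constructor 1; lia.
    have := prod1 (r - 2 * x) (3 * x - r); have := G 2 isT; lia.
  have [h4|h4] := lerP r (4 * x).
    have [e0|e0] := eqVneq (4 * x - r) 0; first by constructor 2; lia.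
    by have := prod1 (r - 3 * x) (4 * x - r); have := G 3 isT; lia.
  (* From here on x may be r/5 or r/6. As 1/5 < 2/9 < 1/4, a product with one factor 1 is no longer
     over budget; hence the windows of width one around 5x and 6x. *)
  have prod2 (b e : int) : 2 <= b -> 2 <= e -> b * e <= c -> 2 * b + 2 * e - 4 <= c.
    by move=> b1 e1; have : 0 <= (b - 2) * (e - 2) by [apply: mulr_ge0; lia]; lia.
  have [h5|h5] := lerP r (5 * x).
    have [e0|e0] := lerP (5 * x - r) 1; first by constructor 3; lia.
    have [b1|b1] := eqVneq (r - 4 * x) 1.
      by have := G 4 isT; rewrite b1; lia.
    by have := prod2 (r - 4 * x) (5 * x - r); have := G 4 isT; lia.
  have [b1|b1] := lerP (r - 5 * x) 1; first by constructor 3; lia.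
  have [h6|h6] := lerP r (6 * x).
    have [e0|e0] := lerP (6 * x - r) 1; first by constructor 4; lia.
    by have := prod2 (r - 5 * x) (6 * x - r); have := G 5 isT; lia.
  have [b0|b0] := lerP (r - 6 * x) 1; first by constructor 4; lia.
  have := prod2 (r - 6 * x) (7 * x - r); have := G 6 isT; lia.
have {}G' k : 0 <= k -> (A - k * w) * ((k + 1) * w - A) <= c' by exact: G'.
case: x_cases => xE.
- have A5 : A - 5 * w = 5 by lia.
  by have := G' 5 isT; rewrite A5; lia.
- have A3 : A - 3 * w = 3 by lia.
  by have := G' 3 isT; rewrite A3; lia.
- have := G' 2 isT.
  have : 0 <= (A - 2 * w - 8) * (3 * w - A) by apply: mulr_ge0; lia.
  lia.
have [u [uE u1]] : exists u : int, A - 2 * w = u /\ 1 <= u by exists (A - 2 * w); lia.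
have := G' 2 isT; rewrite uE.
have [?|[?|?]] : u = 1 \/ u = 2 \/ u = 3 by lia.
all: subst u; lia.
Qed.

(* kappa is the amount by which the three largest parts exceed r. *)
Lemma typeB_z (D r kappa g x y2 y3 h2 h3 w2 z2 z3 A2 A3 c1 c2 c3 : int) :
  73 <= r -> 1 <= kappa -> 0 <= g -> x = kappa + g -> r = y2 + y3 + g ->
  y2 = w2 + kappa + h2 -> y3 = z3 + kappa + h3 -> A2 = r - y2 -> A3 = r - y3 ->
  0 <= h2 -> 0 <= c1 -> 0 <= c2 -> 0 <= c3 ->
  gap_bound c1 x r -> gap_bound c2 w2 A2 -> gap_bound c3 z3 A3 ->
  0 <= z2 -> z2 <= w2 -> z2 <= w2 + h2 - kappa -> z2 * (w2 - z2) <= c2 ->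
  z2 <= A2 -> w2 = z2 \/ z2 < w2 /\ 2 * w2 + z2 <= A2 ->
  0 <= z3 -> z3 <= z3 + h3 - kappa -> z3 <= A3 ->
  kappa * g + h2 * A2 + h3 * A3 + c1 + c2 + c3 - g - z2 - z3 <= D ->
  9 * D < 2 * r - 108 -> False.
Proof.
move=> r73 k1 g0 xE rE y2E y3E A2E A3E h20 c10 c20 c30 G1 G2 G3.
move=> z20 zw2 zh2 zc2 zA2 w2z z30 zh3 zA3 DE Dlt.
have kg : 0 <= (kappa - 1) * g by apply: mulr_ge0; lia.
(* The loss z2 is paid for by A2 if h2 >= 1; if h2 = 0 then z2 < w2, and the cost z2 (w2 - z2)
   pays. *)
have hA2 : z2 <= h2 * A2 + c2.
  have [h2_1|h2_0] := lerP 1 h2.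
    have : 0 <= (h2 - 1) * A2 by apply: mulr_ge0; lia.
    lia.
  have h2E : h2 = 0 by lia.
  have : 0 <= z2 * (w2 - z2 - 1) by apply: mulr_ge0; lia.
  rewrite h2E; lia.
have [||||kE A3z r3] := @typeB_z_core r kappa h3 y3 z3 A3 c3 D r73 k1 _ y3E _
  z30 zA3 _ c30 G3 _ Dlt; try lia.
subst kappa.
have h3E : h3 = 1 by lia.
case: w2z => [w2E|[zw w2A]].
  subst w2.
  have hA3 : z3 <= h3 * A3 + c3 by rewrite h3E; lia.
  (* Both y2 and y3 would be r/2 + 1, against y2 + y3 <= r. *)
  have [||||_ A2z r2] := @typeB_z_core r 1 h2 y2 z2 A2 c2 D r73 k1 _ y2E _ z20
    zA2 _ c20 G2 _ Dlt; lia.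
have h2E : h2 = 0.
  have [h|] := lerP 1 h2; last by lia.
  have : 0 <= (h2 - 1) * A2 by apply: mulr_ge0; lia.
  lia.
subst h2 h3.
by apply: (@typeB_mixed r x w2 z2 A2 c1 c2) => //; lia.
Qed.

(* At each point n and m are the sum and the cost of the parts of type m, Y or Z
   is the sum of the other parts (without the largest one, y, at the last two
   points), and x is the largest part of type m. *)
Lemma typeB_paired_far (D r kappa g x Y1 n1 m1
    y2 y3 h2 h3 x2 x3 Z2 Z3 n2 n3 m2 m3 : int) :
  73 <= r -> 2 <= kappa -> 0 <= g -> x = kappa + g -> r = y2 + y3 + g ->
  y2 = x2 + kappa + h2 -> y3 = x3 + kappa + h3 ->
  0 <= h2 -> 0 <= h3 -> 0 <= Y1 -> r = Y1 + 2 * n1 -> x <= n1 ->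
  0 <= Z2 -> 0 <= Z3 -> r = y2 + Z2 + 2 * n2 -> r = y3 + Z3 + 2 * n3 ->
  1 <= x2 -> 1 <= x3 -> x2 <= n2 -> x3 <= n3 ->
  0 <= m1 -> 0 <= m2 -> 0 <= m3 -> gap_bound m1 x n1 ->
  (m1 = 0 \/ x - 1 <= m1) -> (m2 = 0 \/ x2 - 1 <= m2) ->
  (m3 = 0 \/ x3 - 1 <= m3) ->
  (kappa - 1) * (g + Z2 + Z3) + kappa * Y1 + 2 * m1 + 2 * m2 + 2 * m3 +
    h2 * (2 * n2) + h3 * (2 * n3) <= D ->
  9 * D < 2 * r - 108 ->
  [/\ g = 0, h2 = 0 & h3 = 0] /\ [/\ Y1 = 0, Z2 = 0 & Z3 = 0] /\
  [/\ m1 = 0, m2 = 0 & m3 = 0].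
Proof.
move=> r73 k2 g0 xE rE y2E y3E h20 h30 Y10 r1 xn1 Z20 Z30 r2 r3 x21 x31 xn2 xn3.
move=> m10 m20 m30 G M1 M2 M3 DE Dlt.
have kg0 : 0 <= (kappa - 1) * g by apply: mulr_ge0; lia.
have kZ2 : 0 <= (kappa - 1) * Z2 by apply: mulr_ge0; lia.
have kZ3 : 0 <= (kappa - 1) * Z3 by apply: mulr_ge0; lia.
have kY1 : 0 <= kappa * Y1 by apply: mulr_ge0; lia.
have hn2 : 0 <= h2 * n2 by apply: mulr_ge0; lia.
have hn3 : 0 <= h3 * n3 by apply: mulr_ge0; lia.
have h_eq0 h n Z y y' xx : 0 <= h -> 1 <= xx -> xx <= n -> 0 <= Z ->
    0 <= (kappa - 1) * Z -> y = xx + kappa + h ->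
    r = y + Z + 2 * n -> y' + g = Z + 2 * n -> 0 <= h * n ->
    9 * ((kappa - 1) * Z + h * (2 * n)) < 2 * r - 108 -> h = 0.
  move=> h0 xx1 xxn Z0 kZ yE ry _ hn lt.
  have [h1|] := lerP 1 h; last by lia.
  have hM : 0 <= (h - 1) * (2 * n - 2) by apply: mulr_ge0; lia.
  have kb : kappa <= n1 by lia.
  have [k3|k3] := lerP 3 kappa; last first.
    have kE : kappa = 2 by lia.
    subst kappa; lia.
  have : 0 <= (kappa - 3) * Z by apply: mulr_ge0; lia.
  lia.
have h2E : h2 = 0 by apply: (h_eq0 h2 n2 Z2 y2 y3 x2); lia.
have h3E : h3 = 0 by apply: (h_eq0 h3 n3 Z3 y3 y2 x3); lia.
subst h2 h3.
(* Since y_i = x_i + kappa and x_i <= n_i, 3 y_i <= r + 2 kappa; the two inequalities are added. *)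
have xr : r + g <= 4 * x by lia.
have gE : g = 0.
  have [g1|] := lerP 1 g; last by lia.
  have : 0 <= (kappa - 2) * (g - 1) by apply: mulr_ge0; lia.
  lia.
have Z2E : Z2 = 0.
  have [Z1|] := lerP 1 Z2; last by lia.
  have : 0 <= (kappa - 1) * (Z2 - 1) by apply: mulr_ge0; lia.
  lia.
have Z3E : Z3 = 0.
  have [Z1|] := lerP 1 Z3; last by lia.
  have : 0 <= (kappa - 1) * (Z3 - 1) by apply: mulr_ge0; lia.
  lia.
have Y1E : Y1 = 0.
  have [Z1|] := lerP 1 Y1; last by lia.
  have : 0 <= kappa * (Y1 - 1) by apply: mulr_ge0; lia.
  lia.
subst g Z2 Z3 Y1.
have m1E : m1 = 0 by lia.
split; first by [].
split; first by [].
subst m1.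
(* Zero cost leaves n1 = x or 2 x, and n1 = x would give x2 + x3 = 0. So r = 4 x, with parts x, x,
   x, x at the first point and 2x, x, x at the others. *)
have xE' : 2 * x = n1.
  have := G 1 isT.
  have [e|e] := lerP (2 * x) n1; first by lia.
  have [b|b] := eqVneq n1 x; first by lia.
  have : 0 <= (n1 - x - 1) * (2 * x - n1 - 1) by apply: mulr_ge0; lia.
  lia.
split => //; lia.
Qed.

(** As x3 <= x2 and x2 + x3 = r/2 - 1, the second point leaves r = 3 x2 + 1, r = 4 x2 or r = 4 x2 +
    2. At the third point, A3 is then 5 x3 + 3, or 3 x3 + 3, or else Z3 is x3 + 1 with parts at most
    x3 - 1: each time the remainder is too expensive. *)
Lemma typeB_half (D r x x2 x3 z2 z3 Z3 n3 m3 u3 A2 A3 c2 c3 : int) :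
  73 <= r -> r = 2 * x -> x2 + x3 = x - 1 -> x3 <= x2 ->
  A2 = r - x2 - 1 -> A3 = r - x3 - 1 ->
  0 <= z2 -> z2 < x2 -> 2 * x2 + z2 <= A2 -> gap_bound c2 x2 A2 ->
  z2 <= c2 -> z3 <= c3 -> 0 <= z3 -> z3 < x3 -> gap_bound c3 x3 A3 ->
  A3 = Z3 + 2 * n3 -> x3 <= n3 -> z3 <= Z3 -> c3 = u3 + 2 * m3 -> 0 <= m3 ->
  gap_bound m3 x3 n3 -> Z3 <= u3 -> gap_bound (u3 - Z3) (x3 - 1) Z3 ->
  c2 - z2 + c3 - z3 <= D -> 9 * D < 2 * r - 108 -> False.
Proof.
move=> r73 rE xE x32 A2E A3E z20 zx2 xz2 G2 zc2 zc3 z30 zx3 G3.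
move=> A3E' xn3 zZ3 c3E m30 Gm Zu Gu DE Dlt.
pose B := A2 - 2 * x2.
have B0 : 0 <= B by rewrite /B; lia.
have [Bz|B1] := eqVneq B 0.
  have rE' : r = 3 * x2 + 1 by rewrite /B in Bz; lia.
  have A35 : A3 - 5 * x3 = 3 by lia.
  by have := G3 5 isT; rewrite A35; lia.
have G2' : B * (x2 - B) <= c2 by have := G2 2 isT; rewrite /B; lia.
have Bz : z2 <= B by rewrite /B; lia.
have eE : x2 - B = 4 * x2 - r + 1 by rewrite /B; lia.
have [e2|e2] := lerP 2 (x2 - B).
  have : 0 <= (B - 1) * (x2 - B - 2) by apply: mulr_ge0; lia.
  clear G2 G3 Gm Gu; lia.
have [e1|e1] : 4 * x2 = r \/ 4 * x2 + 2 = r by clear G2'; lia.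
  have A33 : A3 - 3 * x3 = 3 by lia.
  by have := G3 3 isT; rewrite A33; lia.
have x3E : x3 = x2 by lia.
have [nx|nx] := ltrP x3 n3.
  have : 0 <= (n3 - x3 - 1) * (2 * x3 - n3 - 1) by apply: mulr_ge0; lia.
  by have := Gm 1 isT; lia.
have Z3E : Z3 = x3 + 1 by lia.
by have := Gu 1 isT; rewrite Z3E; lia.
Qed.

Lemma typeB_paired_near (D r x Y1 n1 u1 m1 c1 y2 y3 h2 h3 x2 x3 z2 z3 Z2 Z3
    n2 n3 u2 u3 m2 m3 c2 c3 A2 A3 : int) :
  73 <= r -> 1 <= x -> r = y2 + y3 + (x - 1) ->
  y2 = x2 + 1 + h2 -> y3 = x3 + 1 + h3 -> 0 <= h2 -> 0 <= h3 ->
  A2 = r - y2 -> A3 = r - y3 ->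
  r = Y1 + 2 * n1 -> x <= n1 -> c1 = u1 + 2 * m1 -> 0 <= Y1 -> Y1 <= u1 ->
  0 <= m1 -> gap_bound u1 x Y1 -> gap_bound m1 x n1 ->
  A2 = Z2 + 2 * n2 -> A3 = Z3 + 2 * n3 -> x2 <= n2 -> x3 <= n3 ->
  z2 <= Z2 -> z3 <= Z3 -> 0 <= z2 -> 0 <= z3 -> z2 < x2 -> z3 < x3 ->
  0 <= c2 -> 0 <= c3 -> c2 = u2 + 2 * m2 -> c3 = u3 + 2 * m3 ->
  0 <= m2 -> 0 <= m3 ->
  gap_bound c2 x2 A2 -> gap_bound c3 x3 A3 ->
  gap_bound m2 x2 n2 -> gap_bound m3 x3 n3 ->
  Z2 <= u2 -> Z3 <= u3 ->
  gap_bound (u2 - Z2) (x2 - 1) Z2 -> gap_bound (u3 - Z3) (x3 - 1) Z3 ->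
  h2 * A2 + h3 * A3 + c1 + c2 - z2 + c3 - z3 <= D ->
  9 * D < 2 * r - 108 -> False.
Proof.
move=> r73 x1 rE y2E y3E h20 h30 A2E A3E r1 xn1 c1E Y10 Yu1 m10 Gu1 Gm1.
move=> A2E' A3E' xn2 xn3 zZ2 zZ3 z20 z30 zx2 zx3 c20 c30 c2E c3E m20 m30.
move=> G2 G3 Gm2 Gm3 Zu2 Zu3 Gu2 Gu3 DE Dlt.
have hA2 : 0 <= h2 * A2 by apply: mulr_ge0; lia.
have hA3 : 0 <= h3 * A3 by apply: mulr_ge0; lia.
have H0 : h2 + h3 = 0.
  have [H1|] := lerP 1 (h2 + h3); last by lia.
  (* The loss z2 is at most A2 / 3, because z2 <= Z2, z2 < x2 <= n2 and A2 = Z2 + 2 n2. *)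
  have b2 : 2 * (h2 * A2) <= 3 * (h2 * A2 + c2 - z2).
    have [h1|h1] := lerP 1 h2; last by have -> : h2 = 0 by [lia]; lia.
    have : 0 <= (h2 - 1) * A2 by apply: mulr_ge0; lia.
    lia.
  have b3 : 2 * (h3 * A3) <= 3 * (h3 * A3 + c3 - z3).
    have [h1|h1] := lerP 1 h3; last by have -> : h3 = 0 by [lia]; lia.
    have : 0 <= (h3 - 1) * A3 by apply: mulr_ge0; lia.
    lia.
  have a2 : 0 <= h2 * (A2 - x - 1) by apply: mulr_ge0; lia.
  have a3 : 0 <= h3 * (A3 - x - 1) by apply: mulr_ge0; lia.
  have b : 3 * ((h2 + h3) * (x + 1)) < r - 54 by lia.
  have b' : 0 <= (h2 + h3) * (3 * x + 1 + 2 * (h2 + h3) - r).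
    by apply: mulr_ge0; lia.
  have : 0 <= (h2 + h3) * (x - 1) by apply: mulr_ge0; lia.
  move=> b''; have : 0 <= (h2 + h3 - 1) * (r - 2 * (h2 + h3)).
    by apply: mulr_ge0; lia.
  lia.
have h2E : h2 = 0 by lia.
have h3E : h3 = 0 by lia.
subst h2 h3.
have n1E : n1 = x.
  have [nx|] := ltrP x n1; last by lia.
  have : 0 <= (n1 - x - 1) * (2 * x - n1 - 1) by apply: mulr_ge0; lia.
  have := Gm1 1 isT; lia.
subst n1.
have Y1E : Y1 = 0.
  have [Y11|] := lerP 1 Y1; last by lia.
  have : 0 <= (Y1 - 1) * (x - Y1 - 1) by apply: mulr_ge0; lia.
  have := Gu1 0 isT; lia.
subst Y1.
have [x32|x23] := lerP x3 x2.
  by apply: (@typeB_half D r x x2 x3 z2 z3 Z3 n3 m3 u3 A2 A3 c2 c3) => //; lia.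
by apply: (@typeB_half D r x x3 x2 z3 z2 Z2 n2 m2 u2 A3 A2 c3 c2) => //; lia.
Qed.

(** * The numerical theorem *)

Definition top_m (d : spectrum) : nat := head 0%N (m_seq d).
Definition top_e (d : spectrum) : nat := head 0%N (e_seq d).
(** The largest part at 1 or -1 once [top_e] is removed; it merges the last two MC inequalities. *)
Definition second_ef (d : spectrum) : nat :=
  maxn (head 0%N (behead (e_seq d))) (head 0%N (f_seq d)).
Definition squares (d : spectrum) : int := \sum_(q <- parts d) q%:Z * q%:Z.

Definition well_ordered (d : spectrum) : bool :=
  descending d && (head 0 (f_seq d) <= top_e d)%N.

Definition MC_ordered (r : int) (d1 d2 d3 : spectrum) : bool :=
  [&& (top_m d1)%:Z + (top_m d2)%:Z + (top_m d3)%:Z <= r,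
      (top_e d1)%:Z + (top_e d2)%:Z + (top_e d3)%:Z <= r,
      (top_m d1)%:Z + (top_m d2)%:Z + (top_e d3)%:Z <= r &
      2 * ((top_m d1)%:Z + (top_e d2)%:Z) + (top_e d3)%:Z + (second_ef d3)%:Z
        <= 2 * r].

Definition MC_minimal (r : int) (d1 d2 d3 : spectrum) : bool :=
  [&& MC_ordered r d1 d2 d3, MC_ordered r d2 d3 d1, MC_ordered r d3 d1 d2,
      MC_ordered r d2 d1 d3, MC_ordered r d1 d3 d2 & MC_ordered r d3 d2 d1].

(** Twice the dimension of the centralizer, by [dim_lie_centralizer_excess]. *)
Definition excess (eps : int) (d : spectrum) : int :=
  squares d - eps * signed_sum Posz d.

Lemma sorted_le_head (s : seq nat) (q : nat) :
  sorted geq s -> q \in s -> (q <= head 0 s)%N.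
Proof.
case: s => //= x s; rewrite path_sortedE; last by move=> ? ? ? /= ? /leq_trans; apply.
by move=> /andP[/allP xs _]; rewrite inE => /predU1P[-> //|/xs].
Qed.

Lemma sum_ge_mem (s : seq nat) (q : nat) :
  q \in s -> q%:Z <= \sum_(j <- s) j%:Z.
Proof.
by move=> qs; rewrite (big_rem q qs) /= lerDl; apply: sumr_ge0.
Qed.

Lemma sum_ge_head (s : seq nat) : (head 0 s)%:Z <= \sum_(j <- s) j%:Z.
Proof.
by case: s => [|q s]; [rewrite big_nil|apply: sum_ge_mem; rewrite mem_head].
Qed.

Lemma second_ef_le (d : spectrum) :
  well_ordered d -> (second_ef d <= top_e d)%N.
Proof.
case/andP=> /and3P[se _ _] fe; rewrite geq_max fe andbT /top_e.
by case: (e_seq d) se => [|x [|y s]] //= /andP[].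
Qed.

Lemma odd_bounds (d : spectrum) : well_ordered d ->
  [/\ 0 <= signed_sum Posz d, signed_sum Posz d <= 2 * (top_e d)%:Z,
      (top_e d)%:Z - (second_ef d)%:Z <= signed_sum Posz d &
      signed_sum Posz d <= (top_e d)%:Z + (second_ef d)%:Z].
Proof.
case/andP=> /and3P[se sf _] fe.
have srt s : sorted geq s -> sorted >=%R (map Posz s).
  by move=> ss; rewrite sorted_map; apply: sub_sorted ss => x y /=; lia.
have nneg s : all (>= 0) (map Posz s) by apply/allP => x /mapP[q _ ->].
have hd s : head 0 (map Posz s) = (head 0%N s)%:Z by case: s.
have := altsum_bound (srt _ sf) (nneg _); rewrite hd.
have := altsum_bound (srt _ se) (nneg _); rewrite hd.
have : (top_e d)%:Z - (head 0%N (behead (e_seq d)))%:Z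
    <= altsum (map Posz (e_seq d)).
  rewrite /top_e; case: (e_seq d) se => [|x s] //= ss.
  by have /andP[] := altsum_bound2 (srt (x :: s) ss) (nneg (x :: s)); rewrite hd.
by rewrite /signed_sum /second_ef /top_e in fe *; split; lia.
Qed.

Lemma total_squares (d : spectrum) (r p : int) :
  r = \sum_(q <- parts d) q%:Z -> squares d = p * r - cost d p.
Proof.
move=> ->; rewrite /squares /cost mulr_sumr -sumrB.
by apply: eq_bigr => q _; ring.
Qed.

Lemma numeric_typeA (eps r D : int) (d1 d2 d3 : spectrum) :
  eps = 1 \/ eps = -1 -> 73 <= r ->
  well_ordered d1 -> well_ordered d2 -> well_ordered d3 ->
  r = \sum_(q <- parts d1) q%:Z -> r = \sum_(q <- parts d2) q%:Z ->
  r = \sum_(q <- parts d3) q%:Z ->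
  (top_e d1)%:Z + (top_e d2)%:Z + (top_e d3)%:Z <= r ->
  let p d := maxn (top_m d) (top_e d) in
  (p d3 <= p d2)%N -> (p d2 <= p d1)%N ->
  (p d1)%:Z + (p d2)%:Z + (p d3)%:Z <= r ->
  D = r * r - eps * r - excess eps d1 - excess eps d2 - excess eps d3 ->
  4 <= D -> 9 * D < 2 * r - 108 -> False.
Proof.
move=> eps1 r73 w1 w2 w3 r1 r2 r3 e_le p p32 p21 p_le DE D4 Dlt.
have prof d : well_ordered d -> r = \sum_(q <- parts d) q%:Z ->
    exists k s v t, profile eps r (p d) k s v t (cost d (p d)) (signed_sum Posz d).
  move=> /andP[dd fe] rE; apply: profileP => //; rewrite /p ?leq_max ?leqnn ?orbT //.
  by rewrite fe orbT.
have [k1 [s1 [v1 [t1 P1]]]] := prof _ w1 r1.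
have [k2 [s2 [v2 [t2 P2]]]] := prof _ w2 r2.
have [k3 [s3 [v3 [t3 P3]]]] := prof _ w3 r3.
have le_p d q : well_ordered d -> q \in parts d -> (q <= p d)%N.
  move=> /andP[/and3P[se sf sm] fe]; rewrite /p leq_max !mem_cat.
  case/or4P => /(sorted_le_head _) h; apply/orP.
  - by right; apply: h.
  - by right; apply: leq_trans fe; apply: h.
  - by left; apply: h.
  - by left; apply: h.
have p3_1 : 1 <= (p d3)%:Z.
  rewrite lez_nat lt0n; apply/negP => /eqP p0.
  suff : r = 0 by lia.
  by rewrite r3 big_seq big1 // => q /(le_p _ _ w3); rewrite p0 leqn0 => /eqP->.
have [o1 o1' _ _] := odd_bounds w1; have [o2 o2' _ _] := odd_bounds w2.
have [o3 o3' _ _] := odd_bounds w3.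
apply: (typeA eps1 P1 P2 P3) D4 Dlt => //; try lia.
  move=> pE; rewrite /cost big_seq big1 // => q /(le_p _ _ w3).
  by rewrite pE; case: q => [|[|q]] //; lia.
by rewrite DE /excess (total_squares (p d1)%:Z r1) (total_squares (p d2)%:Z r2)
  (total_squares (p d3)%:Z r3).
Qed.

(* Z and u are the sum and the cost relative to w of parts at 1 and -1, all at
   most z; n and m are those of the parts of type m. *)
Record tail_data (w z Z n u m : int) : Prop := TailData {
  tail_Z : 0 <= Z;
  tail_u : (w - z) * Z <= u;
  tail_u0 : Z = 0 -> u = 0;
  tail_m : 0 <= m;
  tail_m0 : m = 0 \/ w - 1 <= m;
  tail_gap : gap_bound (u + 2 * m) w (Z + 2 * n);
  tail_gap_m : gap_bound m w n;
  tail_gap_u : forall t, z <= t -> gap_bound (u - (w - t) * Z) t Z }.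

Lemma gap_bound_list (s : seq nat) (w : int) :
  all (fun q : nat => q%:Z <= w) s ->
  gap_bound (\sum_(q <- s) q%:Z * (w - q%:Z)) w (\sum_(q <- s) q%:Z).
Proof. by move=> sw k k0; apply: gap_sum. Qed.

Lemma tail_dataP (E m : seq nat) (w z : int) :
  all (fun q : nat => q%:Z <= z) E -> all (fun q : nat => q%:Z <= w) m ->
  z <= w ->
  tail_data w z (\sum_(q <- E) q%:Z) (\sum_(q <- m) q%:Z)
    (\sum_(q <- E) q%:Z * (w - q%:Z)) (\sum_(q <- m) q%:Z * (w - q%:Z)).
Proof.
move=> Ez mw zw; split.
- by apply: sumr_ge0.
- rewrite mulrC mulr_suml big_seq [leRHS]big_seq; apply: ler_sum => q qE.
  by have := allP Ez q qE; nia.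
- move=> Z0; rewrite big_seq big1 // => q qE.
  by have := sum_ge_mem qE; rewrite Z0; case: q {qE} => // q; lia.
- rewrite big_seq; apply: sumr_ge0 => q qm.
  by have := allP mw q qm => ?; apply: mulr_ge0; lia.
- exact: sum_eq0_or_ge.
- have sw : all (fun q : nat => q%:Z <= w) (E ++ m ++ m).
    rewrite !all_cat mw !andbT; apply/allP => q qE.
    by apply: le_trans zw; apply: (allP Ez).
  have := gap_bound_list sw; rewrite !big_cat /=.
  by congr gap_bound; ring.
- exact: gap_bound_list.
- move=> t zt; have Et : all (fun q : nat => q%:Z <= t) E.
    by apply/allP => q qE; apply: le_trans zt; apply: (allP Ez).
  have := gap_bound_list Et; congr gap_bound.
  rewrite mulr_sumr -sumrB; apply: eq_bigr => q _; ring.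
Qed.

Lemma spectrum_head_data (d : spectrum) (r : int) :
  well_ordered d -> (top_e d <= top_m d)%N -> r = \sum_(q <- parts d) q%:Z ->
  exists Z n u m : int,
    [/\ tail_data (top_m d)%:Z (top_e d)%:Z Z n u m,
        r = Z + 2 * n, squares d = (top_m d)%:Z * r - (u + 2 * m),
        (top_e d)%:Z <= Z & (top_m d)%:Z <= n].
Proof.
case/andP=> /and3P[se sf sm] fe em rE.
exists (\sum_(q <- e_seq d ++ f_seq d) q%:Z), (\sum_(q <- m_seq d) q%:Z),
  (\sum_(q <- e_seq d ++ f_seq d) q%:Z * ((top_m d)%:Z - q%:Z)),
  (\sum_(q <- m_seq d) q%:Z * ((top_m d)%:Z - q%:Z)); split.
- apply: tail_dataP => //.
    apply/allP => q; rewrite mem_cat lez_nat => /orP[|/(sorted_le_head sf) h].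
      exact: sorted_le_head.
    exact: leq_trans h fe.
  by apply/allP => q; apply: sorted_le_head.
- by rewrite rE /parts !big_cat /=; ring.
- rewrite (total_squares (top_m d)%:Z rE) /cost /parts !big_cat /=; ring.
- by rewrite big_cat /= (le_trans (sum_ge_head _)) // lerDl sumr_ge0.
- exact: sum_ge_head.
Qed.

Lemma spectrum_tail_data (d : spectrum) (r : int) :
  well_ordered d -> (0 < top_e d)%N -> r = \sum_(q <- parts d) q%:Z ->
  let w := maxn (top_m d) (second_ef d) in
  exists Z n u m : int,
    [/\ tail_data w%:Z (second_ef d)%:Z Z n u m,
        r = (top_e d)%:Z + Z + 2 * n,
        squares d = (top_e d)%:Z * (top_e d)%:Z +
          w%:Z * (r - (top_e d)%:Z) - (u + 2 * m),
        (second_ef d)%:Z <= Z & (top_m d)%:Z <= n].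
Proof.
case/andP=> /and3P[se sf sm] fe e0 rE w.
pose E := behead (e_seq d) ++ f_seq d.
have eE : e_seq d = top_e d :: behead (e_seq d).
  by rewrite /top_e in e0 *; case: (e_seq d) e0.
have sb : sorted geq (behead (e_seq d)).
  by move: se; rewrite eE; apply: path_sorted.
have rE' : r = (top_e d)%:Z + \sum_(q <- E) q%:Z + 2 * \sum_(q <- m_seq d) q%:Z.
  by rewrite rE /parts /E {1}eE cat_cons big_cons !big_cat /=; ring.
exists (\sum_(q <- E) q%:Z), (\sum_(q <- m_seq d) q%:Z),
  (\sum_(q <- E) q%:Z * (w%:Z - q%:Z)),
  (\sum_(q <- m_seq d) q%:Z * (w%:Z - q%:Z)); split => //.
- apply: tail_dataP => //.
  + apply/allP => q; rewrite mem_cat lez_nat /second_ef leq_max.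
    by case/orP=> /sorted_le_head ->; rewrite ?orbT.
  + apply/allP => q /(sorted_le_head sm) h; rewrite lez_nat /w leq_max.
    by rewrite -/(top_m d) in h; rewrite h.
  + by rewrite lez_nat /w leq_maxr.
- rewrite (total_squares w%:Z rE) /cost /parts {1}eE cat_cons big_cons /E.
  rewrite !big_cat /=; ring.
- rewrite /E big_cat /= /second_ef; case: leqP => _.
    by rewrite (le_trans (sum_ge_head _)) // lerDr sumr_ge0.
  by rewrite (le_trans (sum_ge_head _)) // lerDl sumr_ge0.
- exact: sum_ge_head.
Qed.

Lemma tail_data_ge0 (w z Z n u m : int) :
  tail_data w z Z n u m -> z <= w -> 0 <= u + 2 * m.
Proof.
move=> T zw; have : 0 <= (w - z) * Z by rewrite mulr_ge0 ?subr_ge0 ?(tail_Z T).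
by have := tail_u T; have := tail_m T; lia.
Qed.

Lemma typeB (eps r D x1 x2 x3 y1 y2 y3 z2 z3 w2 w3 Y1 n1 u1 m1
    Z2 n2 u2 m2 Z3 n3 u3 m3 O1 O2 O3 : int) :
  eps = 1 \/ eps = -1 -> 73 <= r ->
  tail_data x1 y1 Y1 n1 u1 m1 -> tail_data w2 z2 Z2 n2 u2 m2 ->
  tail_data w3 z3 Z3 n3 u3 m3 ->
  r = Y1 + 2 * n1 -> r = y2 + Z2 + 2 * n2 -> r = y3 + Z3 + 2 * n3 ->
  0 <= y1 -> y1 <= Y1 -> x1 <= n1 -> z2 <= Z2 -> z3 <= Z3 ->
  x2 <= n2 -> x3 <= n3 -> 0 <= z2 <= y2 -> 0 <= z3 <= y3 -> 0 <= x2 < y2 ->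
  0 <= x3 < y3 -> y1 <= x1 ->
  w2 = x2 /\ z2 < x2 \/ w2 = z2 /\ x2 <= z2 ->
  w3 = x3 /\ z3 < x3 \/ w3 = z3 /\ x3 <= z3 ->
  0 <= O1 <= 2 * y1 -> y2 - z2 <= O2 <= y2 + z2 -> y3 - z3 <= O3 <= y3 + z3 ->
  y1 + y2 + y3 <= r -> x1 + x3 + y2 <= r -> x1 + x2 + y3 <= r ->
  2 * (x1 + y2) + y3 + z3 <= 2 * r -> 2 * (x1 + y3) + y2 + z2 <= 2 * r ->
  r < x1 + y2 + y3 ->
  D = r * r - eps * r - (x1 * r - (u1 + 2 * m1) - eps * O1)
    - (y2 * y2 + w2 * (r - y2) - (u2 + 2 * m2) - eps * O2)
    - (y3 * y3 + w3 * (r - y3) - (u3 + 2 * m3) - eps * O3) ->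
  4 <= D -> 9 * D < 2 * r - 108 -> False.
Proof.
move=> eps1 r73 T1 T2 T3 r1 r2 r3 y10 yY1 xn1 zZ2 zZ3 xn2 xn3 zy2 zy3 xy2 xy3.
move=> yx1 w2E w3E O1b O2b O3b ysum xxy2 xxy3 xyz3 xyz2 kpos DE D4 Dlt.
(* [kappa] is the overlap; [g], [h2], [h3] are the slacks when x1 is dropped, or y2 or y3 is
   replaced by the next part w2 or w3. They put D in a form without r^2. *)
pose kappa := x1 + y2 + y3 - r; pose g := r - y2 - y3.
pose h2 := r - x1 - y3 - w2; pose h3 := r - x1 - y2 - w3.
pose A2 := r - y2; pose A3 := r - y3.
pose c1 := u1 + 2 * m1; pose c2 := u2 + 2 * m2; pose c3 := u3 + 2 * m3.
have DE' : D = kappa * g + h2 * A2 + h3 * A3 + c1 + c2 + c3 +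
    eps * (O1 + (O2 - y2) + (O3 - y3) - g).
  by rewrite DE /kappa /g /h2 /h3 /A2 /A3 /c1 /c2 /c3; ring.
(* The signed bracket is at most g + z2 + z3 in absolute value: O1 <= 2 y1 <= 2 g, and O2, O3 differ
   from y2, y3 by at most z2, z3. *)
have Dge : kappa * g + h2 * A2 + h3 * A3 + c1 + c2 + c3 - g - z2 - z3 <= D.
  by rewrite DE'; case: eps1 => ->; rewrite ?mul1r ?mulN1r /g; lia.
have k1 : 1 <= kappa by rewrite /kappa; lia.
have g0 : 0 <= g by rewrite /g; lia.
have xE : x1 = kappa + g by rewrite /kappa /g; lia.
have rE : r = y2 + y3 + g by rewrite /g; lia.
have y2E : y2 = w2 + kappa + h2 by rewrite /kappa /h2; lia.
have y3E : y3 = w3 + kappa + h3 by rewrite /kappa /h3; lia.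
have h20 : 0 <= h2 by rewrite /h2; case: w2E => [] [-> ?]; lia.
have h30 : 0 <= h3 by rewrite /h3; case: w3E => [] [-> ?]; lia.
(* The last MC inequality, as w2 + h2 - kappa = 2 r - 2 x1 - 2 y3 - y2; for w2 = z2 it says kappa <=
   h2. *)
have zh2 : z2 <= w2 + h2 - kappa by rewrite /h2 /kappa; lia.
have zh3 : z3 <= w3 + h3 - kappa by rewrite /h3 /kappa; lia.
have y1g : y1 <= g by rewrite /g; lia.
have A2E : A2 = Z2 + 2 * n2 by rewrite /A2; lia.
have A3E : A3 = Z3 + 2 * n3 by rewrite /A3; lia.
have A2r : A2 = r - y2 by []; have A3r : A3 = r - y3 by [].
have c1E : c1 = u1 + 2 * m1 by []; have c2E : c2 = u2 + 2 * m2 by [].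
have c3E : c3 = u3 + 2 * m3 by [].
clear DE; clearbody kappa g h2 h3 A2 A3 c1 c2 c3.
have zw2 : z2 <= w2 by case: w2E => [] [-> ?]; lia.
have zw3 : z3 <= w3 by case: w3E => [] [-> ?]; lia.
have c10 : 0 <= c1 by rewrite c1E; apply: tail_data_ge0 T1 yx1.
have c20 : 0 <= c2 by rewrite c2E; apply: tail_data_ge0 T2 zw2.
have c30 : 0 <= c3 by rewrite c3E; apply: tail_data_ge0 T3 zw3.
have Y10 := tail_Z T1; have Z20 := tail_Z T2; have Z30 := tail_Z T3.
have m10 := tail_m T1; have m20 := tail_m T2; have m30 := tail_m T3.
have U1 := tail_u T1; have U2 := tail_u T2; have U3 := tail_u T3.
have G1 := tail_gap T1; have G2 := tail_gap T2; have G3 := tail_gap T3.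
rewrite -r1 -c1E in G1; rewrite -A2E -c2E in G2; rewrite -A3E -c3E in G3.
have zu2 : z2 * (w2 - z2) <= c2.
  have : 0 <= (w2 - z2) * (Z2 - z2) by clear -zw2 zZ2; apply: mulr_ge0; lia.
  by clear -U2 c2E m20; lia.
have zu3 : z3 * (w3 - z3) <= c3.
  have : 0 <= (w3 - z3) * (Z3 - z3) by clear -zw3 zZ3; apply: mulr_ge0; lia.
  by clear -U3 c3E m30; lia.
have w2z : w2 = z2 \/ z2 < w2 /\ 2 * w2 + z2 <= A2.
  by clear -w2E xn2 zZ2 A2E; case: w2E => [] [E ?]; [right; rewrite E|left]; lia.
have w3z : w3 = z3 \/ z3 < w3 /\ 2 * w3 + z3 <= A3.
  by clear -w3E xn3 zZ3 A3E; case: w3E => [] [E ?]; [right; rewrite E|left]; lia.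
case: w3E => [[w3E zx3]|[w3E _]]; last first.
  subst w3.
  by apply: (@typeB_z D r kappa g x1 y2 y3 h2 h3 w2 z2 z3 A2 A3 c1 c2 c3) => //;
    clear G1 G2 G3 T1 T2 T3 U1 U2 U3 DE' w2z w3z zu2 zu3 w2E; lia.
case: w2E => [[w2E zx2]|[w2E _]]; last first.
  subst w2.
  by apply: (@typeB_z D r kappa g x1 y3 y2 h3 h2 w3 z3 z2 A3 A2 c1 c3 c2) => //;
    clear G1 G2 G3 T1 T2 T3 U1 U2 U3 DE' w2z w3z zu2 zu3; lia.
subst w2 w3; clear w2z w3z zu2 zu3.
case: T1 => _ _ U10 _ M1 _ Gm1 Gu1.
case: T2 => _ _ U20 _ M2 _ Gm2 Gu2.
case: T3 => _ _ U30 _ M3 _ Gm3 Gu3.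
have [k2|kE] := lerP 2 kappa; last first.
  have {}kE : kappa = 1 by lia.
  subst kappa.
  have Yu1 : Y1 <= u1.
    have : 0 <= (x1 - y1 - 1) * Y1 by clear -xE y1g Y10; apply: mulr_ge0; lia.
    by clear -U1; lia.
  have Zu2 : Z2 <= u2.
    have : 0 <= (x2 - z2 - 1) * Z2 by clear -zx2 Z20; apply: mulr_ge0; lia.
    by clear -U2; lia.
  have Zu3 : Z3 <= u3.
    have : 0 <= (x3 - z3 - 1) * Z3 by clear -zx3 Z30; apply: mulr_ge0; lia.
    by clear -U3; lia.
  have {}Gu1 : gap_bound u1 x1 Y1.
    by have := Gu1 x1 yx1; rewrite subrr mul0r subr0.
  have one (x : int) : x - (x - 1) = 1 by ring.
  have {}Gu2 : gap_bound (u2 - Z2) (x2 - 1) Z2.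
    by have := Gu2 (x2 - 1); rewrite one mul1r; apply; lia.
  have {}Gu3 : gap_bound (u3 - Z3) (x3 - 1) Z3.
    by have := Gu3 (x3 - 1); rewrite one mul1r; apply; lia.
  apply: (@typeB_paired_near D r x1 Y1 n1 u1 m1 c1 y2 y3 h2 h3 x2 x3 z2 z3 Z2 Z3
    n2 n3 u2 u3 m2 m3 c2 c3 A2 A3) => //;
    clear -Dge xE rE y2E y3E xn2 xn3 zy2 zy3 k1 g0; lia.
have xY1 : 0 <= (x1 - y1 - kappa) * Y1.
  by clear -xE y1g Y10; apply: mulr_ge0; lia.
have hZ2 : 0 <= (x2 + h2 - kappa - z2) * Z2.
  by clear -zh2 Z20; apply: mulr_ge0; lia.
have hZ3 : 0 <= (x3 + h3 - kappa - z3) * Z3.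
  by clear -zh3 Z30; apply: mulr_ge0; lia.
(* By [hZ2] and [tail_u], u2 + h2 Z2 >= kappa Z2, and the loss z2 <= Z2 takes away one of the kappa;
   likewise at the third point. *)
have key : (kappa - 1) * (g + Z2 + Z3) + kappa * Y1 + 2 * m1 + 2 * m2 + 2 * m3 +
    h2 * (2 * n2) + h3 * (2 * n3) <= D.
  move: Dge; rewrite A2E A3E c1E c2E c3E.
  clear -xY1 hZ2 hZ3 U1 U2 U3 zZ2 zZ3; lia.
have x2_1 : 1 <= x2 by clear -zx2 zy2; lia.
have x3_1 : 1 <= x3 by clear -zx3 zy3; lia.
have [[gE h2E h3E] [[Y1E Z2E Z3E] [m1E m2E m3E]]] :=
  @typeB_paired_far D r kappa g x1 Y1 n1 m1 y2 y3 h2 h3 x2 x3 Z2 Z3 n2 n3 m2 m3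
  r73 k2 g0 xE rE y2E y3E h20 h30 Y10 r1 xn1 Z20 Z30 r2 r3 x2_1 x3_1 xn2 xn3
  m10 m20 m30 Gm1 M1 M2 M3 key Dlt.
have O1E : O1 = 0 by clear -O1b y10 yY1 Y1E; lia.
have O2E : O2 = y2 by clear -O2b zZ2 zy2 Z2E; lia.
have O3E : O3 = y3 by clear -O3b zZ3 zy3 Z3E; lia.
(* All slacks and costs vanish, so D = 0, against D >= 4. *)
move: D4; rewrite DE' O1E O2E O3E gE h2E h3E c1E c2E c3E m1E m2E m3E.
by rewrite U10 ?U20 ?U30 // !(mul0r, mulr0, addr0, subrr, subr0).
Qed.

Lemma numeric_typeB (eps r D : int) (d1 d2 d3 : spectrum) :
  eps = 1 \/ eps = -1 -> 73 <= r ->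
  well_ordered d1 -> well_ordered d2 -> well_ordered d3 ->
  r = \sum_(q <- parts d1) q%:Z -> r = \sum_(q <- parts d2) q%:Z ->
  r = \sum_(q <- parts d3) q%:Z -> MC_minimal r d1 d2 d3 ->
  (top_e d1 <= top_m d1)%N -> (top_m d2 < top_e d2)%N ->
  (top_m d3 < top_e d3)%N ->
  r < (top_m d1)%:Z + (top_e d2)%:Z + (top_e d3)%:Z ->
  D = r * r - eps * r - excess eps d1 - excess eps d2 - excess eps d3 ->
  4 <= D -> 9 * D < 2 * r - 108 -> False.
Proof.
move=> eps1 r73 wo1 wo2 wo3 r1 r2 r3 MC ey1 ey2 ey3 kappa_gt0 DE D4 Dlt.
have e2_gt0 : (0 < top_e d2)%N by apply: leq_trans ey2.
have e3_gt0 : (0 < top_e d3)%N by apply: leq_trans ey3.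
have [Y1 [n1 [u1 [m1 [T1 r1E sq1 eY1 xn1]]]]] := spectrum_head_data wo1 ey1 r1.
have [Z2 [n2 [u2 [m2 [T2 r2E sq2 zZ2 xn2]]]]] := spectrum_tail_data wo2 e2_gt0 r2.
have [Z3 [n3 [u3 [m3 [T3 r3E sq3 zZ3 xn3]]]]] := spectrum_tail_data wo3 e3_gt0 r3.
have [o1 o1' _ _] := odd_bounds wo1.
have [_ _ o2 o2'] := odd_bounds wo2; have [_ _ o3 o3'] := odd_bounds wo3.
have ze2 := second_ef_le wo2; have ze3 := second_ef_le wo3.
move: MC; rewrite /MC_minimal /MC_ordered => MC.
apply: (@typeB eps r D (top_m d1)%:Z (top_m d2)%:Z (top_m d3)%:Z (top_e d1)%:Z
  (top_e d2)%:Z (top_e d3)%:Z (second_ef d2)%:Z (second_ef d3)%:Z _ _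
  Y1 n1 u1 m1 Z2 n2 u2 m2 Z3 n3 u3 m3 (signed_sum Posz d1) (signed_sum Posz d2)
  (signed_sum Posz d3) eps1 r73 T1 T2 T3 r1E r2E r3E);
  try lia.
by rewrite DE /excess sq1 sq2 sq3.
Qed.

Theorem numeric_bound (eps r D : int) (d1 d2 d3 : spectrum) :
  eps = 1 \/ eps = -1 ->
  well_ordered d1 -> well_ordered d2 -> well_ordered d3 ->
  r = \sum_(q <- parts d1) q%:Z -> r = \sum_(q <- parts d2) q%:Z ->
  r = \sum_(q <- parts d3) q%:Z -> MC_minimal r d1 d2 d3 ->
  D = r * r - eps * r - excess eps d1 - excess eps d2 - excess eps d3 ->
  4 <= D -> 2 * r <= 9 * D + 108.
Proof.
move=> eps1 wo1 wo2 wo3 r1 r2 r3 MC DE D4; rewrite leNgt; apply/negP => lt.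
have Dlt : 9 * D < 2 * r - 108 by lia.
have r73 : 73 <= r by lia.
have MC' := MC; move: MC'; rewrite /MC_minimal /MC_ordered => MC'.
pose p d := maxn (top_m d) (top_e d).
have [p_le|p_gt] := lerP ((p d1)%:Z + (p d2)%:Z + (p d3)%:Z) r.
  have A := @numeric_typeA eps r D _ _ _ eps1 r73; rewrite /p in p_le.
  case: (leqP (p d1) (p d2)); case: (leqP (p d2) (p d3));
    case: (leqP (p d1) (p d3)); rewrite /p => p13 p23 p12; try lia.
  - by apply: (A d3 d2 d1) => //; rewrite ?DE; lia.
  - by apply: (A d2 d3 d1) => //; rewrite ?DE; lia.
  - by apply: (A d2 d1 d3) => //; rewrite ?DE; lia.
  - by apply: (A d3 d1 d2) => //; rewrite ?DE; lia.
  - by apply: (A d1 d3 d2) => //; rewrite ?DE; lia.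
  - by apply: (A d1 d2 d3) => //; rewrite ?DE; lia.
have B := @numeric_typeB eps r D _ _ _ eps1 r73.
rewrite /p in p_gt.
have [em1|em1] := leqP (top_e d1) (top_m d1);
  have [em2|em2] := leqP (top_e d2) (top_m d2);
  have [em3|em3] := leqP (top_e d3) (top_m d3); try lia.
- by apply: (B d1 d2 d3) => //; lia.
- by apply: (B d2 d1 d3) => //; rewrite /MC_minimal /MC_ordered ?DE; lia.
- by apply: (B d3 d1 d2) => //; rewrite /MC_minimal /MC_ordered ?DE; lia.
Qed.

(** * Forms invariant under a pair of Jordan blocks *)

Section Blocks.
Variable F : fieldType.
Hypothesis two_neq0 : 2%:R != 0 :> F.

(* Out-of-range entries are 0, so that shifted indices need no bounds. *)
Definition entry (m n : nat) (A : 'M[F]_(m, n)) (i j : nat) : F :=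
  match insub i, insub j with Some i', Some j' => A i' j' | _, _ => 0 end.

Lemma entry_ord m n (A : 'M[F]_(m, n)) (i : 'I_m) (j : 'I_n) : entry A i j = A i j.
Proof. by rewrite /entry !valK. Qed.

Lemma entry_row_out m n (A : 'M[F]_(m, n)) i j : (m <= i)%N -> entry A i j = 0.
Proof. by move=> mi; rewrite /entry insubF // ltnNge mi. Qed.

Lemma entry_col_out m n (A : 'M[F]_(m, n)) i j : (n <= j)%N -> entry A i j = 0.
Proof.
by move=> nj; rewrite /entry; case: insub => // i'; rewrite insubF // ltnNge nj.
Qed.

Lemma entryE m n (A : 'M[F]_(m, n)) i j (im : (i < m)%N) (jn : (j < n)%N) :
  entry A i j = A (Ordinal im) (Ordinal jn).
Proof. by rewrite -entry_ord. Qed.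

Lemma entryP m n (A B : 'M[F]_(m, n)) :
  (forall i j, (i < m)%N -> (j < n)%N -> entry A i j = entry B i j) -> A = B.
Proof. by move=> AB; apply/matrixP => i j; rewrite -!entry_ord AB. Qed.

Lemma entryD m n (A B : 'M[F]_(m, n)) i j :
  entry (A + B) i j = entry A i j + entry B i j.
Proof.
rewrite /entry; case: insub => [i'|]; last by rewrite addr0.
by case: insub => [j'|]; rewrite ?addr0 // mxE.
Qed.

Lemma entryZ m n a (A : 'M[F]_(m, n)) i j : entry (a *: A) i j = a * entry A i j.
Proof.
rewrite /entry; case: insub => [i'|]; last by rewrite mulr0.
by case: insub => [j'|]; rewrite ?mulr0 // mxE.
Qed.

Lemma entry_tr m n (A : 'M[F]_(m, n)) i j : entry A^T i j = entry A j i.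
Proof.
by rewrite /entry; case: (insub j) => [j'|]; case: (insub i) => [i'|] //; rewrite mxE.
Qed.

Lemma entry0 m n i j : entry (0 : 'M[F]_(m, n)) i j = 0.
Proof. by rewrite -(scale0r 0) entryZ mul0r. Qed.

Definition shift_mx n : 'M[F]_n := \matrix_(i, j) (i.+1 == j :> nat)%:R.
Definition upper_mx n : 'M[F]_n := \matrix_(i, j) (i < j)%N%:R.
(* z (1 + N) / (1 - N) for N the shift: unlike the Jordan block z + N, it leaves
   a form W invariant exactly when N W + W N^T = 0, if the eigenvalues are
   inverse to each other. *)
Definition cayley_block (z : F) n : 'M[F]_n := z *: (1%:M + 2%:R *: upper_mx n).

Lemma entry_shift_mul m n (A : 'M[F]_(m, n)) i j :
  entry (shift_mx m *m A) i j = entry A i.+1 j.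
Proof.
have [mi|im] := leqP m i; first by rewrite !entry_row_out // ltnW.
have [nj|jn] := leqP n j; first by rewrite !entry_col_out.
rewrite (entryE _ im jn) mxE; have [mi|im'] := leqP m i.+1.
  rewrite entry_row_out // big1 // => k _.
  rewrite mxE /= gtn_eqF ?mul0r //.
  exact: leq_trans (ltn_ord k) mi.
rewrite (bigD1 (Ordinal im')) //= mxE /= eqxx mul1r big1 ?addr0 -?(entryE _ im' jn) //.
by move=> k /negPf; rewrite mxE /= -val_eqE /= eq_sym => ->; rewrite mul0r.
Qed.

Lemma entry_mul_shift m n (A : 'M[F]_(m, n)) i j :
  entry (A *m (shift_mx n)^T) i j = entry A i j.+1.
Proof. by rewrite -entry_tr trmx_mul trmxK entry_shift_mul entry_tr. Qed.

Lemma jordan_blockE z n : jordan_block z n = z%:M + shift_mx n.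
Proof. by apply/matrixP => i j; rewrite !mxE. Qed.

Lemma shift_upper n : (1%:M - shift_mx n) *m upper_mx n = shift_mx n.
Proof.
rewrite mulmxBl mul1mx -scaleN1r; apply: entryP => i j im jn.
rewrite entryD entryZ entry_shift_mul !(entryE _ im jn) !mxE /=.
have [ni|i1] := leqP n i.+1.
  rewrite entry_row_out // mulr0 addr0; have -> : (i < j)%N = false.
    by apply/negbTE; rewrite -leqNgt -ltnS (leq_trans jn).
  by rewrite gtn_eqF // (leq_trans jn).
rewrite (entryE _ i1 jn) mxE /= mulN1r leq_eqVlt.
by have [->|_] := eqVneq i.+1 j; rewrite ?ltnn ?subr0 ?orbF //= subrr.
Qed.

Lemma shift_cayley n :
  (1%:M - shift_mx n) *m (1%:M + 2%:R *: upper_mx n) = 1%:M + shift_mx n.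
Proof.
rewrite mulmxDr mulmx1 -scalemxAr shift_upper scaler_nat mulr2n.
by rewrite addrA subrK.
Qed.

Lemma unitmx_subr_shift n : 1%:M - shift_mx n \in unitmx.
Proof.
have /mulmx1_unit[] // : (1%:M - shift_mx n) *m (1%:M + upper_mx n) = 1%:M.
by rewrite mulmxDr mulmx1 shift_upper subrK.
Qed.

(** Multiplication by 1 - N on the left and by its transpose on the right clears the denominators of
    the Cayley blocks. *)
Lemma cayley_formE z w m n (W : 'M[F]_(m, n)) :
  cayley_block z m *m W *m (cayley_block w n)^T = W <->
  (z * w) *: ((1%:M + shift_mx m) *m W *m (1%:M + shift_mx n)^T) =
  (1%:M - shift_mx m) *m W *m (1%:M - shift_mx n)^T.
Proof.
have um := unitmx_subr_shift m; have un := unitmx_subr_shift n.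
have tn : (1%:M - shift_mx n)^T \in unitmx by rewrite unitmx_tr.
have E : (1%:M - shift_mx m) *m (cayley_block z m *m W *m (cayley_block w n)^T) *m
    (1%:M - shift_mx n)^T =
    (z * w) *: ((1%:M + shift_mx m) *m W *m (1%:M + shift_mx n)^T).
  rewrite /cayley_block linearZ /= !(=^~ scalemxAl, =^~ scalemxAr) scalerA.
  by rewrite mulrC; congr (_ *: _); rewrite -!shift_cayley trmx_mul !mulmxA.
split=> [eW|]; first by rewrite -E eW.
rewrite -E => /(congr1 (fun X => invmx (1%:M - shift_mx m) *m X *m
  invmx (1%:M - shift_mx n)^T)).
by rewrite !mulmxA !mulVmx // !mul1mx -!mulmxA !mulmxV // !mulmx1 !mulmxA.
Qed.

Lemma cayley_form_entry z w m n (W : 'M[F]_(m, n)) :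
  cayley_block z m *m W *m (cayley_block w n)^T = W <->
  forall i j, (i < m)%N -> (j < n)%N ->
  (z * w) * (entry W i j + entry W i.+1 j + (entry W i j.+1 + entry W i.+1 j.+1)) =
  entry W i j - entry W i.+1 j - (entry W i j.+1 - entry W i.+1 j.+1).
Proof.
have expand a i j : entry ((1%:M + a *: shift_mx m) *m W *m
      (1%:M + a *: shift_mx n)^T) i j =
    entry W i j + a * entry W i.+1 j +
    a * (entry W i j.+1 + a * entry W i.+1 j.+1).
  rewrite linearD linearZ /= trmx1 mulmxDr mulmx1 -scalemxAr entryD entryZ.
  rewrite entry_mul_shift mulmxDl mul1mx -scalemxAl !entryD !entryZ.
  by rewrite !entry_shift_mul.
rewrite cayley_formE; split=> [E i j im jn|E].
  have := congr1 (fun X => entry X i j) E; rewrite entryZ.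
  by have := expand 1 i j; have := expand (-1) i j;
    rewrite !scale1r !scaleN1r !mul1r !mulN1r => -> ->.
apply: entryP => i j im jn; rewrite entryZ.
by have := expand 1 i j; have := expand (-1) i j;
  rewrite !scale1r !scaleN1r !mul1r !mulN1r => -> ->; apply: E.
Qed.

(** Descending induction on i + j: once the later entries vanish, the equation at (i, j) reads (z w
    - 1) W(i, j) = 0. *)
Lemma cayley_form_eq0 z w m n (W : 'M[F]_(m, n)) : z * w != 1 ->
  cayley_block z m *m W *m (cayley_block w n)^T = W -> W = 0.
Proof.
move=> zw /cayley_form_entry E.
have H k : forall i j, (m + n <= i + j + k)%N -> entry W i j = 0.
  elim: k => [|k IH] i j ijk.
    rewrite addn0 in ijk; have [mi|im] := leqP m i; first exact: entry_row_out.
    by apply: entry_col_out; rewrite -(leq_add2l m) (leq_trans ijk) // leq_add2r ltnW.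
  have [mi|im] := leqP m i; first exact: entry_row_out.
  have [nj|jn] := leqP n j; first exact: entry_col_out.
  have := E i j im jn; rewrite (IH i.+1 j) ?(IH i j.+1) ?(IH i.+1 j.+1);
    try by rewrite ?(addSn, addnS) in ijk *; rewrite // ltnW.
  rewrite !addr0 !subr0 => /eqP; rewrite -subr_eq0 -{2}[entry W i j]mul1r -mulrBl.
  by rewrite mulf_eq0 subr_eq0 (negPf zw) => /eqP.
by apply: entryP => i j _ _; rewrite entry0 (H (m + n)%N) // leq_addl.
Qed.

(** The equation becomes 2 (N W + W N^T) = 0: signs alternate along antidiagonals. The indices are
    unrestricted, so the condition also kills the antidiagonals that reach row m. *)
Lemma cayley_form_alternate z w m n (W : 'M[F]_(m, n)) : z * w = 1 ->
  cayley_block z m *m W *m (cayley_block w n)^T = W <->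
  forall i j, entry W i j = (-1) ^+ i * entry W 0 (i + j).
Proof.
move=> zw; rewrite cayley_form_entry zw; split=> [E|E i j im jn].
  elim=> [|i IH] j; first by rewrite mul1r.
  have [mi|im] := leqP m i.
    by rewrite entry_row_out 1?ltnW // exprS -mulrA addSnnS -IH entry_row_out ?mulr0.
  have -> : entry W i.+1 j = - entry W i j.+1.
    have [nj|jn] := leqP n j.
      by rewrite !entry_col_out ?oppr0 // ltnW.
    have := E i j im jn; rewrite mul1r => /eqP; rewrite -subr_eq0.
    set a := entry W i j; set b := entry W i.+1 j; set c := entry W i j.+1.
    set d := entry W i.+1 j.+1.
    have -> : a + b + (c + d) - (a - b - (c - d)) = 2%:R * (b + c) by ring.
    by rewrite mulf_eq0 (negPf two_neq0) /= addr_eq0 => /eqP.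
  by rewrite IH exprS addSnnS mulN1r mulNr.
rewrite mul1r !(E i.+1) (E i j) (E i j.+1) !exprS !addnS !addSn; ring.
Qed.

End Blocks.

(** * Similarity of Cayley blocks and Jordan blocks *)

Section Similarity.
Variable F : fieldType.
Hypothesis two_neq0 : 2%:R != 0 :> F.

(* The rows e_0 K^i with K = cayley_block z n - z conjugate K to the shift. *)
Definition krylov_row (z : F) n (i : nat) : 'rV[F]_n :=
  iter i (fun v => v *m ((2%:R * z) *: upper_mx F n)) (\row_j (j == 0 :> nat)%:R).

Definition krylov_mx (z : F) n : 'M[F]_n := \matrix_i krylov_row z n i.

Lemma krylov_rowE z n i (j : 'I_n) : (j <= i)%N ->
  krylov_row z n i 0 j = ((2%:R * z) ^+ i) *+ (i == j).
Proof.
elim: i j => [|i IH] j ji; first by rewrite mxE; case: (j : nat) ji.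
rewrite /krylov_row iterS -/(krylov_row z n i) mxE.
have [ij|ij] := eqVneq i.+1 (j : nat).
  have i1 : (i < n)%N by rewrite (leq_trans _ (ltn_ord j)) // ltnW // ij.
  rewrite (bigD1 (Ordinal i1)) //= IH //= eqxx !mxE /= -ij leqnn mulr1.
  rewrite exprSr mulr1n big1 ?addr0 // => l /negPf li; rewrite !mxE -ij ltnS.
  have [le|lt] := leqP l i; last by rewrite !mulr0.
  by rewrite IH // eq_sym -[l == i :> nat]/(l == Ordinal i1) li mulr0n mul0r.
rewrite mulr0n big1 // => l _; rewrite !mxE.
have [lj|jl] := ltnP l j; last by rewrite !mulr0.
have li : (l < i)%N by rewrite (leq_trans lj) // -ltnS ltn_neqAle eq_sym ij.
by rewrite IH ?(ltnW li) // gtn_eqF // mulr0n mul0r.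
Qed.

Lemma krylov_row_out z n : krylov_row z n n = 0.
Proof.
apply/rowP => j; rewrite krylov_rowE ?(ltnW (ltn_ord j)) // mxE.
by rewrite gtn_eqF ?ltn_ord.
Qed.

(** The matrix is triangular with diagonal entries (2 z)^i. *)
Lemma krylov_unit z n : z != 0 -> krylov_mx z n \in unitmx.
Proof.
move=> z0; rewrite unitmxE unitfE -det_tr det_trig.
  rewrite prodf_seq_neq0; apply/allP => i _ /=; rewrite !mxE krylov_rowE //.
  by rewrite eqxx expf_neq0 // mulf_neq0.
apply/is_trig_mxP => i j ij; rewrite !mxE krylov_rowE ?(ltnW ij) //.
by rewrite gtn_eqF.
Qed.

Lemma krylov_conj z n :
  krylov_mx z n *m cayley_block z n = jordan_block z n *m krylov_mx z n.
Proof.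
have rowS i : krylov_row z n i *m cayley_block z n =
    z *: krylov_row z n i + krylov_row z n i.+1.
  rewrite /cayley_block -scalemxAr mulmxDr mulmx1 scalerDr /krylov_row iterS.
  by rewrite -!scalemxAr !scalerA mulrC.
apply/row_matrixP => i; rewrite row_mul rowK rowS jordan_blockE mulmxDl.
rewrite mul_scalar_mx linearD linearZ /= rowK; congr (_ + _).
apply/rowP => j; rewrite [in RHS]mxE -entry_ord entry_shift_mul.
change (krylov_row z n i.+1 0 j = entry (krylov_mx z n) i.+1 j).
have [ni|i1] := leqP n i.+1.
  have -> : i.+1 = n by apply/eqP; rewrite eqn_leq ni ltn_ord.
  by rewrite krylov_row_out entry_row_out // mxE.
have -> : entry (krylov_mx z n) i.+1 j = krylov_mx z n (Ordinal i1) j.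
  by rewrite -entry_ord.
by rewrite [RHS]mxE.
Qed.

End Similarity.

Section JordanForm.
Variables (F : fieldType) (r : nat) (g : 'M[F]_r) (s : jordan_type F).
Hypothesis two_neq0 : 2%:R != 0 :> F.
Hypothesis g_unit : g \in unitmx.
Hypothesis g_jordan : has_jordan_type g s.

Let size_gt0 (k : 'I_(size s)) : (0 < block_size s k)%N.
Proof.
rewrite /block_size (nth_map (0, 0%N)) //.
by have [/allP/(_ _ (mem_nth (0, 0%N) (ltn_ord k)))] := g_jordan.
Qed.

(** A block at 0 would kill its last basis row vector, while the Jordan matrix is invertible because
    g is. *)
Lemma block_value_neq0 (k : 'I_(size s)) : block_value s k != 0.
Proof.
apply/negP => /eqP z0; have [_ [P [Q [PQ QP gE]]]] := g_jordan.
have JU : jordan_mx s *m (Q *m invmx g *m P) = 1%:M.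
  have JE : jordan_mx s *m Q = Q *m g by rewrite gE !mulmxA QP mul1mx.
  by rewrite !mulmxA JE mulmxK.
have last_lt : ((block_size s k).-1 < block_size s k)%N by rewrite prednK.
pose v (l : 'I_(size s)) : 'rV[F]_(block_size s l) :=
  \row_j ((l == k) && (j.+1 == block_size s l))%:R.
have vJ : (\mxrow_l v l) *m jordan_mx s = 0.
  rewrite /jordan_mx mul_mxrow_mxdiag -[RHS]mxrow0; apply: eq_mxrow => l.
  apply/rowP => j; rewrite !mxE big1 // => i _; rewrite !mxE.
  case: andP => [[/eqP lk /eqP iE]|_]; last by rewrite mul0r.
  by rewrite [in block_value _ _]lk z0 mul0rn add0r gtn_eqF ?mulr0 // iE.
have v0 : \mxrow_l v l = 0.
  by rewrite -[LHS]mulmx1 -JU !mulmxA vJ !mul0mx.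
have vk : v k = 0 by rewrite -[v k](mxrowK v) v0 submxrow0.
have /rowP/(_ (Ordinal last_lt)) := vk.
by rewrite !mxE /= prednK // !eqxx => /eqP; rewrite oner_eq0.
Qed.

Lemma jordan_cayley : exists
  (P : 'M[F]_(r, \sum_(k < size s) block_size s k))
  (Q : 'M[F]_(\sum_(k < size s) block_size s k, r)),
  [/\ P *m Q = 1%:M, Q *m P = 1%:M &
      g = P *m (\mxdiag_(k < size s)
        cayley_block (block_value s k) (block_size s k)) *m Q].
Proof.
have [_ [P [Q [PQ QP gE]]]] := g_jordan.
pose S (k : 'I_(size s)) := krylov_mx (block_value s k) (block_size s k).
have SU k : S k \in unitmx by apply: krylov_unit => //; apply: block_value_neq0.
pose DS := \mxdiag_k S k; pose DV := \mxdiag_k invmx (S k).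
have mul_diag (X Y : forall k : 'I_(size s), 'M[F]_(block_size s k)) :
    (\mxdiag_k X k) *m (\mxdiag_k Y k) = \mxdiag_k (X k *m Y k).
  rewrite [X in _ *m X]/mxdiag mul_mxdiag_mxblock; apply: eq_mxblock => a b.
  by have [<-|_] := eqVneq a b; rewrite ?conform_mx_id ?mulmx0.
have DSV : DS *m DV = 1%:M.
  by rewrite mul_diag -mxdiagZ; apply: eq_mxdiag => k; rewrite mulmxV.
have DVS : DV *m DS = 1%:M.
  by rewrite mul_diag -mxdiagZ; apply: eq_mxdiag => k; rewrite mulVmx.
exists (P *m DS), (DV *m Q); split.
- by rewrite mulmxA -[P *m _ *m _]mulmxA DSV mulmx1.
- by rewrite mulmxA -[DV *m Q *m _]mulmxA QP mulmx1.
rewrite gE !mulmxA; congr (_ *m Q); rewrite -!mulmxA; congr (_ *m _).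
rewrite mulmxA mul_diag.
have -> : \mxdiag_k (S k *m cayley_block (block_value s k) (block_size s k)) =
    jordan_mx s *m DS.
  by rewrite mul_diag; apply: eq_mxdiag => k; apply: krylov_conj.
by rewrite -mulmxA DSV mulmx1.
Qed.

End JordanForm.

(** * Forms invariant under a Jordan matrix *)

Section InvariantForms.
Variables (F : fieldType) (K M : nat) (n_ : 'I_K -> nat) (z_ : 'I_K -> F).
Variable c : bool.
Hypothesis two_neq0 : 2%:R != 0 :> F.
Hypothesis n_le : forall k, (n_ k <= M)%N.

Let G : 'M[F]_(\sum_k n_ k) := \mxdiag_k cayley_block (z_ k) (n_ k).

(** First-row entries of the blocks determine an invariant form; symmetry reduces to a <= b, and for
    a = b it reads W(0, l) = (-1)^(c + l) W(0, l), leaving the l of the parity of c. The bound [M]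
    on the block sizes makes the coordinates a finite type. *)
Definition free_coord (x : 'I_K * 'I_K * 'I_M) : bool :=
  let: (a, b, l) := x in
  [&& z_ a * z_ b == 1, (l < minn (n_ a) (n_ b))%N &
      (a < b)%N || (a == b) && (odd l == c)].

Local Notation blk W a b := (@submxblock F K K n_ n_ W a b).

Definition coord_entry (W : 'M[F]_(\sum_k n_ k)) (x : 'I_K * 'I_K * 'I_M) : F :=
  let: (a, b, l) := x in entry (blk W a b) 0 l.

Definition invariant_form (W : 'M[F]_(\sum_k n_ k)) : Prop :=
  G *m W *m G^T = W /\ W^T = (-1) ^+ c *: W.

Lemma conj_blockE W a b : blk (G *m W *m G^T) a b =
  cayley_block (z_ a) (n_ a) *m blk W a b *m (cayley_block (z_ b) (n_ b))^T.
Proof.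
by rewrite -{1}(submxblockK W) mul_mxdiag_mxblock tr_mxdiag mul_mxblock_mxdiag mxblockK.
Qed.

Lemma entry_submxblock_tr W a b i j : W^T = (-1) ^+ c *: W ->
  entry (blk W b a) j i = (-1) ^+ c * entry (blk W a b) i j.
Proof.
move=> Wt; rewrite -entry_tr tr_submxblock Wt -entryZ.
by congr entry; apply/matrixP => k l; rewrite !mxE.
Qed.

Lemma invariant_form_eq0 W : invariant_form W ->
  (forall x, free_coord x -> coord_entry W x = 0) -> W = 0.
Proof.
move=> [GW Wt] W0; apply/mxblockP => a b.
have GWab a' b' : cayley_block (z_ a') (n_ a') *m blk W a' b' *m
    (cayley_block (z_ b') (n_ b'))^T = blk W a' b' by rewrite -conj_blockE GW.
rewrite submxblock0; have [zz|zz] := eqVneq (z_ a * z_ b) 1; last first.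
  exact: cayley_form_eq0 zz (GWab a b).
have alt := (cayley_form_alternate two_neq0 _ zz).1 (GWab a b).
have zz' : z_ b * z_ a = 1 by rewrite mulrC.
have alt' := (cayley_form_alternate two_neq0 _ zz').1 (GWab b a).
apply: entryP => i j _ _; rewrite entry0 alt.
set l := (i + j)%N; suff -> : entry (blk W a b) 0 l = 0 by rewrite mulr0.
have [nb|lb] := leqP (n_ b) l; first exact: entry_col_out.
have Etr : entry (blk W a b) 0 l =
    (-1) ^+ c * ((-1) ^+ l * entry (blk W b a) 0 l).
  by rewrite (entry_submxblock_tr b a l 0 Wt) alt' addn0.
have [na|la] := leqP (n_ a) l.
  by rewrite Etr entry_col_out // !mulr0.
have lM : (l < M)%N by apply: leq_trans la (n_le a).
have [ab|ba|ab] := ltngtP a b.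
- by apply: (W0 (a, b, Ordinal lM)); rewrite /= zz eqxx leq_min la lb ab.
- rewrite Etr; have -> : entry (blk W b a) 0 l = 0; last by rewrite !mulr0.
  by apply: (W0 (b, a, Ordinal lM)); rewrite /= zz' eqxx leq_min la lb ba.
have {}ab : a = b by apply: val_inj.
have [lc|lc] := eqVneq (odd l) c.
  by apply: (W0 (a, b, Ordinal lM)); rewrite /= zz eqxx leq_min la lb ab eqxx lc eqxx orbT.
move: Etr; rewrite -ab; set e := entry _ _ _.
rewrite mulrA -[(-1) ^+ l]signr_odd -signr_addb.
have -> : c (+) odd l = true by move: lc; case: (odd l); case: (c).
rewrite expr1 mulN1r => /eqP; rewrite -addr_eq0 -mulr2n -mulr_natl mulf_eq0.
by rewrite (negPf two_neq0) => /eqP.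
Qed.

Section Existence.
Variable v : 'I_K * 'I_K * 'I_M -> F.

Definition coord_value (a b : 'I_K) (l : nat) : F :=
  if insub l is Some l' then
    if free_coord (a, b, l') then v (a, b, l') else 0
  else 0.

Definition antidiagonal_value (a b : 'I_K) (l : nat) : F :=
  if (a <= b)%N then coord_value a b l
  else (-1) ^+ c * (-1) ^+ l * coord_value b a l.

Definition form_of_coord : 'M[F]_(\sum_k n_ k) :=
  \mxblock_(a, b) \matrix_(i, j) ((-1) ^+ i * antidiagonal_value a b (i + j)).

Lemma coord_value_out a b l :
  ~~ [&& z_ a * z_ b == 1, (l < minn (n_ a) (n_ b))%N &
      (a < b)%N || (a == b) && (odd l == c)] -> coord_value a b l = 0.
Proof.
by rewrite /coord_value; case: insubP => // l' _ <- /negPf /= ->.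
Qed.

Lemma antidiagonal_out a b l :
  (z_ a * z_ b != 1) || (minn (n_ a) (n_ b) <= l)%N -> antidiagonal_value a b l = 0.
Proof.
rewrite /antidiagonal_value leqNgt -negb_and => h.
case: ifP => _; rewrite coord_value_out ?mulr0 //.
  by apply: contra h => /and3P[-> ->].
by apply: contra h => /and3P[]; rewrite mulrC minnC => -> ->.
Qed.

Lemma antidiagonal_sym a b l :
  antidiagonal_value b a l = (-1) ^+ c * (-1) ^+ l * antidiagonal_value a b l.
Proof.
rewrite /antidiagonal_value; case: (ltngtP a b) => [ab|ba|/val_inj ab].
- by [].
- by rewrite mulrA mulrACA -!expr2 !sqrr_sign mul1r mul1r.
rewrite -ab; have [lc|lc] := eqVneq (odd l) c.
  by rewrite -lc signr_odd -expr2 sqrr_sign mul1r.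
by rewrite coord_value_out ?mulr0 // ltnn eqxx (negPf lc) !andbF.
Qed.

Lemma entry_form_of_coord a b i j : (i < n_ a)%N -> (j < n_ b)%N ->
  entry (blk form_of_coord a b) i j = (-1) ^+ i * antidiagonal_value a b (i + j).
Proof. by move=> ia jb; rewrite mxblockK (entryE _ ia jb) mxE. Qed.

Lemma form_of_coord_invariant : invariant_form form_of_coord.
Proof.
split.
  apply/mxblockP => a b; rewrite conj_blockE.
  have [zz|zz] := eqVneq (z_ a * z_ b) 1; last first.
    suff -> : blk form_of_coord a b = 0 by rewrite mulmx0 mul0mx.
    apply: entryP => i j ia jb; rewrite entry_form_of_coord // entry0.
    by rewrite antidiagonal_out ?zz // mulr0.
  apply/(cayley_form_alternate two_neq0 _ zz) => i j.
  have [out|] := boolP ((n_ a <= i) || (n_ b <= j))%N.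
    have -> : entry (blk form_of_coord a b) i j = 0.
      by case/orP: out => ?; [apply: entry_row_out|apply: entry_col_out].
    have [nb|lb] := leqP (n_ b) (i + j); first by rewrite entry_col_out ?mulr0.
    have a0 : (0 < n_ a)%N \/ n_ a = 0%N by case: (n_ a); [right|left].
    case: a0 => [a0|a0]; last by rewrite entry_row_out ?a0 ?mulr0.
    rewrite entry_form_of_coord // antidiagonal_out ?mulr0 //.
    apply/orP; right; rewrite geq_min.
    by case/orP: out => h; rewrite ?(leq_trans h (leq_addr _ _))
      ?(leq_trans h (leq_addl _ _)) ?orbT.
  rewrite negb_or -!ltnNge => /andP[ia jb]; rewrite entry_form_of_coord //.
  have [nb|lb] := leqP (n_ b) (i + j).
    by rewrite entry_col_out // antidiagonal_out ?mulr0 // geq_min nb !orbT.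
  by rewrite entry_form_of_coord ?mul1r // (leq_trans _ ia).
apply/mxblockP => b a; rewrite -tr_submxblock.
apply: entryP => j i jb ia; rewrite entry_tr entry_form_of_coord //.
have -> : blk ((-1) ^+ c *: form_of_coord) b a =
    (-1) ^+ c *: blk form_of_coord b a.
  by apply/matrixP => k l; rewrite !mxE.
rewrite entryZ entry_form_of_coord // antidiagonal_sym addnC !mulrA.
congr (_ * _); rewrite exprD.
rewrite [X in X * _ = _]mulrC -!mulrA; congr (_ * _).
by rewrite mulrCA -expr2 sqrr_sign mulr1.
Qed.

Lemma coord_form_of_coord x : free_coord x -> coord_entry form_of_coord x = v x.
Proof.
case: x => [[a b] l] /= fx; case/and3P: (fx) => zz; rewrite leq_min => /andP[la lb] ab.
rewrite entry_form_of_coord ?(leq_trans _ la) // mul1r add0n /antidiagonal_value.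
have -> : (a <= b)%N by case/orP: ab => [/ltnW //|/andP[/eqP->]].
by rewrite /coord_value valK /= fx.
Qed.

End Existence.
End InvariantForms.

(** * Centralizers in the Lie algebra *)

Section Coordinates.
Variables (F : fieldType) (K M r : nat) (n_ : 'I_K -> nat) (z_ : 'I_K -> F).
Variables (c : bool) (B : 'M[F]_r) (Q : 'M[F]_(\sum_k n_ k, r)).

Definition coords (X : 'M[F]_r) : 'rV[F]_#|@free_coord F K M n_ z_ c| :=
  \row_k @coord_entry F K M n_ (Q *m (X *m B) *m Q^T) (enum_val k).

Fact coords_is_linear : linear coords.
Proof.
move=> a X Y; apply/rowP => k; rewrite !mxE; case: (enum_val k) => [[i j] l] /=.
rewrite -entryZ -entryD; congr entry; rewrite mulmxDl -scalemxAl mulmxDr.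
by rewrite -scalemxAr mulmxDl -scalemxAl; apply/matrixP => x y; rewrite !mxE.
Qed.

HB.instance Definition _ :=
  GRing.isLinear.Build F 'M[F]_r 'rV[F]_#|@free_coord F K M n_ z_ c| *:%R
    coords coords_is_linear.

End Coordinates.

Section Centralizer.
Variables (F : fieldType) (r : nat) (eps : int) (B g : 'M[F]_r).
Variable s : jordan_type F.
Hypothesis two_neq0 : 2%:R != 0 :> F.
Hypothesis eps1 : eps = 1 \/ eps = -1.
Hypothesis hB : nondegenerate_form eps B.
Hypothesis hg : form_group B g.
Hypothesis g_jordan : has_jordan_type g s.

Definition lie_centralizer : {vspace 'M[F]_r} :=
  (lie_algebra B :&: lker (linfun (dconj g)))%VS.

Lemma form_group_unit : g \in unitmx.
Proof.
have [Bu _] := hB; have gB : g *m B *m g^T = B := hg.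
have /mulmx1_unit[] // : g *m (B *m g^T *m invmx B) = 1%:M.
by rewrite !mulmxA gB mulmxV.
Qed.

Lemma class_dimE : (class_dim B g + \dim lie_centralizer = group_dim B)%N.
Proof. by rewrite addnC limg_ker_dim. Qed.

(** X |-> Q X B Q^T identifies the centralizer with the invariant forms: membership in the Lie
    algebra says that W^T = - eps W, hence [c], and commutation with g says that W is invariant. *)
Lemma dim_lie_centralizer (M : nat) : (forall k, block_size s k <= M)%N ->
  \dim lie_centralizer = #|@free_coord F (size s) M (block_size s) (block_value s) (eps == 1)|.
Proof.
move=> sM; set c := eps == 1.
have [Bu Bt] := hB; have gB : g *m B *m g^T = B := hg.
have gu := form_group_unit.
have [P [Q [PQ QP gE]]] := jordan_cayley two_neq0 gu g_jordan.
set G := \mxdiag_(k < _) _ in gE.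
have GE : G = Q *m g *m P by rewrite gE !mulmxA QP mul1mx -mulmxA QP mulmx1.
have QPt : Q^T *m P^T = 1%:M by rewrite -trmx_mul PQ trmx1.
have PQt : P^T *m Q^T = 1%:M by rewrite -trmx_mul QP trmx1.
have eps_c : eps%:~R = - (-1) ^+ c :> F.
  by rewrite /c; case: eps1 => ->; rewrite /= ?expr1 ?expr0 ?opprK ?rmorphN1.
have memU X : X \in lie_centralizer =
    (X *m B + B *m X^T == 0) && (g *m X == X *m g).
  by rewrite memv_cap mem_lie_algebra memv_ker lfunE /= /dconj subr_eq0.
have inv_of X : X \in lie_centralizer ->
    @invariant_form F (size s) (block_size s) (block_value s) c
      (Q *m (X *m B) *m Q^T).
  rewrite memU => /andP[/eqP XB /eqP gX]; split.
    rewrite -/G GE !trmx_mul.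
    have -> : Q *m g *m P *m (Q *m (X *m B) *m Q^T) *m (P^T *m (g^T *m Q^T)) =
        Q *m (g *m (P *m Q) *m X *m B *m (Q^T *m P^T) *m g^T) *m Q^T.
      by rewrite !mulmxA.
    rewrite PQ QPt !mulmx1 gX -[X *m g *m B]mulmxA -[X *m _ *m _]mulmxA.
    by rewrite [g *m B *m _]gB.
  rewrite !trmx_mul trmxK Bt.
  have -> : (eps%:~R *: B) *m X^T = (-1) ^+ c *: (X *m B).
    by rewrite -scalemxAl eps_c scaleNr -scalerN -(addr0_eq XB) opprK.
  by rewrite -scalemxAl -scalemxAr mulmxA.
pose f := linfun (@coords F (size s) M r (block_size s) (block_value s) c B Q).
have <- : \dim (f @: lie_centralizer) = \dim lie_centralizer.
  apply: limg_dim_eq; apply/eqP; rewrite -subv0; apply/subvP => X.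
  rewrite memv_cap memv_ker lfunE memv0 => /andP[XU /eqP fX].
  have W0 : Q *m (X *m B) *m Q^T = 0.
    apply: (invariant_form_eq0 two_neq0 sM (inv_of X XU)) => x xf.
    have xf' : x \in @free_coord F (size s) M (block_size s) (block_value s) c by [].
    by have /rowP/(_ (enum_rank_in xf' x)) := fX; rewrite !mxE enum_rankK_in.
  have : P *m (Q *m (X *m B) *m Q^T) *m P^T *m invmx B = X.
    rewrite !mulmxA PQ mul1mx -[X *m B *m _ *m _]mulmxA QPt mulmx1.
    by rewrite -mulmxA mulmxV // mulmx1.
  by rewrite W0 mulmx0 !mul0mx => <-.
have -> : (f @: lie_centralizer)%VS = fullv.
  apply/vspaceP => v; rewrite memvf; apply/memv_imgP.
  pose fc := @free_coord F (size s) M (block_size s) (block_value s) c.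
  pose u x : F := if insub x : {? x | fc x} is Some _
    then \sum_(k < #|fc| | enum_val k == x) v 0 k else 0.
  pose W := @form_of_coord F (size s) M (block_size s) (block_value s) c u.
  have [GW Wt] : invariant_form (block_value s) c W.
    exact: form_of_coord_invariant.
  have Wu := @coord_form_of_coord F (size s) M (block_size s) (block_value s) c u.
  pose X := P *m W *m P^T *m invmx B.
  have XB : X *m B = P *m W *m P^T by rewrite /X -mulmxA mulVmx // mulmx1.
  have XBt : (X *m B)^T = (-1) ^+ c *: (X *m B).
    by rewrite XB !trmx_mul trmxK Wt -scalemxAl -scalemxAr mulmxA.
  exists X; last first.
    apply/rowP => k; rewrite lfunE mxE XB.
    have -> : Q *m (P *m W *m P^T) *m Q^T = W.
      by rewrite !mulmxA QP mul1mx -mulmxA PQt mulmx1.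
    have kfc : fc (enum_val k) by apply: (enum_valP k).
    rewrite Wu // /u insubT (big_pred1 k) // => k'.
    by rewrite (inj_eq enum_val_inj).
  clearbody X; rewrite memU; apply/andP; split.
    apply/eqP; move: XBt; rewrite trmx_mul.
    rewrite Bt -scalemxAl eps_c scaleNr -scalerN => /(canRL (signrZK _)) h.
    by rewrite -[B *m _]opprK h signrZK subrr.
  rewrite -subr_eq0; apply/eqP.
  (* Both sides equal X B: invariance of the form X B on the left, of B on the right. Cancelling B
     g^T gives commutation. *)
  have gX : g *m X *m B *m g^T = X *m g *m B *m g^T.
    rewrite -[X *m g *m B]mulmxA -[X *m _ *m _]mulmxA [g *m B *m _]gB.
    rewrite -[g *m X *m B]mulmxA XB {1 2}gE !trmx_mul -/G.
    have -> : P *m G *m Q *m (P *m W *m P^T) *m (Q^T *m (G^T *m P^T)) =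
        P *m (G *m (Q *m P) *m W *m (P^T *m Q^T) *m G^T) *m P^T.
      by rewrite !mulmxA.
    by rewrite QP PQt !mulmx1 GW.
  have gtu : g^T \in unitmx by rewrite unitmx_tr.
  have : (g *m X - X *m g) *m (B *m g^T) = 0.
    by rewrite mulmxBl !mulmxA gX subrr.
  move=> /(congr1 (fun Y => Y *m invmx (B *m g^T))).
  by rewrite mul0mx mulmxK // unitmx_mul Bu.
by rewrite dimvf dim_matrix mul1r.
Qed.
End Centralizer.

(** * Counting the free coordinates *)

Lemma sum_ord_lt (M m : nat) (P : pred nat) : (m <= M)%N ->
  (\sum_(l < M) ((l < m) && P l) = \sum_(l < m) P l)%N.
Proof.
move=> mM; rewrite (big_ord_widen M (fun l => nat_of_bool (P l)) mM) [RHS]big_mkcond /=.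
by apply: eq_bigr => l _; case: (l < m)%N.
Qed.

Lemma sum_parity (n : nat) (c : bool) :
  2 * (\sum_(l < n) (odd l == c)%N)%:Z = n%:Z + (-1) ^+ c * (odd n)%:Z.
Proof.
elim: n => [|n IH]; first by rewrite big_ord0 mulr0 add0r mulr0.
by rewrite big_ord_recr /= PoszD mulrDr IH; case: c {IH}; case: (odd n) => /=; lia.
Qed.

Section Counting.
Variables (F : fieldType) (K M : nat) (n_ : 'I_K -> nat) (z_ : 'I_K -> F).
Variable c : bool.
Hypothesis n_le : forall k, (n_ k <= M)%N.

Let cnt (a b : 'I_K) : nat :=
  \sum_(l < M) @free_coord F K M n_ z_ c (a, b, l).

(** Adding both orders of a pair removes the dependence on the enumeration of the blocks; the parity
    condition on diagonal blocks produces the correction at odd sizes. *)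
Lemma card_free_coord_pair (a b : 'I_K) :
  (cnt a b)%:Z + (cnt b a)%:Z =
  (z_ a * z_ b == 1)%:Z * (minn (n_ a) (n_ b))%:Z +
  (a == b)%:Z * ((-1) ^+ c * ((z_ a * z_ a == 1) && odd (n_ a))%:Z).
Proof.
pose zz (i j : 'I_K) := z_ i * z_ j == 1.
have cntE (i j : 'I_K) : cnt i j = (zz i j * \sum_(l < minn (n_ i) (n_ j))
    ((i < j) || (i == j) && (odd l == c)))%N.
  rewrite /cnt /free_coord -/(zz i j); case: (zz i j); last by rewrite mul0n big1.
  rewrite mul1n -(@sum_ord_lt M _ (fun l => (i < j)%N || (i == j) && (odd l == c))) //.
  by rewrite geq_min n_le.
rewrite !cntE -/(zz a b) -/(zz a a).
have -> : zz b a = zz a b by rewrite /zz mulrC.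
rewrite [minn (n_ b) _]minnC.
have neq (i j : 'I_K) : (i < j)%N -> (i == j) = false.
  by move=> ij; apply/eqP => E; rewrite E ltnn in ij.
have [ab|ba|/val_inj <-] := ltngtP a b.
- rewrite (neq _ _ ab) [b == a]eq_sym (neq _ _ ab) /=.
  by rewrite sum1_card card_ord sum_nat_const muln0 muln0 mul0r !addr0 PoszM.
- rewrite (neq _ _ ba) [a == b]eq_sym (neq _ _ ba) /=.
  by rewrite sum1_card card_ord sum_nat_const muln0 muln0 mul0r add0r addr0 PoszM.
rewrite eqxx /= minnn mul1r; have := sum_parity (n_ a) c.
by case: (zz a a); rewrite ?mul0n ?mul1n /= => E; rewrite ?mul0r ?mulr0 // mul1r -E; ring.
Qed.

Lemma card_free_coord : 2 * #|@free_coord F K M n_ z_ c|%:Z =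
  \sum_a \sum_b (z_ a * z_ b == 1)%:Z * (minn (n_ a) (n_ b))%:Z +
  (-1) ^+ c * \sum_a ((z_ a * z_ a == 1) && odd (n_ a))%:Z.
Proof.
have -> : #|@free_coord F K M n_ z_ c| = (\sum_a \sum_b cnt a b)%N.
  rewrite -sum1_card big_mkcond pair_bigA /cnt /=.
  rewrite (pair_bigA _ (fun (p : 'I_K * 'I_K) (l : 'I_M) =>
    nat_of_bool (@free_coord F K M n_ z_ c (p.1, p.2, l)))) /=.
  by apply: eq_bigr => [[[a b] l]] _ /=; rewrite -topredE /=; case: ifP.
rewrite -[2]/(1 + 1) mulrDl mul1r.
have E : (\sum_a \sum_b cnt a b)%N%:Z = \sum_a \sum_b (cnt a b)%:Z.
  by rewrite -natz natr_sum; apply: eq_bigr => a _; rewrite natr_sum;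
    apply: eq_bigr => b _; rewrite natz.
rewrite E {2}exchange_big -big_split /= mulr_sumr -big_split /=.
apply: eq_bigr => a _; rewrite -big_split /=.
under eq_bigr => b _ do rewrite card_free_coord_pair.
rewrite big_split /=; congr (_ + _).
rewrite (bigD1 a) //= eqxx mul1r big1 ?addr0 // => b ba.
by rewrite eq_sym (negPf ba) mul0r.
Qed.

End Counting.

(** * Symmetry of the Jordan type under inversion *)

(** The R by C submatrix of W has a right inverse, cut out of the inverse of W, so its rank is the
    cardinal of R. *)
Lemma unit_support_card (F : fieldType) (N : nat) (W : 'M[F]_N) (R C : pred 'I_N) :
  W \in unitmx -> (forall i j, R i -> W i j != 0 -> C j) -> (#|R| <= #|C|)%N.
Proof.
move=> Wu supp.
pose A : 'M[F]_(#|R|, #|C|) := \matrix_(i, j) W (enum_val i) (enum_val j).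
pose A' : 'M[F]_(#|C|, #|R|) := \matrix_(i, j) invmx W (enum_val i) (enum_val j).
have AA' : A *m A' = 1%:M.
  apply/matrixP => i k; rewrite !mxE.
  under eq_bigr => j _ do rewrite !mxE.
  have Ri : R (enum_val i) by apply: (enum_valP i).
  rewrite -(big_enum_val (A := C) (fun j => W (enum_val i) j * invmx W j (enum_val k))).
  have := mulmxV Wu => /matrixP/(_ (enum_val i) (enum_val k)).
  rewrite !mxE (inj_eq enum_val_inj) => <-.
  rewrite [RHS](bigID C) /= [X in _ = _ + X]big1 ?addr0 // => j Cj.
  by have [->|/(supp _ _ Ri)] := eqVneq (W (enum_val i) j) 0;
    rewrite ?mul0r // (negPf Cj).
by rewrite -(mxrank1 F #|R|) -AA' (leq_trans (mxrankM_maxl _ _)) // rank_leq_col.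
Qed.

Lemma card_ord_lt (n J : nat) : #|[pred i : 'I_n | i < J]%N| = minn n J.
Proof.
rewrite -sum1_card big_mkcond; have [nJ|/ltnW Jn] := leqP n J.
  transitivity (\sum_(i < n) 1)%N; last by rewrite sum1_card card_ord.
  by apply: eq_bigr => i _; rewrite inE (leq_trans (ltn_ord i) nJ).
transitivity (\sum_(i < n) ((i < J) && xpredT i))%N.
  by apply: eq_bigr => i _; rewrite andbT inE; case: ifP.
by rewrite (@sum_ord_lt n J xpredT) // sum1_card card_ord.
Qed.

Section Blocks.
Variables (F : fieldType) (s : jordan_type F).

Lemma big_block (T : Type) (idx : T) (op : T -> T -> T) (f : F -> nat -> T) :
  \big[op/idx]_(k < size s) f (block_value s k) (block_size s k) =
  \big[op/idx]_(b <- s) f b.1 b.2.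
Proof.
rewrite (big_nth (0, 0%N)) big_mkord; apply: eq_bigr => k _.
by rewrite /block_value /block_size !(nth_map (0, 0%N)).
Qed.

Lemma dual_partE (z : F) (j : nat) :
  dual_part s z j = (\sum_(b <- s) ((b.1 == z) && (j < b.2)))%N.
Proof. by rewrite /dual_part -sum1_count big_mkcond. Qed.

Lemma sum_dual_part (z : F) (J : nat) :
  (\sum_(j < J) dual_part s z j = \sum_(b <- s) (b.1 == z) * minn b.2 J)%N.
Proof.
transitivity (\sum_(j < J) \sum_(b <- s) ((b.1 == z) && (j < b.2)))%N.
  by apply: eq_bigr => j _; apply: dual_partE.
rewrite exchange_big /=; apply: eq_bigr => b _.
case: (b.1 == z); last by rewrite big1.
rewrite mul1n minnC -card_ord_lt -sum1_card [RHS]big_mkcond.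
by apply: eq_bigr => j _; rewrite /= inE; case: ifP.
Qed.

End Blocks.

Section Symmetry.
Variables (F : fieldType) (r : nat) (eps : int) (B g : 'M[F]_r).
Variable s : jordan_type F.
Hypothesis two_neq0 : 2%:R != 0 :> F.
Hypothesis hB : nondegenerate_form eps B.
Hypothesis hg : form_group B g.
Hypothesis g_jordan : has_jordan_type g s.

Let n_ (k : 'I_(size s)) := block_size s k.
Let z_ (k : 'I_(size s)) := block_value s k.

Lemma sum_block_card (P : forall k, pred 'I_(n_ k)) :
  #|[pred x : 'I_(\sum_k n_ k) | P (tagnat.sig1 x) (tagnat.sig2 x)]| =
  (\sum_k #|P k|)%N.
Proof.
transitivity (\sum_k \sum_(i < n_ k) P k i)%N; last first.
  by apply: eq_bigr => k _; rewrite -sum1_card [RHS]big_mkcond.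
rewrite sig_big_dep (reindex _ tagnat.sig_bij_on) /= -[LHS]sum1_card [LHS]big_mkcond.
by apply: eq_bigr => x.
Qed.

(** In the Cayley basis, B becomes an invertible invariant form W whose blocks pair inverse
    eigenvalues and vanish when i + j reaches the size. So the last J rows of the blocks at z are
    supported on the first J columns of the blocks at z^-1. *)
Lemma sum_min_le (z : F) (J : nat) : z != 0 ->
  (\sum_k (z_ k == z) * minn (n_ k) J <= \sum_k (z_ k == z^-1) * minn (n_ k) J)%N.
Proof.
move=> z0.
have [Bu _] := hB; have gB : g *m B *m g^T = B := hg.
have gu := form_group_unit hB hg.
have [P [Q [PQ QP gE]]] := jordan_cayley two_neq0 gu g_jordan.
set G := \mxdiag_(k < _) _ in gE.
pose W := Q *m B *m Q^T.
have PQt : P^T *m Q^T = 1%:M by rewrite -trmx_mul QP trmx1.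
have QPt : Q^T *m P^T = 1%:M by rewrite -trmx_mul PQ trmx1.
have Wu : W \in unitmx.
  have /mulmx1_unit[] // : W *m (P^T *m invmx B *m P) = 1%:M.
  rewrite /W !mulmxA -[Q *m B *m _ *m _]mulmxA QPt mulmx1.
  by rewrite -[Q *m B *m _]mulmxA mulmxV // mulmx1.
have GW : G *m W *m G^T = W.
  have GE : G = Q *m g *m P by rewrite gE !mulmxA QP mul1mx -mulmxA QP mulmx1.
  rewrite /W GE !trmx_mul.
  have -> : Q *m g *m P *m (Q *m B *m Q^T) *m (P^T *m (g^T *m Q^T)) =
      Q *m (g *m (P *m Q) *m B *m (Q^T *m P^T) *m g^T) *m Q^T.
    by rewrite !mulmxA.
  by rewrite PQ QPt !mulmx1 [g *m B *m _]gB.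
pose R k : pred 'I_(n_ k) := fun i => (z_ k == z) && (n_ k <= i + J)%N.
pose C k : pred 'I_(n_ k) := fun i => (z_ k == z^-1) && (i < J)%N.
have RE k : #|R k| = ((z_ k == z) * minn (n_ k) J)%N.
  rewrite /R; case: (z_ k == z); last by rewrite mul0n; apply: eq_card0.
  rewrite mul1n -card_ord_lt -!sum1_card (reindex_inj rev_ord_inj).
  apply: eq_bigl => i; rewrite !inE /= -[LHS]/(n_ k <= n_ k - i.+1 + J)%N.
  by have := ltn_ord i; lia.
have CE k : #|C k| = ((z_ k == z^-1) * minn (n_ k) J)%N.
  rewrite /C; case: (z_ k == z^-1); last by rewrite mul0n; apply: eq_card0.
  by rewrite mul1n -card_ord_lt.
rewrite -(eq_bigr _ (fun k _ => RE k)) -(eq_bigr _ (fun k _ => CE k)).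
rewrite -!sum_block_card; apply: (unit_support_card Wu) => x y /andP[/eqP zx Jx] Wxy.
have Wxy' : entry (@submxblock F _ _ n_ n_ W (tagnat.sig1 x) (tagnat.sig1 y))
    (tagnat.sig2 x) (tagnat.sig2 y) != 0 by rewrite entry_ord mxE !tagnat.sig2K.
have GWxy := conj_blockE z_ W (tagnat.sig1 x) (tagnat.sig1 y).
rewrite [X in submxblock X]GW in GWxy.
have [zz|zz] := eqVneq (z_ (tagnat.sig1 x) * z_ (tagnat.sig1 y)) 1; last first.
  by move: Wxy'; rewrite (cayley_form_eq0 zz (esym GWxy)) entry0 eqxx.
apply/andP; split; first by apply/eqP; rewrite -zx; apply: (mulfI z0); rewrite -{1}zx zz zx mulfV.
move: Wxy'; rewrite ((cayley_form_alternate two_neq0 _ zz).1 (esym GWxy)).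
rewrite mulf_eq0 signr_eq0 /= => W0.
have [|ga] := ltnP (tagnat.sig2 x + tagnat.sig2 y) (n_ (tagnat.sig1 x)).
  by move=> h; have := leq_trans h Jx; rewrite ltn_add2l.
case/negP: W0; move: ((cayley_form_alternate two_neq0 _ zz).1 (esym GWxy)
  (tagnat.sig2 x + tagnat.sig2 y)%N 0%N).
by rewrite addn0 entry_row_out // => /esym/eqP; rewrite mulf_eq0 signr_eq0.
Qed.

Lemma sum_dual_part_le (z : F) (J : nat) : z != 0 ->
  (\sum_(j < J) dual_part s z j <= \sum_(j < J) dual_part s z^-1 j)%N.
Proof.
move=> /(sum_min_le J); rewrite !sum_dual_part /n_ /z_.
by rewrite !(big_block s _ _ (fun x n => ((x == _) * minn n J)%N)).
Qed.

(** Exchanging z and z^-1 makes the partial sums equal, and the parts are their differences. *)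
Lemma dual_part_inv (z : F) (j : nat) : dual_part s z^-1 j = dual_part s z j.
Proof.
have [->|z0] := eqVneq z 0; first by rewrite invr0.
have E J : (\sum_(j < J) dual_part s z^-1 j = \sum_(j < J) dual_part s z j)%N.
  apply/eqP; rewrite eqn_leq [X in _ && X]sum_dual_part_le // andbT.
  by rewrite -{2}[z]invrK sum_dual_part_le // invr_eq0.
by have := E j.+1; rewrite !big_ord_recr /= E => /addnI.
Qed.

End Symmetry.

(** * Dimensions in terms of Jordan blocks *)

Section Dimension.
Variables (F : fieldType) (r : nat) (eps : int) (B g : 'M[F]_r).
Variable s : jordan_type F.
Hypothesis two_neq0 : 2%:R != 0 :> F.
Hypothesis eps1 : eps = 1 \/ eps = -1.
Hypothesis hB : nondegenerate_form eps B.
Hypothesis hg : form_group B g.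
Hypothesis g_jordan : has_jordan_type g s.

Lemma dim_lie_centralizer_blocks : 2 * (\dim (lie_centralizer B g))%:Z =
  \sum_(a <- s) \sum_(b <- s) (a.1 * b.1 == 1)%:Z * (minn a.2 b.2)%:Z -
  eps * \sum_(a <- s) ((a.1 * a.1 == 1) && odd a.2)%:Z.
Proof.
pose M := (\max_(k < size s) block_size s k)%N.
have sM k : (block_size s k <= M)%N.
  have [ks|sk] := ltnP k (size s); first exact: (leq_bigmax (Ordinal ks)).
  by rewrite /block_size nth_default // size_map.
rewrite (dim_lie_centralizer two_neq0 eps1 hB hg g_jordan sM) card_free_coord //.
have -> : (-1) ^+ (eps == 1) = - eps by case: eps1 => ->.
rewrite mulNr; congr (_ - _ * _).
  rewrite (big_block s _ _ (fun x n => \sum_(k < size s)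
    (x * block_value s k == 1)%:Z * (minn n (block_size s k))%:Z)).
  apply: eq_bigr => a _.
  by rewrite (big_block s _ _ (fun x n => (a.1 * x == 1)%:Z * (minn a.2 n)%:Z)).
by rewrite (big_block s _ _ (fun x n => ((x * x == 1) && odd n)%:Z)).
Qed.

End Dimension.

Section GroupDimension.
Variables (F : fieldType) (r : nat) (eps : int) (B : 'M[F]_r).
Hypothesis two_neq0 : 2%:R != 0 :> F.
Hypothesis eps1 : eps = 1 \/ eps = -1.
Hypothesis hB : nondegenerate_form eps B.

Lemma sum_block_size (s : jordan_type F) (g : 'M[F]_r) :
  has_jordan_type g s -> (\sum_(b <- s) b.2 = r)%N.
Proof.
case=> _ [P [Q [PQ QP _]]].
rewrite -(big_block s _ _ (fun _ n => n)); apply/eqP; rewrite eqn_leq.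
rewrite -{1}(mxrank1 F (\sum_(k < size s) _)) -{2}(mxrank1 F r) -PQ -QP.
by rewrite !(leq_trans (mxrankM_maxl _ _)) // ?rank_leq_col.
Qed.

Lemma jordan_type1 : has_jordan_type (1%:M : 'M[F]_r) (nseq r (1, 1%N)).
Proof.
split; first by apply/allP => b /nseqP[->].
set s := nseq r _.
have val (k : 'I_(size s)) : block_value s k = 1 /\ block_size s k = 1%N.
  have kr : (k < r)%N by rewrite (leq_trans (ltn_ord k)) // size_nseq.
  by rewrite /block_value /block_size !(nth_map (0, 0%N)) ?size_nseq // nth_nseq kr.
have J1 : jordan_mx s = 1%:M.
  rewrite /jordan_mx -mxdiagZ; apply: eq_mxdiag => k; apply/matrixP => i j.
  rewrite !mxE (val k).1.
  have := ltn_ord i; have := ltn_ord j; rewrite {2 4}(val k).2 !ltnS !leqn0.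
  by move=> /eqP j0 /eqP i0; rewrite i0 j0 addr0.
have : (\sum_(k < size s) block_size s k)%N = r.
  transitivity (\sum_(k < size s) 1)%N; first by apply: eq_bigr => k _; case: (val k).
  by rewrite sum1_card card_ord size_nseq.
(* The size of [jordan_mx s] is r only propositionally, so it is generalized before the
   substitution. *)
move: (jordan_mx s) J1; move: (\sum_(k < _) _)%N => N J J1 Nr; subst N.
by exists 1%:M, 1%:M; rewrite J1 !mulmx1.
Qed.

(** The centralizer formula at g = 1, which has r blocks of size 1. *)
Lemma group_dimE : 2 * (group_dim B)%:Z = r%:Z * r%:Z - eps * r%:Z.
Proof.
have g1 : form_group B 1%:M by rewrite /form_group /= mul1mx trmx1 mulmx1.
have := dim_lie_centralizer_blocks two_neq0 eps1 hB g1 jordan_type1.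
have -> : lie_centralizer B 1%:M = lie_algebra B.
  apply/capv_idPl/subvP => X _; rewrite memv_ker lfunE /= /dconj.
  by rewrite mul1mx mulmx1 subrr.
rewrite -/(group_dim B) => ->.
have sum_nseq (f : F * nat -> int) : \sum_(b <- nseq r (1, 1%N)) f b = f (1, 1%N) * r%:Z.
  by rewrite big_nseq iter_addr_0 -mulr_natr natz.
by rewrite !sum_nseq /= mulr1 eqxx minnn !mul1r.
Qed.

End GroupDimension.

(** * The spectrum of a Jordan type *)

Lemma Posz_sum (I : Type) (s : seq I) (f : I -> nat) :
  (\sum_(i <- s) f i)%N%:Z = \sum_(i <- s) (f i)%:Z.
Proof. exact: (big_morph Posz PoszD). Qed.

(** A block of size n adds 1 to the first n dual parts; hence the alternating sum of the dual parts
    counts the odd blocks. *)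
Lemma altsum_iota_lt (n m k : nat) : (m <= n <= m + k)%N ->
  altsum [seq (j < n)%N%:Z | j <- iota m k] = (odd (n - m))%:Z.
Proof.
have out k' m' : (n <= m')%N -> altsum [seq (j < n)%N%:Z | j <- iota m' k'] = 0.
  elim: k' m' => [|k' IH] m' nm //=.
  have -> : (m' < n)%N = false by rewrite ltnNge nm.
  by rewrite IH // ltnW.
elim: k m => [|k IH] m /andP[mn nk].
  have -> : n = m by move: mn nk; lia.
  by rewrite subnn.
have [mn'|nm] := ltnP m n; last first.
  by rewrite out // (eqP (_ : n - m == 0)%N) // subn_eq0.
rewrite /= mn' IH; last by move: mn' nk; lia.
have -> : (n - m = (n - m.+1).+1)%N by move: mn'; lia.
by rewrite /=; case: (odd _).
Qed.

Lemma inverse_pairs (F : fieldType) (t : seq F) : uniq t ->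
  let zs := foldr (fun z zs => if (z == z^-1) || (z^-1 \in zs) then zs else z :: zs)
    [::] t in
  [/\ uniq zs, forall z, z \in zs -> (z \in t) && (z != z^-1),
      forall z, z \in zs -> z^-1 \notin zs
    & forall z, z \in t -> z != z^-1 -> (z \in zs) || (z^-1 \in zs)].
Proof.
elim: t => [|z t IH] //= /andP[zt /IH[]]; move: (foldr _ _ _) => zs U Ht V W {IH}.
case: ifPn => [zz|]; [|rewrite negb_or => /andP[z1 zV]]; split=> //.
- by move=> w /Ht /andP[wt ->]; rewrite inE wt orbT.
- move=> w; rewrite inE => /predU1P[->|]; last exact: W.
  by case/orP: zz => -> // _; rewrite orbT.
- by rewrite /= U andbT; apply/negP => /Ht; rewrite (negPf zt).
- move=> w; rewrite inE => /predU1P[->|/Ht/andP[wt ->]]; first by rewrite mem_head.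
  by rewrite inE wt orbT.
- move=> w; rewrite !inE => /predU1P[->|wz]; first by rewrite negb_or eq_sym z1.
  by rewrite negb_or V // andbT; apply: contra zV => /eqP <-; rewrite invrK.
- move=> w; rewrite !inE => /predU1P[->|wt w1]; first by rewrite eqxx.
  by case/orP: (W w wt w1) => ->; rewrite !orbT.
Qed.

Section JordanSpectrum.
Variables (F : fieldType) (s : jordan_type F).
Hypothesis two_neq0 : 2%:R != 0 :> F.
Hypothesis size_gt0 : all (fun b => 0 < b.2)%N s.
Hypothesis value_neq0 : forall b, b \in s -> b.1 != 0.
Hypothesis dual_inv : forall z j, dual_part s z^-1 j = dual_part s z j.

Let l := undup [seq b.1 | b <- s].
Let N := (\max_(b <- s) b.2)%N.

Definition jordan_spectrum : spectrum :=
  Spectrum (mkseq (e_part s) N) (mkseq (f_part s) N)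
    (sort geq (flatten [seq mkseq (dual_part s z) N | z <- pair_reps s])).

Lemma size_le (b : F * nat) : b \in s -> (b.2 <= N)%N.
Proof. by move=> bs; rewrite /N (big_rem b bs) /= leq_maxl. Qed.

Lemma dual_part_out (z : F) (j : nat) : (N <= j)%N -> dual_part s z j = 0%N.
Proof.
move=> Nj; apply/eqP; rewrite -leqn0 leqNgt -has_count; apply/hasPn => b /size_le bN.
by rewrite ltnNge (leq_trans bN Nj) andbF.
Qed.

Lemma dual_part_anti (z : F) (i j : nat) : (i <= j)%N ->
  (dual_part s z j <= dual_part s z i)%N.
Proof. by move=> ij; apply: sub_count => b /andP[-> /(leq_ltn_trans ij)]. Qed.

Lemma mem_eigenvalue (z : F) : (z \in l) = (0 < dual_part s z 0)%N.
Proof.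
rewrite mem_undup -has_count; apply/mapP/hasP => [[b bs ->]|[b bs /andP[/eqP<- _]]].
  by exists b; rewrite ?eqxx ?(allP size_gt0).
by exists b.
Qed.

Lemma dual_part_notin (z : F) (j : nat) : z \notin l -> dual_part s z j = 0%N.
Proof.
rewrite mem_eigenvalue lt0n negbK => /eqP z0; apply/eqP.
by rewrite -leqn0 -z0 dual_part_anti.
Qed.

Lemma eqV_sign (z : F) : z \in l -> (z == z^-1) = (z == 1) || (z == -1).
Proof.
rewrite mem_undup => /mapP[b bs ->]; have b0 := value_neq0 bs.
by rewrite -sqrf_eq1 expr2 -[LHS](inj_eq (mulfI b0)) mulfV.
Qed.

Lemma one_neqN1 : 1 != -1 :> F.
Proof. by rewrite -subr_eq0 opprK. Qed.

Lemma sum_eigenvalues (G : F -> int) :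
  (forall z, G z^-1 = G z) -> (forall z, z \notin l -> G z = 0) ->
  \sum_(z <- l) G z = G 1 + G (-1) + (\sum_(z <- pair_reps s) G z) *+ 2.
Proof.
move=> Ginv G0; have [U Ht V W] := inverse_pairs (undup_uniq [seq b.1 | b <- s]).
rewrite -/l -/(pair_reps s) in U Ht V W.
have linv z : (z^-1 \in l) = (z \in l) by rewrite !mem_eigenvalue dual_inv.
have mem_map_inv z (zs : seq F) : (z \in [seq w^-1 | w <- zs]) = (z^-1 \in zs).
  by rewrite -[z in LHS]invrK mem_map //; exact: invr_inj.
pose signs := [seq z <- [:: 1; -1] | z \in l].
have signs_uniq : uniq signs by rewrite filter_uniq //= inE one_neqN1.
have mem_signs z : (z \in signs) = (z \in l) && (z == z^-1).
  by rewrite mem_filter; case: (boolP (z \in l)) => // /eqV_sign ->; rewrite !inE.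
have E : perm_eq l (signs ++ pair_reps s ++ [seq z^-1 | z <- pair_reps s]).
  apply: uniq_perm; rewrite ?undup_uniq //.
    rewrite !cat_uniq signs_uniq U map_inj_uniq ?U; last exact: invr_inj.
    apply/and5P; split=> //; apply/hasPn => z.
      rewrite mem_cat mem_map_inv => zr; rewrite /= mem_signs negb_and orbC.
      by case/orP: zr => /Ht/andP[_]; rewrite ?invrK 1?eq_sym => ->.
    by rewrite mem_map_inv; apply: contraL => /V.
  move=> z; rewrite !mem_cat mem_signs mem_map_inv; apply/idP/idP => [zl|].
    by rewrite zl; have [//|z1] := eqVneq z z^-1; apply: W.
  by case/or3P => [/andP[]//|/Ht/andP[]//|/Ht/andP[+ _]]; rewrite linv.
rewrite (perm_big _ E) !big_cat big_map /=.
rewrite [X in _ + (_ + X)](eq_bigr G) //.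
rewrite big_filter big_mkcond !big_cons big_nil /= addr0.
have GE z : (if z \in l then G z else 0) = G z by case: ifPn => // /G0.
by rewrite !GE.
Qed.

Lemma sum_mkseq (h : int -> int) (f : nat -> nat) (n : nat) :
  \sum_(q <- mkseq f n) h q%:Z = \sum_(j < n) h (f j)%:Z.
Proof. by rewrite big_map -{1}[n]subn0 big_mkord. Qed.

(** h 0 = 0 discards the zero parts that the spectrum lists at 1 or -1 when these are not
    eigenvalues. *)
Lemma sum_parts (h : int -> int) : h 0 = 0 ->
  \sum_(q <- parts jordan_spectrum) h q%:Z =
  \sum_(z <- l) \sum_(j < N) h (dual_part s z j)%:Z.
Proof.
move=> h0; pose H z := \sum_(j < N) h (dual_part s z j)%:Z.
rewrite (@sum_eigenvalues H); last 2 first.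
- by move=> z; apply: eq_bigr => j _; rewrite dual_inv.
- by move=> z zl; apply: big1 => j _; rewrite dual_part_notin.
rewrite /parts !big_cat /= !sum_mkseq -/(H _) -/(H _) addrA; congr (_ + _).
  by rewrite /e_part /f_part /e_value; case: ifP; rewrite // opprK addrC.
rewrite mulr2n (perm_big _ (permEl (perm_sort geq _))) big_flatten big_map /=.
by congr (_ + _); apply: eq_bigr => z _; rewrite sum_mkseq.
Qed.

Lemma sum_by_value (H : F * nat -> int) :
  \sum_(b <- s) H b = \sum_(z <- l) \sum_(b <- s) (b.1 == z)%:Z * H b.
Proof.
rewrite exchange_big /= big_seq [RHS]big_seq; apply: eq_bigr => b bs.
have bl : b.1 \in l by rewrite mem_undup map_f.
rewrite (bigD1_seq b.1) ?undup_uniq //= eqxx mul1r big1 ?addr0 // => z.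
by rewrite eq_sym => /negPf->; rewrite mul0r.
Qed.

Lemma sum_dual (z : F) (c : nat -> int) :
  \sum_(b <- s) (b.1 == z)%:Z * (\sum_(j < b.2) c j) =
  \sum_(j < N) (dual_part s z j)%:Z * c j.
Proof.
have E j : (dual_part s z j)%:Z = \sum_(b <- s) ((b.1 == z) && (j < b.2)%N)%:Z.
  by rewrite dual_partE Posz_sum.
under [RHS]eq_bigr => j _ do rewrite E mulr_suml.
rewrite exchange_big big_seq [RHS]big_seq; apply: eq_bigr => b bs /=.
rewrite (big_ord_widen _ c (size_le bs)) mulr_sumr big_mkcond; apply: eq_bigr => j _.
by case: (b.1 == z); case: (j < b.2)%N; rewrite /= ?mul0r.
Qed.

Lemma total_jordan_spectrum :
  \sum_(q <- parts jordan_spectrum) q%:Z = (\sum_(b <- s) b.2)%N%:Z.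
Proof.
rewrite (@sum_parts id) // Posz_sum sum_by_value; apply: eq_bigr => z _.
transitivity (\sum_(j < N) (dual_part s z j)%:Z * 1).
  by apply: eq_bigr => j _; rewrite mulr1.
rewrite -(sum_dual z (fun=> 1)); apply: eq_bigr => b _.
by rewrite sumr_const card_ord natz.
Qed.

(** A sum of squares of dual parts is a sum over the blocks a of partial sums of dual parts up to
    a.2. By [dual_inv] these may be taken at the inverse eigenvalue, where they are sums of minima
    of sizes. *)
Lemma squares_jordan_spectrum : squares jordan_spectrum =
  \sum_(a <- s) \sum_(b <- s) (a.1 * b.1 == 1)%:Z * (minn a.2 b.2)%:Z.
Proof.
rewrite /squares (@sum_parts (fun x => x * x)) ?mulr0 // sum_by_value.
apply: eq_bigr => z _.
rewrite -(sum_dual z (fun j => (dual_part s z j)%:Z)) big_seq [RHS]big_seq; apply: eq_bigr => a as_.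
have [az|_] := eqVneq a.1 z; last by rewrite !mul0r.
congr (_ * _); rewrite -az.
transitivity (\sum_(j < a.2) dual_part s a.1^-1 j)%N%:Z.
  by rewrite Posz_sum; apply: eq_bigr => j _; rewrite dual_inv.
rewrite sum_dual_part Posz_sum; apply: eq_bigr => b _.
rewrite PoszM minnC; congr ((_ : bool)%:Z * _).
by rewrite -[LHS](inj_eq (mulfI (value_neq0 as_))) mulfV ?value_neq0.
Qed.

Lemma altsum_dual (z : F) : altsum (map Posz (mkseq (dual_part s z) N)) =
  \sum_(b <- s) (b.1 == z)%:Z * (odd b.2)%:Z.
Proof.
have : all (fun b => b.2 <= N)%N s by apply/allP => b /size_le.
rewrite -map_comp; move: N => M; elim: {+}s => [_|b t IH /= /andP[bM tM]].
  rewrite big_nil; elim: (iota 0 M) => [|j w IH] //=.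
  by move: IH => /= ->.
rewrite big_cons -(IH tM) -[b.2 in RHS]subn0 -(@altsum_iota_lt _ _ M) //.
rewrite -[altsum _ in X in _ + X]mul1r -altsum_linear; congr altsum.
by apply: eq_map => j /=; rewrite mul1r PoszD; case: (b.1 == z); rewrite /= ?mul1r ?mul0r.
Qed.

Lemma signed_sum_jordan_spectrum : signed_sum Posz jordan_spectrum =
  \sum_(a <- s) ((a.1 * a.1 == 1) && odd a.2)%:Z.
Proof.
have -> : signed_sum Posz jordan_spectrum =
    \sum_(b <- s) (b.1 == 1)%:Z * (odd b.2)%:Z +
    \sum_(b <- s) (b.1 == -1)%:Z * (odd b.2)%:Z.
  rewrite -!altsum_dual /signed_sum /= /e_part /f_part /e_value.
  by case: ifP; rewrite // opprK addrC.
rewrite -big_split; apply: eq_bigr => b _ /=.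
rewrite -expr2 sqrf_eq1; have [->|_] := eqVneq b.1 1.
  by rewrite (negPf one_neqN1) mul1r mul0r addr0.
by rewrite mul0r add0r; case: (b.1 == -1); case: (odd _).
Qed.

Lemma nth_mkseq_dual (z : F) (j : nat) : nth 0%N (mkseq (dual_part s z) N) j = dual_part s z j.
Proof.
have [jN|Nj] := ltnP j N; first by rewrite nth_mkseq.
by rewrite nth_default ?size_mkseq // dual_part_out.
Qed.

Lemma top_m_jordan : top_m jordan_spectrum = m_part s 0.
Proof. by rewrite /top_m -nth0. Qed.

Lemma top_e_jordan : top_e jordan_spectrum = e_part s 0.
Proof. by rewrite /top_e -nth0 nth_mkseq_dual. Qed.

Lemma second_ef_jordan :
  second_ef jordan_spectrum = maxn (e_part s 1) (f_part s 0).
Proof. by rewrite /second_ef -!nth0 nth_behead !nth_mkseq_dual. Qed.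

Lemma jordan_spectrum_well_ordered : well_ordered jordan_spectrum.
Proof.
have srt z : sorted geq (mkseq (dual_part s z) N).
  rewrite /mkseq sorted_map; apply: sub_sorted (iota_ltn_sorted 0 N) => i j /= ij.
  by apply: dual_part_anti; apply: ltnW.
rewrite /well_ordered /descending !srt sort_sorted /=; last by move=> x y /=; apply: leq_total.
rewrite top_e_jordan -nth0 nth_mkseq_dual /f_part /e_part /e_value.
by case: ifPn => //; rewrite opprK -ltnNge; apply: ltnW.
Qed.

End JordanSpectrum.

Section JordanData.
Variables (F : fieldType) (r : nat) (eps : int) (B g : 'M[F]_r).
Variable s : jordan_type F.
Hypothesis two_neq0 : 2%:R != 0 :> F.
Hypothesis eps1 : eps = 1 \/ eps = -1.
Hypothesis hB : nondegenerate_form eps B.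
Hypothesis hg : form_group B g.
Hypothesis g_jordan : has_jordan_type g s.

Let size_gt0 : all (fun b => 0 < b.2)%N s := g_jordan.1.
Let dual_inv := dual_part_inv two_neq0 hB hg g_jordan.

Let value_neq0 (b : F * nat) : b \in s -> b.1 != 0.
Proof.
move=> bs; have i_lt : (index b s < size s)%N by rewrite index_mem.
have := block_value_neq0 (form_group_unit hB hg) g_jordan (Ordinal i_lt).
by rewrite /block_value (nth_map (0, 0%N)) //= nth_index.
Qed.

Lemma total_parts_of_class : \sum_(q <- parts (jordan_spectrum s)) q%:Z = r%:Z.
Proof.
by rewrite (total_jordan_spectrum two_neq0 size_gt0 value_neq0 dual_inv)
  (sum_block_size g_jordan).
Qed.

Lemma dim_lie_centralizer_excess :
  2 * (\dim (lie_centralizer B g))%:Z = excess eps (jordan_spectrum s).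
Proof.
rewrite (dim_lie_centralizer_blocks two_neq0 eps1 hB hg g_jordan) /excess.
by rewrite (squares_jordan_spectrum two_neq0 size_gt0 value_neq0 dual_inv)
  (signed_sum_jordan_spectrum s two_neq0).
Qed.

End JordanData.

Lemma MC_minimal_jordan (F : fieldType) (r : nat) (s : 'I_3 -> jordan_type F) :
  MC_inequalities r s ->
  MC_minimal r%:Z (jordan_spectrum (s ord0)) (jordan_spectrum (s (lift ord0 ord0)))
    (jordan_spectrum (s ord_max)).
Proof.
move=> mc.
have ord (i1 i2 i3 : 'I_3) : uniq [:: i1; i2; i3] -> MC_ordered r%:Z
    (jordan_spectrum (s i1)) (jordan_spectrum (s i2)) (jordan_spectrum (s i3)).
  move=> /mc[/(_ 0%N) M E /(_ 0%N) ME F1 F2].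
  rewrite /MC_ordered !top_m_jordan !top_e_jordan second_ef_jordan.
  have half a b c d : a%:R + b%:R + (c + d)%N%:R / 2 <= r%:R :> rat ->
      (2 * (a + b) + (c + d) <= 2 * r)%N.
    move=> H; rewrite -(ler_nat rat) natrD !natrM natrD; lra.
  move: (half _ _ _ _ F1) (half _ _ _ _ F2) M E ME; clear; lia.
by rewrite /MC_minimal !ord.
Qed.

Theorem theorem2p19 (R : realType) (d r : nat) (eps : int)
    (B : 'M[R[i]]_r) (c : 'I_3 -> 'M[R[i]]_r)
    (hd : (2 <= d)%N)
    (heps : eps = 1 \/ eps = -1)
    (hB : nondegenerate_form eps B)
    (hc : forall i, form_group B (c i))
    (hmin : numerically_MC_minimal c)
    (hdim : char_variety_has_dim B c d) :
  (r <= 9 * d + 54)%N.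
Proof.
have two_neq0 : 2%:R != 0 :> R[i] by rewrite pnatr_eq0.
case: hmin => _ [s [js mc]]; case: hdim => _ dimE.
have rE i := esym (total_parts_of_class two_neq0 hB (hc i) (js i)).
have exE i := dim_lie_centralizer_excess two_neq0 heps hB (hc i) (js i).
have wo i := jordan_spectrum_well_ordered (s i).
(* With D = 2 d, the bound 2 r <= 9 D + 108 is the claim, and d >= 2 is D >= 4. The formula for D
   follows from dim C_i = dim G - dim Z_i. *)
have := @numeric_bound eps r%:Z (2 * d%:Z) _ _ _ heps (wo _) (wo _) (wo _)
  (rE _) (rE _) (rE _) (MC_minimal_jordan mc).
have gE := group_dimE two_neq0 heps hB.
have cE i := class_dimE B (c i).
move: dimE; rewrite !big_ord_recl big_ord0.
rewrite -!exE -gE; move: hd (cE ord0) (cE (lift ord0 ord0)) (cE ord_max).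
have -> : lift ord0 (lift ord0 ord0) = ord_max :> 'I_3 by apply: val_inj.
clear; lia.
Qed.
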